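(* Let $(M,g)$ be a smooth compact Riemannian manifold of dimension $n\ge 2$ with smooth boundary $\partial M$. There are constants $C=C(M,g)$ and $\lambda_0=\lambda_0(M,g)>0$, depending only on $(M,g)$, such that for every $\lambda\ge\lambda_0$ and every function $u$ on $M$ satisfying $(\Delta+\lambda^2)u=0$ on $M$, either the Dirichlet boundary condition $u|_{\partial M}=0$ or the Neumann boundary condition $\partial_n u|_{\partial M}=0$, and the normalization $\|u\|_{L^2(M)}=1$, one has $$\|u\|_\infty=\max_{x\in M}|u(x)|\le C\,\lambda^{(n-1)/2}.$$
   Context: $\Delta$ denotes the Laplace-Beltrami operator of $(M,g)$ acting on functions, with the sign convention that $-\Delta$ is nonnegative. $\partial_n$ denotes the outward normal derivative at $\partial M$. The $L^2$ norm is taken with respect to the Riemannian volume. *)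

(* Defs.v *)
From HB Require Import structures.
From mathcomp Require Import all_boot all_order all_algebra.
From mathcomp Require Import all_classical all_reals all_analysis.

Set Implicit Arguments.
Unset Strict Implicit.
Unset Printing Implicit Defensive.

Import Order.TTheory GRing.Theory Num.Theory.
Import numFieldTopology.Exports numFieldNormedType.Exports.

Local Open Scope classical_set_scope.
Local Open Scope ring_scope.

(* Throughout, manifolds have dimension n.+1 and are modelled on the closed
   half-space of R^(n+1) where the coordinate of index 0 is nonnegative. *)

Section HalfSpaceCalculus.
Variables (R : realType) (n : nat).
Implicit Types (f : 'rV[R]_n.+1 -> R) (k : 'I_n.+1) (x : 'rV[R]_n.+1).

Definition half_space : set 'rV[R]_n.+1 := [set x | 0 <= x 0 0].

Definition diff_quotient f k x : R -> R :=
  fun h => h^-1 * (f (x + h *: delta_mx 0 k) - f x).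

(* Increments leaving the half-space are discarded: at a point of the boundary
   hyperplane the derivative in direction 0 is the one-sided (inward) one;
   elsewhere in the half-space this is the usual partial derivative. *)
Definition increments k x : set_system R :=
  within [set h | half_space (x + h *: delta_mx 0 k)] 0^'.

Definition pderivable f k x : Prop :=
  cvg (diff_quotient f k x @ increments k x).

Definition pderiv f k x : R :=
  lim (diff_quotient f k x @ increments k x).

(* C^m up to the boundary, for V relatively open in the half-space; by the
   Whitney-Seeley extension theorem, [smooth] below agrees with the existence of
   local smooth extensions to open subsets of R^(n+1). *)
Fixpoint Ck (m : nat) (V : set 'rV[R]_n.+1) f : Prop :=
  match m with
  | 0 => {within V, continuous f}
  | m'.+1 => {within V, continuous f} /\
      forall k, (forall x, V x -> pderivable f k x) /\ Ck m' V (pderiv f k)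
  end.

Definition smooth (V : set 'rV[R]_n.+1) f : Prop := forall m, Ck m V f.

End HalfSpaceCalculus.

(* The Lebesgue integral over R^n of a nonnegative Borel function, as an
   iterated integral (Tonelli). *)
Fixpoint lebesgue_integral_rV (R : realType) (n : nat) :
    ('rV[R]_n -> \bar R) -> \bar R :=
  match n with
  | 0 => fun F => F 0
  | n'.+1 => fun F => (\int[@lebesgue_measure R]_(t in setT)
      lebesgue_integral_rV (fun v : 'rV[R]_n' => F (row_mx t%:M v)))%E
  end.

(* A smooth manifold with (possibly empty) boundary, given by a smooth atlas.
   [param i] is the inverse of [chart i]; outside their respective domains the
   values of these total functions are irrelevant. *)
Record smooth_manifold (R : realType) (n : nat) (M : ptopologicalType) :=
  SmoothManifold {
    index : Type;
    dom : index -> set M;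
    chart : index -> M -> 'rV[R]_n.+1;
    param : index -> 'rV[R]_n.+1 -> M;
    chart_at : M -> index;
    hausdorff_axiom : hausdorff_space M;
    second_countable_axiom : @second_countable M;
    dom_chart_at : forall p, dom (chart_at p) p;
    dom_open : forall i, open (dom i);
    image_open : forall i, exists2 O : set 'rV[R]_n.+1,
      open O & chart i @` dom i = O `&` @half_space R n;
    chartK : forall i p, dom i p -> param i (chart i p) = p;
    chart_continuous : forall i, {within dom i, continuous (chart i)};
    param_continuous : forall i,
      {within chart i @` dom i, continuous (param i)};
    transition_smooth : forall i j (k : 'I_n.+1),
      smooth (chart i @` (dom i `&` dom j))
             (fun x => chart j (param i x) 0 k) }.

(* M with its Borel sigma-algebra; this is what requires M to be pointed. *)
Notation borel M := (g_sigma_algebraType (@open M)).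

Section Manifold.
Variables (R : realType) (n : nat) (M : ptopologicalType).
Variable S : smooth_manifold R n M.

(* The chart used at p does not matter, transitions being diffeomorphisms. *)
Definition bdry : set M := [set p | chart (chart_at S p) p 0 0 = 0].

Definition Ck_on (m : nat) (u : M -> R) : Prop :=
  forall i : index S, Ck m (chart i @` dom i) (u \o param i).

(* Entry (k, l) is the partial derivative in direction k of the l-th component
   of the transition map, so that tangent vectors, as row vectors, transform by
   right multiplication. *)
Definition transition_jacobian (i j : index S) (x : 'rV[R]_n.+1) :
    'M[R]_n.+1 :=
  \matrix_(k, l) pderiv (fun y => chart j (param i y) 0 l) k x.

(* [metric i x] is the Gram matrix of the coordinate vector fields of chart i
   at the point of coordinates x. *)
Record riemannian_metric := RiemannianMetric {
  metric : index S -> 'rV[R]_n.+1 -> 'M[R]_n.+1;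
  metric_sym : forall i x, (chart i @` dom i) x ->
    (metric i x)^T = metric i x;
  metric_pos : forall i x, (chart i @` dom i) x ->
    forall v : 'rV[R]_n.+1, v != 0 -> 0 < (v *m metric i x *m v^T) 0 0;
  metric_smooth : forall i (k l : 'I_n.+1),
    smooth (chart i @` dom i) (fun x => metric i x k l);
  metric_transition : forall i j x,
    (chart i @` (dom i `&` dom j)) x ->
    metric i x = transition_jacobian i j x
                 *m metric j (chart j (param i x))
                 *m (transition_jacobian i j x)^T }.

Variable g : riemannian_metric.

Definition density (i : index S) (x : 'rV[R]_n.+1) : R :=
  Num.sqrt (\det (metric g i x)).

Definition differential (f : 'rV[R]_n.+1 -> R) (x : 'rV[R]_n.+1) :
    'rV[R]_n.+1 :=
  \row_k pderiv f k x.

Definition gradient (i : index S) (f : 'rV[R]_n.+1 -> R)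
    (x : 'rV[R]_n.+1) : 'rV[R]_n.+1 :=
  differential f x *m invmx (metric g i x).

Definition divergence (i : index S) (X : 'rV[R]_n.+1 -> 'rV[R]_n.+1)
    (x : 'rV[R]_n.+1) : R :=
  (density i x)^-1 * \sum_k pderiv (fun y => density i y * X y 0 k) k x.

(* Delta = div grad, hence -Delta is nonnegative. *)
Definition laplacian (u : M -> R) (p : M) : R :=
  let i := chart_at S p in
  divergence i (gradient i (u \o param i)) (chart i p).

(* The 0-th row of the inverse metric is the gradient of the coordinate of
   index 0: it is orthogonal to the boundary, points inward, and has squared
   length [invmx (metric g i x) 0 0]. *)
Definition outward_normal (i : index S) (x : 'rV[R]_n.+1) : 'rV[R]_n.+1 :=
  let G := invmx (metric g i x) in
  - ((Num.sqrt (G 0 0))^-1 *: row 0 G).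

Definition normal_derivative (u : M -> R) (p : M) : R :=
  let i := chart_at S p in
  let x := chart i p in
  \sum_k outward_normal i x 0 k * pderiv (u \o param i) k x.

Definition dirichlet (u : M -> R) : Prop := forall p, bdry p -> u p = 0.

Definition neumann (u : M -> R) : Prop :=
  forall p, bdry p -> normal_derivative u p = 0.

(* By countable additivity these identities determine mu. *)
Definition is_riemannian_volume (mu : {measure set (borel M) -> \bar R}) : Prop :=
  forall (i : index S) (A : set (borel M)), measurable A -> A `<=` dom i ->
    mu A = lebesgue_integral_rV
      (fun x => (\1_(chart i @` A) x * density i x)%:E).

End Manifold.

(* Main.v *)
(* In a chart, put rho = sqrt (det g) and G = rho g^-1: u becomes a solution v of
   div (G dv) = - lambda^2 rho v on a cube whose only face of interest lies on the
   boundary. Let x0 be a point where |u| is maximal and let the cube contain x0.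

   Rellich's identity for the field grad |x - x0| (distances being those of the
   constant metric G(x0)), regularised at scale 1/lambda, bounds the mass of v^2 on
   the ball of radius about 1/lambda around x0 by C/lambda times its mass on the
   cube. Adding the same field for the mirror image of x0 makes the multiplier
   tangent to the boundary, so that the boundary terms vanish under either boundary
   condition; since the mirror image lies outside the half-space, its contribution
   has a sign up to lower order terms.

   A mean value inequality at x0, obtained by testing the equation for v^2 with a
   truncated fundamental solution and again its mirror image, then gives
   v(x0)^2 <= C lambda^(n+1) * (C/lambda) * mass = C lambda^n; the error terms are
   absorbed because v^2 is maximal at x0. Compactness makes C uniform.

   All integrations by parts are carried out on Riemann sums: [null D] says that the
   averages of D over finer and finer grids tend to 0, and the derivative of a C^1
   function vanishing on two opposite faces is null by telescoping. *)

Require Import Defs.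
From mathcomp Require Import all_boot all_order all_algebra.
From mathcomp Require Import all_classical all_reals all_analysis.
From mathcomp Require Import perm ring lra measurable_realfun.

Set Implicit Arguments.
Unset Strict Implicit.
Unset Printing Implicit Defensive.

Import Order.TTheory GRing.Theory Num.Theory.
Import numFieldTopology.Exports numFieldNormedType.Exports.

Local Open Scope classical_set_scope.
Local Open Scope ring_scope.

(** * Calculus on the half-space *)

(** The Rellich field is [(t - eps/2 t^2) (x - x0)], with [t] the inverse regularised distance. The
    plain field [t (x - x0)] has a radial Hessian of order [eps^2 t^3] only, which decays too fast
    to absorb the lower order term carrying the gradient of its divergence, of order [t^2]. The
    quadratic correction raises the bound to [eps t^2], and a large value of [eps * lam] then closes
    the argument. In the mean value inequality the pole is smoothed at a scale [eta] that depends on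
    the solution. This is harmless: the mass of the smoothed pole is bounded below independently of
    [eta]. The singular weights left over, a truncated fundamental solution and a Riesz kernel, are
    not integrated directly. Up to a bounded function on a small ball, each is dominated by the
    divergence of a radial field, and divergences are null. All fields are radial for the constant
    metric at [x0]. The variable coefficients cost a factor [|G - G(x0)|], that is one power of
    [1/t]. *)

Section Calculus.
Variables (R : realType) (n : nat).
Local Notation vec := 'rV[R]_n.+1.
Local Notation H := (@half_space R n).
Local Notation e_ k := (delta_mx 0 k : vec).
Implicit Types (f g : vec -> R) (k l : 'I_n.+1) (x y : vec) (V : set vec).

Definition has_pderiv f k x (l : R) : Prop :=
  diff_quotient f k x @ increments k x --> l.

Lemma increments_filter k x : Filter (increments k x).
Proof. by apply: within_filter; apply: nbhs_filter. Qed.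
#[local] Existing Instance increments_filter.

Lemma increments_nearP k x (P : set R) :
  increments k x P <-> exists2 d : R, 0 < d &
    forall h, h != 0 -> `|h| < d -> H (x + h *: e_ k) -> P h.
Proof.
split.
  move=> /nbhs_ballP[d /= d0 dP]; exists d => // h h0 hd Hh.
  by apply: dP => //=; rewrite /ball /= sub0r normrN.
move=> [d d0 dP]; apply/nbhs_ballP; exists d => // h /=.
by rewrite /ball /= sub0r normrN => hd h0 Hh; exact: dP.
Qed.

(** An increment [h >= 0] stays in the half-space in every direction, so the filter is proper at
    boundary points too, and one-sided derivatives are unique there. *)
Lemma increments_proper k x : H x -> ProperFilter (increments k x).
Proof.
move=> Hx; apply: Build_ProperFilter => //.
move=> /increments_nearP[d d0 dP]; apply: (dP (d / 2)).
- by rewrite gt_eqF// divr_gt0.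
- by rewrite gtr0_norm ?divr_gt0// ltr_pdivrMr// ltr_pMr// ltr1n.
- by move: Hx; rewrite /half_space/= !mxE => Hx; rewrite addr_ge0// mulr_ge0 ?ler0n// divr_ge0// ltW.
Qed.

Lemma has_pderivP f k x (a : R) : has_pderiv f k x a <->
  forall e : R, 0 < e -> exists2 d : R, 0 < d & forall h, `|h| < d ->
    H (x + h *: e_ k) -> `|f (x + h *: e_ k) - f x - h * a| <= e * `|h|.
Proof.
split.
  move=> /cvgrPdist_le + e e0 => /(_ e e0) /increments_nearP[d d0 dP].
  exists d => // h hd Hh; have [->|h0] := eqVneq h 0.
    by rewrite scale0r addr0 subrr mul0r subrr normr0 mulr0.
  have /= := dP h h0 hd Hh; rewrite /diff_quotient.
  have -> : f (x + h *: e_ k) - f x - h * a =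
    - h * (a - h^-1 * (f (x + h *: e_ k) - f x)) by field.
  by move=> hh; rewrite normrM normrN mulrC ler_wpM2r.
move=> fP; apply/cvgrPdist_le => e e0; apply/increments_nearP.
have [d d0 dP] := fP e e0; exists d => // h h0 hd Hh.
have := dP h hd Hh; rewrite /diff_quotient.
have -> : f (x + h *: e_ k) - f x - h * a =
    - h * (a - h^-1 * (f (x + h *: e_ k) - f x)) by field.
by rewrite normrM normrN mulrC ler_pM2r// normr_gt0.
Qed.

Lemma has_pderiv_unique f k x a b : H x ->
  has_pderiv f k x a -> has_pderiv f k x b -> a = b.
Proof.
move=> /(increments_proper k) ? fa fb.
exact: (cvg_unique _ fa fb).
Qed.

Lemma pderivE f k x a : H x -> has_pderiv f k x a -> pderiv f k x = a.
Proof.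
by move=> /(increments_proper k) ? fa; apply: cvg_lim.
Qed.

Lemma has_pderivW f k x a : has_pderiv f k x a -> pderivable f k x.
Proof. by move=> fa; apply/cvg_ex; exists a. Qed.

Lemma pderivableP f k x : pderivable f k x -> has_pderiv f k x (pderiv f k x).
Proof. by []. Qed.

Lemma has_pderiv_cvg f k x a : has_pderiv f k x a ->
  (fun h => f (x + h *: e_ k)) @ increments k x --> f x.
Proof.
move=> fa.
have idc : (fun h : R => h) @ increments k x --> (0 : R).
  by apply/cvgrPdist_le => e e0; apply/increments_nearP; exists e => // h _ + _;
     rewrite sub0r normrN => /ltW.
have : (fun h => f x + h * diff_quotient f k x h) @ increments k x --> f x + 0 * a.
  by apply: cvgD; [exact: cvg_cst|exact: cvgM].
rewrite mul0r addr0; apply: cvg_trans; apply: near_eq_cvg.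
apply/increments_nearP; exists 1 => // h h0 _ _.
by rewrite /diff_quotient mulrA mulfV// mul1r addrC subrK.
Qed.

Lemma has_pderiv_near f g k x a (d : R) : 0 < d -> f x = g x ->
  (forall h, `|h| < d -> H (x + h *: e_ k) -> f (x + h *: e_ k) = g (x + h *: e_ k)) ->
  has_pderiv f k x a -> has_pderiv g k x a.
Proof.
move=> d0 fgx fg; apply: cvg_trans; apply: near_eq_cvg; apply/increments_nearP.
by exists d => // h h0 hd Hh; rewrite /diff_quotient fgx fg.
Qed.

Lemma has_pderiv_cst c k x : has_pderiv (fun=> c) k x 0.
Proof.
apply/has_pderivP => e e0; exists 1 => // h _ _.
by rewrite mulr0 !subrr normr0 mulr_ge0// ltW.
Qed.

Lemma has_pderiv_coord j k x : has_pderiv (fun y => y 0 j) k x (k == j)%:R.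
Proof.
apply/has_pderivP => e e0; exists 1 => // h _ _; rewrite !mxE eqxx /= (eq_sym j).
by rewrite (addrC (x 0 j)) addrK subrr normr0 mulr_ge0// ltW.
Qed.

Lemma has_pderivD f g k x a b : has_pderiv f k x a -> has_pderiv g k x b ->
  has_pderiv (fun y => f y + g y) k x (a + b).
Proof.
move=> fa gb.
have : diff_quotient f k x \+ diff_quotient g k x @ increments k x --> a + b.
  by apply: cvgD.
apply: cvg_trans; apply: near_eq_cvg; apply/increments_nearP.
by exists 1 => // h _ _ _ /=; rewrite /diff_quotient; ring.
Qed.

Lemma has_pderivM f g k x a b : has_pderiv f k x a -> has_pderiv g k x b ->
  has_pderiv (fun y => f y * g y) k x (a * g x + f x * b).
Proof.
move=> fa gb.
have : (fun h => diff_quotient f k x h * g (x + h *: e_ k)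
    + f x * diff_quotient g k x h) @ increments k x --> a * g x + f x * b.
  apply: cvgD; apply: cvgM => //; first exact: has_pderiv_cvg gb.
  exact: cvg_cst.
apply: cvg_trans; apply: near_eq_cvg; apply/increments_nearP.
by exists 1 => // h _ _ _; rewrite /diff_quotient; ring.
Qed.

Lemma has_pderivZ c f k x a : has_pderiv f k x a ->
  has_pderiv (fun y => c * f y) k x (c * a).
Proof.
by move=> fa; have := has_pderivM (has_pderiv_cst c k x) fa; rewrite mul0r add0r.
Qed.

Lemma has_pderivN f k x a : has_pderiv f k x a ->
  has_pderiv (fun y => - f y) k x (- a).
Proof.
move=> fa; have := has_pderivZ (c := -1) fa; rewrite mulN1r.
by under eq_fun do rewrite mulN1r.
Qed.

Lemma has_pderivB f g k x a b : has_pderiv f k x a -> has_pderiv g k x b ->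
  has_pderiv (fun y => f y - g y) k x (a - b).
Proof. by move=> fa /has_pderivN; exact: has_pderivD. Qed.

Lemma has_pderiv_sum (I : Type) (r : seq I) (F : I -> vec -> R) k x (a : I -> R) :
  (forall i, has_pderiv (F i) k x (a i)) ->
  has_pderiv (fun y => \sum_(i <- r) F i y) k x (\sum_(i <- r) a i).
Proof.
move=> Fa; elim: r => [|i r IHr].
  by under eq_fun do rewrite big_nil; rewrite big_nil; exact: has_pderiv_cst.
by under eq_fun do rewrite big_cons; rewrite big_cons; exact: has_pderivD.
Qed.

Lemma has_pderiv_comp (phi : R -> R) f k x a b : has_pderiv f k x a ->
  is_derive (f x) 1 phi b -> has_pderiv (fun y => phi (f y)) k x (b * a).
Proof.
move=> /has_pderivP fP [dphi phib]; apply/has_pderivP => e e0.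
have [d2 d20 phiP] : exists2 d : R, 0 < d & forall h, `|h| < d ->
    `|phi (f x + h) - phi (f x) - h * b| <= e / 2 / (1 + `|a|) * `|h|.
  move: dphi => /cvg_ex[c]; move: (phib) => /[swap] cc; rewrite /derive.
  have -> : lim ((fun h : R => h^-1 *: ((phi \o shift (f x)) (h *: 1) - phi (f x))) @ 0^') = c.
    by apply: cvg_lim.
  move=> cb; move: cc; rewrite cb => /cvgrPdist_le.
  have e1 : 0 < e / 2 / (1 + `|a|) by rewrite !divr_gt0// ltr_pwDl.
  move=> /(_ _ e1) /nbhs_ballP[d /= d0 dP]; exists d => // h hd.
  have [->|h0] := eqVneq h 0; first by rewrite addr0 subrr mul0r subrr normr0 mulr0.
  have := dP h; rewrite /ball/= sub0r normrN => /(_ hd h0).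
  rewrite /= /GRing.scale/= mulr1 (addrC h).
  have -> : phi (f x + h) - phi (f x) - h * b = - h * (b - h^-1 * (phi (f x + h) - phi (f x))).
    by field.
  by move=> hh; rewrite normrM normrN mulrC ler_wpM2r.
set m := Num.min 1 (e / 2 / (1 + `|b|)).
have m0 : 0 < m by rewrite lt_min ltr01/= !divr_gt0// ltr_pwDl.
have [d1 d10 fd] := fP _ m0.
exists (Num.min d1 (d2 / (1 + `|a|))) => [|h].
  by rewrite lt_min d10 divr_gt0// ltr_pwDl.
rewrite lt_min => /andP[hd1 hd2] Hh; have := fd h hd1 Hh.
set D := f (x + _) - f x => hD.
have -> : f (x + h *: e_ k) = f x + D by rewrite /D addrCA subrr addr0.
have D1 : `|D| <= (1 + `|a|) * `|h|.
  have -> : D = (D - h * a) + h * a by rewrite subrK.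
  rewrite (le_trans (ler_normD _ _))// mulrDl lerD// ?normrM 1?mulrC//.
  by rewrite mulrC (le_trans hD)// ler_wpM2r// ge_min lexx.
have D2 : `|D| < d2.
  by rewrite (le_lt_trans D1)// mulrC -ltr_pdivlMr// ltr_pwDl.
have := phiP D D2 => pD.
have -> : phi (f x + D) - phi (f x) - h * (b * a) =
  (phi (f x + D) - phi (f x) - D * b) + (D - h * a) * b by ring.
rewrite (le_trans (ler_normD _ _))//.
have -> : e * `|h| = e / 2 * `|h| + e / 2 * `|h| by field.
apply: lerD.
  rewrite (le_trans pD)//.
  have a1 : 0 < 1 + `|a| by rewrite ltr_pwDl.
  rewrite -[leRHS](_ : e / 2 / (1 + `|a|) * ((1 + `|a|) * `|h|) = _); last first.
    by field; rewrite gt_eqF.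
  by rewrite ler_wpM2l// !divr_ge0// ltW.
have b1 : 0 < 1 + `|b| by rewrite ltr_pwDl.
rewrite normrM (le_trans (ler_wpM2r _ hD))//.
rewrite (@le_trans _ _ (e / 2 / (1 + `|b|) * `|h| * `|b|))//.
  by rewrite !ler_wpM2r// ge_min lexx orbT.
rewrite -mulrA (mulrC `|h|) mulrA ler_wpM2r//.
rewrite -[leRHS]mulr1 -mulrA ler_wpM2l ?divr_ge0 ?(ltW e0)//.
by rewrite mulrC ler_pdivrMr// mul1r lerDr.
Qed.

End Calculus.

(** * Functions of class C^k on relatively open sets *)

Section Smoothness.
Variables (R : realType) (n : nat).
Local Notation vec := 'rV[R]_n.+1.
Local Notation H := (@half_space R n).
Local Notation e_ k := (delta_mx 0 k : vec).
Implicit Types (f g : vec -> R) (k l : 'I_n.+1) (x y : vec) (V : set vec).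

Lemma coord_normP x (e : R) : 0 <= e -> (forall j, `|x 0 j| <= e) <-> `|x| <= e.
Proof.
move=> e0; rewrite [`|x|]/Num.norm /= mx_normrE; split=> [xe|/bigmax_leP[_ xe] j].
  by apply/bigmax_leP; split=> // -[i j] _ /=; rewrite ord1.
exact: (xe (0, j)).
Qed.

Lemma coord_norm_le x j : `|x 0 j| <= `|x|.
Proof. by have /(_ (normr_ge0 _))/iffRL := @coord_normP x `|x|; apply. Qed.

Lemma norm_delta_mx k : `|e_ k| <= 1.
Proof.
apply/coord_normP => // j; rewrite mxE eqxx /=.
by case: eqP => _; rewrite ?normr1 ?normr0.
Qed.

Lemma norm_scale_delta k (h : R) : `|h *: e_ k| <= `|h|.
Proof. by rewrite mx_normZ -[leRHS]mulr1 ler_wpM2l// norm_delta_mx. Qed.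

Lemma half_spaceD x k (h : R) : 0 <= h -> H x -> H (x + h *: e_ k).
Proof. by rewrite /half_space/= !mxE => h0 Hx; rewrite addr_ge0// mulr_ge0// ler0n. Qed.

Lemma within_continuousP V f : {within V, continuous f} <->
  forall x, V x -> forall e : R, 0 < e -> exists2 d : R, 0 < d &
    forall y, V y -> `|y - x| < d -> `|f y - f x| <= e.
Proof.
rewrite subspace_continuousP; split => [fV x Vx e e0|fV x Vx].
  have /cvgrPdist_le/(_ e e0) := fV x Vx.
  rewrite near_withinE => /nbhs_normP[d /= d0 dP]; exists d => // y Vy yx.
  by rewrite distrC; apply: dP => //=; rewrite /ball_ /= distrC.
apply/cvgrPdist_le => e e0; have [d d0 dP] := fV x Vx e e0.
rewrite near_withinE; apply: filterS (nbhsx_ballx x d d0) => y.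
by rewrite mx_norm_ball /ball_/= distrC => yx Vy; rewrite distrC; exact: dP.
Qed.

Definition rel_open V := exists2 O : set vec, open O & V = O `&` H.

Lemma rel_open_sub V : rel_open V -> V `<=` H.
Proof. by move=> [U _ ->] x []. Qed.

Lemma rel_openP V x : rel_open V -> V x -> exists2 d : R, 0 < d &
  forall y, H y -> `|y - x| < d -> V y.
Proof.
move=> [U Uo ->] [Ux Hx]; have : nbhs x U by exact: open_nbhs_nbhs.
move=> /nbhs_normP[d /= d0 dP]; exists d => // y Hy yx; split=> //.
by apply: dP; rewrite /ball_ /= distrC.
Qed.

Lemma rel_open_nbhs V : V `<=` H ->
  (forall x, V x -> exists2 d : R, 0 < d & forall y, H y -> `|y - x| < d -> V y) ->
  rel_open V.
Proof.
move=> VH Vn; exists (\bigcup_(U in [set U | open U /\ U `&` H `<=` V]) U).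
  by apply: bigcup_open => U [].
apply/seteqP; split => [x Vx|x [[U [_ UV] Ux] Hx]]; last exact: UV.
split; last exact: VH.
have [d d0 dP] := Vn x Vx; exists (ball x d); last exact: ballxx.
split; first exact: ball_open.
by move=> y [+ Hy]; rewrite mx_norm_ball /ball_/= => yx; apply: dP; rewrite // distrC.
Qed.

Lemma Ck_le m p V f : (m <= p)%N -> Ck p V f -> Ck m V f.
Proof.
elim: p m f => [[]//|p IHp [|m] f mp [fc df]]//; split=> // k.
by have [fd dc] := df k; split=> //; exact: IHp.
Qed.

Lemma Ck_continuous m V f : Ck m V f -> {within V, continuous f}.
Proof. by case: m => [//|m []]. Qed.

Lemma Ck_pderivable m V f k x : Ck m.+1 V f -> V x -> pderivable f k x.
Proof. by move=> [_ /(_ k)[+ _]]; exact. Qed.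

Lemma Ck_has_pderiv m V f k x : Ck m.+1 V f -> V x -> has_pderiv f k x (pderiv f k x).
Proof. by move=> Cf Vx; apply/pderivableP; exact: Ck_pderivable Cf Vx. Qed.

Lemma Ck_pderiv m V f k : Ck m.+1 V f -> Ck m V (pderiv f k).
Proof. by move=> [_ /(_ k)[]]. Qed.

Lemma Ck_sub m V W f : W `<=` V -> Ck m V f -> Ck m W f.
Proof.
move=> WV; elim: m f => [f|m IHm f [fc df]] /=; first exact: continuous_subspaceW.
split; first exact: continuous_subspaceW fc.
by move=> k; have [fd dc] := df k; split=> [x /WV/fd//|]; exact: IHm.
Qed.

Lemma eq_within_continuous V f g : (forall x, V x -> f x = g x) ->
  {within V, continuous f} -> {within V, continuous g}.
Proof.
by move=> fg; apply: subspace_eq_continuous => x; rewrite inE => /fg.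
Qed.

Lemma Ck1I V f (df : 'I_n.+1 -> vec -> R) : V `<=` H -> {within V, continuous f} ->
  (forall k x, V x -> has_pderiv f k x (df k x)) ->
  (forall k, {within V, continuous (df k)}) -> Ck 1 V f.
Proof.
move=> VH fc fd dc; split => // k; split => [x Vx|]; first exact: has_pderivW (fd k x Vx).
apply: eq_within_continuous (dc k) => x Vx.
by apply/esym/pderivE; [exact: VH|exact: fd].
Qed.

Lemma within_continuousD V f g : {within V, continuous f} -> {within V, continuous g} ->
  {within V, continuous (fun x => f x + g x)}.
Proof.
move=> /subspace_continuousP fc /subspace_continuousP gc.
by apply/subspace_continuousP => x Vx; apply: cvgD; [exact: fc|exact: gc].
Qed.

Lemma within_continuousM V f g : {within V, continuous f} -> {within V, continuous g} ->
  {within V, continuous (fun x => f x * g x)}.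
Proof.
move=> /subspace_continuousP fc /subspace_continuousP gc.
by apply/subspace_continuousP => x Vx; apply: cvgM; [exact: fc|exact: gc].
Qed.

Section closure.
Variable V : set vec.
Hypothesis VH : V `<=` H.

Lemma Ck1_cst c : Ck 1 V (fun=> c).
Proof.
apply: (@Ck1I _ _ (fun _ _ => 0)) => //.
- by move=> x; exact: cvg_cst.
- by move=> k x _; exact: has_pderiv_cst.
- by move=> k x; exact: cvg_cst.
Qed.

Lemma Ck1_coord j : Ck 1 V (fun x => x 0 j).
Proof.
apply: (@Ck1I _ _ (fun k _ => (k == j)%:R)) => //.
- apply/within_continuousP => x Vx e e0; exists e => // y Vy /ltW; apply: le_trans.
  by have := coord_norm_le (y - x) j; rewrite !mxE.
- by move=> k x _; exact: has_pderiv_coord.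
- by move=> k x; exact: cvg_cst.
Qed.

Lemma Ck1D f g : Ck 1 V f -> Ck 1 V g -> Ck 1 V (fun x => f x + g x).
Proof.
move=> [fc fd] [gc gd].
apply: (@Ck1I _ _ (fun k x => pderiv f k x + pderiv g k x)) => //.
- exact: within_continuousD.
- by move=> k x Vx; apply: has_pderivD; apply: pderivableP; [apply (fd k).1|apply (gd k).1].
- by move=> k; apply: within_continuousD; [exact: (fd k).2|exact: (gd k).2].
Qed.

Lemma Ck1M f g : Ck 1 V f -> Ck 1 V g -> Ck 1 V (fun x => f x * g x).
Proof.
move=> [fc fd] [gc gd].
apply: (@Ck1I _ _ (fun k x => pderiv f k x * g x + f x * pderiv g k x)) => //.
- exact: within_continuousM.
- by move=> k x Vx; apply: has_pderivM; apply: pderivableP; [apply (fd k).1|apply (gd k).1].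
- move=> k; apply: within_continuousD; apply: within_continuousM;
    [exact: (fd k).2|exact: gc|exact: fc|exact: (gd k).2].
Qed.

Lemma Ck1Z c f : Ck 1 V f -> Ck 1 V (fun x => c * f x).
Proof. by move=> Cf; apply: Ck1M => //; exact: Ck1_cst. Qed.

Lemma Ck1N f : Ck 1 V f -> Ck 1 V (fun x => - f x).
Proof. by move=> /(Ck1Z (-1)); under eq_fun do rewrite mulN1r. Qed.

Lemma Ck1B f g : Ck 1 V f -> Ck 1 V g -> Ck 1 V (fun x => f x - g x).
Proof. by move=> Cf /Ck1N; exact: Ck1D. Qed.

Lemma Ck1_sum (I : Type) (r : seq I) (F : I -> vec -> R) :
  (forall i, Ck 1 V (F i)) -> Ck 1 V (fun x => \sum_(i <- r) F i x).
Proof.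
move=> FC; elim: r => [|i r IHr].
  by under eq_fun do rewrite big_nil; exact: Ck1_cst.
by under eq_fun do rewrite big_cons; exact: Ck1D.
Qed.

Lemma Ck1_prod (I : Type) (r : seq I) (F : I -> vec -> R) :
  (forall i, Ck 1 V (F i)) -> Ck 1 V (fun x => \prod_(i <- r) F i x).
Proof.
move=> FC; elim: r => [|i r IHr].
  by under eq_fun do rewrite big_nil; exact: Ck1_cst.
by under eq_fun do rewrite big_cons; exact: Ck1M.
Qed.

Lemma Ck1_exp m f : Ck 1 V f -> Ck 1 V (fun x => f x ^+ m).
Proof.
move=> Cf; elim: m => [|m IHm]; first by under eq_fun do rewrite expr0; exact: Ck1_cst.
by under eq_fun do rewrite exprS; exact: Ck1M.
Qed.

Lemma Ck1_comp (phi dphi : R -> R) f : Ck 1 V f ->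
  (forall x, V x -> is_derive (f x) 1 phi (dphi (f x))) ->
  (forall x, V x -> {for f x, continuous dphi}) -> Ck 1 V (fun x => phi (f x)).
Proof.
move=> [fc fd] pd pc.
have comp (psi : R -> R) : (forall x, V x -> {for f x, continuous psi}) ->
    {within V, continuous (fun x => psi (f x))}.
  move=> psic; apply/subspace_continuousP => x Vx.
  apply: (@cvg_comp _ _ _ f psi _ (nbhs (f x))); last exact: psic.
  by move/subspace_continuousP : fc; apply.
apply: (@Ck1I _ _ (fun k x => dphi (f x) * pderiv f k x)) => //.
- apply: comp => x Vx; apply/differentiable_continuous/derivable1_diffP.
  exact: (@ex_derive _ _ _ _ _ _ _ (pd x Vx)).
- by move=> k x Vx; apply: has_pderiv_comp (pd x Vx); apply/pderivableP/(fd k).1.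
- by move=> k; apply: within_continuousM; [exact: comp|exact: (fd k).2].
Qed.

Lemma Ck1_eq f g : (forall x, V x -> f x = g x) ->
  rel_open V -> Ck 1 V f -> Ck 1 V g.
Proof.
move=> fg Vo [fc fd].
apply: (@Ck1I _ _ (fun k x => pderiv f k x)) => //.
- exact: eq_within_continuous fc.
- move=> k x Vx; have [d d0 dP] := rel_openP Vo Vx.
  apply: has_pderiv_near d0 (fg x Vx) _ (pderivableP ((fd k).1 x Vx)) => h hd Hh.
  apply/fg/dP => //; rewrite addrC addKr (le_lt_trans _ hd)//.
  exact: norm_scale_delta.
- by move=> k; exact: (fd k).2.
Qed.

Lemma Ck1_det m (A : vec -> 'M[R]_m) : (forall i j, Ck 1 V (fun x => A x i j)) ->
  Ck 1 V (fun x => \det (A x)).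
Proof.
move=> CA; rewrite /determinant; apply: Ck1_sum => s; apply: Ck1Z.
by apply: Ck1_prod => i.
Qed.

End closure.

End Smoothness.

(** * Mean value inequalities up to the boundary, symmetry of second derivatives *)

Section MeanValue.
Variables (R : realType) (n : nat).
Local Notation vec := 'rV[R]_n.+1.
Local Notation H := (@half_space R n).
Local Notation e_ k := (delta_mx 0 k : vec).
Implicit Types (f g : vec -> R) (k l : 'I_n.+1) (x y : vec) (V : set vec).

Lemma mvt_ineq (phi dphi : R -> R) (a b c e : R) : a <= b ->
  {within `[a, b], continuous phi} ->
  (forall t, a < t < b -> is_derive t 1 phi (dphi t)) ->
  (forall t, a < t < b -> `|dphi t - c| <= e) ->
  `|phi b - phi a - c * (b - a)| <= e * (b - a).
Proof.
rewrite le_eqVlt => /predU1P[<- _ _ _|ab phic phid dphic].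
  by rewrite !subrr !mulr0 subrr normr0.
have phid' t : t \in `]a, b[%R -> is_derive t 1 phi (dphi t).
  by rewrite in_itv; exact: phid.
have [t] := MVT ab phid' phic; rewrite in_itv/= => tab ->.
rewrite -mulrBl normrM (@gtr0_norm _ (b - a)) ?subr_gt0//.
by rewrite ler_pM2r ?subr_gt0// dphic.
Qed.

Lemma line_derive V f k x (t : R) : Ck 1 V f -> H x -> 0 < t -> V (x + t *: e_ k) ->
  is_derive t 1 (fun s => f (x + s *: e_ k)) (pderiv f k (x + t *: e_ k)).
Proof.
move=> Cf Hx t0 Vt; have := Ck_has_pderiv (k := k) Cf Vt.
set l := pderiv _ _ _ => /has_pderivP fP.
have cl : (fun h : R => h^-1 *: (((fun s => f (x + s *: e_ k)) \o shift t) (h *: 1)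
    - f (x + t *: e_ k))) @ 0^' --> l.
  apply/cvgrPdist_le => e e0; have [d d0 dP] := fP e e0.
  apply/nbhs_ballP; exists (Num.min d t) => [|h] /=; first by rewrite lt_min d0.
  rewrite /ball/= sub0r normrN lt_min => /andP[hd ht] h0.
  have -> : x + (h%:A + t) *: e_ k = x + t *: e_ k + h *: e_ k.
    have -> : h%:A = h :> R by rewrite /GRing.scale/= mulr1.
    by rewrite (addrC h) scalerDl addrA.
  have Hh : H (x + t *: e_ k + h *: e_ k).
    rewrite -addrA -scalerDl; apply: half_spaceD => //.
    by move: ht; rewrite ltr_norml => /andP[/ltW]; rewrite -subr_ge0 opprK addrC.
  have := dP h hd Hh.
  rewrite -(@ler_pM2l _ `|h|^-1) ?invr_gt0 ?normr_gt0//.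
  rewrite (mulrC e) mulKf ?normr_eq0// -normfV -normrM distrC; congr (`|_| <= _).
  by rewrite /GRing.scale/=; field.
apply: DeriveDef; first by apply/cvg_ex; exists l.
by rewrite /derive; apply: cvg_lim.
Qed.

Lemma line_continuous V f k x (a b : R) : {within V, continuous f} ->
  (forall t, a <= t <= b -> V (x + t *: e_ k)) ->
  {within `[a, b], continuous (fun s => f (x + s *: e_ k))}.
Proof.
move=> /within_continuousP fc Vab; apply/subspace_continuousP => t /=.
rewrite in_itv/= => tab; apply/cvgrPdist_le => e e0.
have [d d0 dP] := fc _ (Vab t tab) e e0.
rewrite near_withinE; apply/nbhs_ballP; exists d => // s /=.
rewrite /ball/= distrC => std; rewrite in_itv/= => sab; rewrite distrC.
apply: dP; first exact: Vab.
by rewrite opprD addrACA subrr add0r -scalerBl (le_lt_trans _ std)// norm_scale_delta.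
Qed.

Lemma line_mvt V f k x (h c e : R) : V `<=` H -> Ck 1 V f -> 0 <= h ->
  (forall t, 0 <= t <= h -> V (x + t *: e_ k)) ->
  (forall t, 0 <= t <= h -> `|pderiv f k (x + t *: e_ k) - c| <= e) ->
  `|f (x + h *: e_ k) - f x - c * h| <= e * h.
Proof.
move=> VH Cf h0 Vt dc.
have Hx : H x by apply: VH; have := Vt 0; rewrite scale0r addr0 lexx h0; exact.
have := @mvt_ineq (fun s => f (x + s *: e_ k)) (fun s => pderiv f k (x + s *: e_ k)) 0 h c e h0.
rewrite scale0r addr0 subr0; apply.
- exact: line_continuous (Ck_continuous Cf) Vt.
- by move=> t /andP[t0 th]; apply: (line_derive Cf Hx t0); apply: Vt; rewrite !ltW.
- by move=> t /andP[t0 th]; apply: dc; rewrite !ltW.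
Qed.

(** The path from [x] to [y] moves one coordinate at a time. It stays in the box spanned by the two
    ends, and on each leg a single partial derivative gives the mean value inequality. *)
Lemma box_mvt V f x y (c : 'I_n.+1 -> R) (e : R) : V `<=` H -> Ck 1 V f ->
  (forall z : vec, (forall j, Num.min (x 0 j) (y 0 j) <= z 0 j <= Num.max (x 0 j) (y 0 j)) ->
    V z /\ forall k, `|pderiv f k z - c k| <= e) ->
  `|f y - f x - \sum_k c k * (y 0 k - x 0 k)| <= e * \sum_k `|y 0 k - x 0 k|.
Proof.
move=> VH Cf zP.
pose w (j : nat) : vec := \row_i (if (i < j)%N then y 0 i else x 0 i).
have w0 : w 0%N = x by apply/rowP => i; rewrite mxE.
have wn : w n.+1 = y by apply/rowP => i; rewrite mxE ltn_ord.
have -> : f y - f x = \sum_(k < n.+1) (f (w k.+1) - f (w k)).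
  by rewrite -(big_mkord xpredT (fun j : nat => f (w j.+1) - f (w j))) telescope_sumr// w0 wn.
rewrite -sumrB mulr_sumr (le_trans (ler_norm_sum _ _ _))//.
apply: ler_sum => k _.
have wE : w k.+1 = w k + (y 0 k - x 0 k) *: e_ k.
  apply/rowP => i; rewrite !mxE eqxx /= ltnS leq_eqVlt -(inj_eq val_inj)/=.
  have [ik|ik] := eqVneq (i : nat) k.
    by rewrite ik ltnn /= mulr1 (val_inj ik) addrC subrK.
  by rewrite /= mulr0 addr0.
have wz (s : R) : Num.min (x 0 k) (y 0 k) <= s <= Num.max (x 0 k) (y 0 k) ->
    forall j, let z := w k + (s - x 0 k) *: e_ k in
    Num.min (x 0 j) (y 0 j) <= z 0 j <= Num.max (x 0 j) (y 0 j).
  move=> ss j /=; rewrite !mxE eqxx /=.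
  have [->|jk] := eqVneq j k; first by rewrite ltnn mulr1 addrC subrK.
  by rewrite mulr0 addr0; case: ifP => _; rewrite ?ge_min ?le_max !lexx ?orbT.
have [xy|yx] := leP (x 0 k) (y 0 k).
  have zP1 t : 0 <= t <= y 0 k - x 0 k -> V (w k + t *: e_ k) /\
      forall l, `|pderiv f l (w k + t *: e_ k) - c l| <= e.
    move=> /andP[t0 ty]; apply: zP.
    have -> : t = (x 0 k + t) - x 0 k by rewrite addrAC subrr add0r.
    apply: wz; rewrite min_l// max_r//; apply/andP; split; lra.
  rewrite wE (@ger0_norm _ (y 0 k - x 0 k)) ?subr_ge0//.
  apply: (@line_mvt V) => //; rewrite ?subr_ge0// => t th; first exact: (zP1 t th).1.
  exact: (zP1 t th).2.
(* [line_mvt] only follows increasing coordinates, so a decreasing leg is run backwards. *)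
have wE' : w k = w k.+1 + (x 0 k - y 0 k) *: e_ k.
  by rewrite wE -addrA -scalerDl -(opprB (y 0 k)) subrr scale0r addr0.
have -> : f (w k.+1) - f (w k) - c k * (y 0 k - x 0 k) =
  - (f (w k) - f (w k.+1) - c k * (x 0 k - y 0 k)) by ring.
rewrite normrN (distrC (y 0 k)) (@ger0_norm _ (x 0 k - y 0 k)) ?subr_ge0 ?(ltW yx)//.
have zt t : 0 <= t <= x 0 k - y 0 k -> w k.+1 + t *: e_ k = w k + (y 0 k + t - x 0 k) *: e_ k.
  by rewrite wE -addrA -scalerDl => _; congr (_ + _ *: _); ring.
have zP1 t : 0 <= t <= x 0 k - y 0 k -> V (w k.+1 + t *: e_ k) /\
    forall l, `|pderiv f l (w k.+1 + t *: e_ k) - c l| <= e.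
  move=> th; rewrite zt//; move: th => /andP[t0 ty]; apply: zP.
  apply: wz; rewrite min_r ?(ltW yx)// max_l ?(ltW yx)//; apply/andP; split; lra.
rewrite {1}wE'; apply: (@line_mvt V) => //; rewrite ?subr_ge0 ?(ltW yx)// => t th.
  exact: (zP1 t th).1.
exact: (zP1 t th).2.
Qed.

Lemma between_norm x y (z : vec) :
  (forall j, Num.min (x 0 j) (y 0 j) <= z 0 j <= Num.max (x 0 j) (y 0 j)) ->
  `|z - x| <= `|y - x|.
Proof.
move=> zP; apply/coord_normP => // j; rewrite !mxE.
have := coord_norm_le (y - x) j; rewrite !mxE; apply: le_trans.
have := zP j; case: (leP (x 0 j) (y 0 j)) => xy /andP[h1 h2].
  by rewrite !ger0_norm ?subr_ge0// lerD2r.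
by rewrite !ler0_norm ?subr_le0 ?(ltW xy)// lerN2 lerD2r.
Qed.

Lemma between_half_space x y (z : vec) : H x -> H y ->
  (forall j, Num.min (x 0 j) (y 0 j) <= z 0 j <= Num.max (x 0 j) (y 0 j)) -> H z.
Proof.
rewrite /half_space/= => Hx Hy /(_ 0)/andP[+ _]; apply: le_trans.
by rewrite le_min Hx Hy.
Qed.

(** [box_mvt] against the values of the partial derivatives at [x], whose oscillation is small by
    continuity: total differentiability up to the boundary. *)
Lemma Ck1_differentiable V f x (e : R) : rel_open V -> Ck 1 V f -> V x -> 0 < e ->
  exists2 d : R, 0 < d & forall y, H y -> `|y - x| < d -> V y /\
    `|f y - f x - \sum_k pderiv f k x * (y 0 k - x 0 k)| <= e * \sum_k `|y 0 k - x 0 k|.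
Proof.
move=> Vo Cf Vx e0; have [d1 d10 d1P] := rel_openP Vo Vx.
have dc k : exists2 d : R, 0 < d & forall y, V y -> `|y - x| < d ->
    `|pderiv f k y - pderiv f k x| <= e.
  by have /within_continuousP := Ck_continuous (Ck_pderiv k Cf); apply.
have [d d0 dP] : exists2 d : R, 0 < d & d <= d1 /\ forall k y, V y -> `|y - x| < d ->
    `|pderiv f k y - pderiv f k x| <= e.
  pose D k := xget 1 [set d : R | 0 < d /\ forall y, V y -> `|y - x| < d ->
    `|pderiv f k y - pderiv f k x| <= e].
  have DP k : 0 < D k /\ forall y, V y -> `|y - x| < D k ->
      `|pderiv f k y - pderiv f k x| <= e.
    by rewrite /D; case: xgetP => [z -> //|]; have [d d0 dP] := dc k => /(_ d) [].
  exists (\big[Num.min/d1]_k D k); first by apply: lt_bigmin => // k _; exact: (DP k).1.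
  split; first exact: bigmin_le_id.
  move=> k y Vy /lt_le_trans yx; apply: (DP k).2 => //; apply: yx; exact: bigmin_le.
exists d => // y Hy yx; split; first exact/d1P/(lt_le_trans yx)/dP.1.
have Hx := rel_open_sub Vo Vx.
apply: (@box_mvt V) => //; first exact: rel_open_sub.
move=> z zP; have zx : `|z - x| < d by exact: le_lt_trans (between_norm zP) yx.
have Vz : V z by apply: d1P; [exact: between_half_space zP|exact/(lt_le_trans zx)/dP.1].
by split=> // k; exact: dP.2.
Qed.

Lemma has_pderiv_chain V f (tau : vec -> vec) k x (a : 'I_n.+1 -> R) (d0 : R) :
  rel_open V -> Ck 1 V f -> V (tau x) -> 0 < d0 ->
  (forall h, `|h| < d0 -> H (x + h *: e_ k) -> V (tau (x + h *: e_ k))) ->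
  (forall l, has_pderiv (fun y => tau y 0 l) k x (a l)) ->
  has_pderiv (f \o tau) k x (\sum_l a l * pderiv f l (tau x)).
Proof.
move=> Vo Cf Vx d00 Vd ta; apply/has_pderivP => e e0.
set S := \sum_l (`|a l| + 1); set P := \sum_l `|pderiv f l (tau x)|.
have S0 : 0 <= S by apply: sumr_ge0 => l _; rewrite addr_ge0.
have P0 : 0 <= P by exact: sumr_ge0.
have e1 : 0 < e / 2 / (1 + S) by rewrite !divr_gt0// ltr_pwDl.
have [d1 d10 d1P] := Ck1_differentiable Vo Cf Vx e1.
have m0 : 0 < Num.min 1 (e / 2 / (1 + P)) by rewrite lt_min ltr01 !divr_gt0// ltr_pwDl.
set m := Num.min _ _ in m0.
pose D l := xget 1 [set d : R | 0 < d /\ forall h, `|h| < d -> H (x + h *: e_ k) ->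
  `|tau (x + h *: e_ k) 0 l - tau x 0 l - h * a l| <= m * `|h|].
have DP l : 0 < D l /\ forall h, `|h| < D l -> H (x + h *: e_ k) ->
    `|tau (x + h *: e_ k) 0 l - tau x 0 l - h * a l| <= m * `|h|.
  rewrite /D; case: xgetP => [z -> //|].
  by have /has_pderivP/(_ m m0)[d ? dP] := ta l => /(_ d) [].
pose d2 := \big[Num.min/d0]_l D l.
have d20 : 0 < d2 by apply: lt_bigmin => // l _; exact: (DP l).1.
exists (Num.min d2 (d1 / (1 + S))) => [|h].
  by rewrite lt_min d20 divr_gt0// ltr_pwDl.
rewrite lt_min => /andP[hd2 hd1] Hh.
have hd0 : `|h| < d0 by rewrite (lt_le_trans hd2)// bigmin_le_id.
have tl l : `|tau (x + h *: e_ k) 0 l - tau x 0 l - h * a l| <= m * `|h|.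
  by apply: (DP l).2 => //; rewrite (lt_le_trans hd2)// bigmin_le.
have tn l : `|tau (x + h *: e_ k) 0 l - tau x 0 l| <= (`|a l| + 1) * `|h|.
  rewrite -[X in `|X|](subrK (h * a l)) (le_trans (ler_normD _ _))// addrC mulrDl.
  by rewrite normrM mulrC lerD// (le_trans (tl l))// ler_wpM2r// ge_min lexx.
have tS : \sum_l `|tau (x + h *: e_ k) 0 l - tau x 0 l| <= S * `|h|.
  by rewrite mulr_suml ler_sum.
have tx : `|tau (x + h *: e_ k) - tau x| < d1.
  apply: (@le_lt_trans _ _ (S * `|h|)); last first.
    rewrite mulrC (@le_lt_trans _ _ (`|h| * (1 + S)))//.
      by rewrite ler_wpM2l// lerDr.
    by rewrite -ltr_pdivlMr// ltr_pwDl.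
  apply/coord_normP; first by rewrite mulr_ge0.
  move=> l; rewrite !mxE (le_trans (tn l))// ler_wpM2r// /S (bigD1 l)//= lerDl.
  by apply: sumr_ge0 => i _; rewrite addr_ge0.
have [_] := d1P _ (rel_open_sub Vo (Vd h hd0 Hh)) tx.
set Q := \sum_l _ * _ => dQ.
have -> : (f \o tau) (x + h *: e_ k) - (f \o tau) x - h * (\sum_l a l * pderiv f l (tau x))
  = (f (tau (x + h *: e_ k)) - f (tau x) - Q) + \sum_l pderiv f l (tau x) *
    (tau (x + h *: e_ k) 0 l - tau x 0 l - h * a l).
  rewrite /= -[RHS]addrA; congr (_ + _); rewrite /Q mulr_sumr -!sumrN -big_split/=.
  by apply: eq_bigr => l _; ring.
rewrite (le_trans (ler_normD _ _))//.
have -> : e * `|h| = e / 2 * `|h| + e / 2 * `|h| by field.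
apply: lerD.
  rewrite (le_trans dQ)// (@le_trans _ _ (e / 2 / (1 + S) * (S * `|h|)))//.
    by rewrite ler_wpM2l// ltW.
  rewrite mulrA ler_wpM2r// -mulrA -[leRHS]mulr1 ler_wpM2l// ?divr_ge0 ?(ltW e0)//.
  by rewrite mulrC ler_pdivrMr ?ltr_pwDl// mul1r lerDr.
rewrite (le_trans (ler_norm_sum _ _ _))// (@le_trans _ _ (P * (m * `|h|)))//.
  by rewrite mulr_suml ler_sum// => l _; rewrite normrM ler_wpM2l.
rewrite mulrA ler_wpM2r// (@le_trans _ _ (P * (e / 2 / (1 + P))))//.
  by rewrite ler_wpM2l// ge_min lexx orbT.
rewrite mulrCA ger_pMr ?divr_gt0//.
by rewrite ler_pdivrMr ?ltr_pwDl// mul1r lerDr.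
Qed.

(** The mean value inequality in direction [k] for the increment of [f] along [l], then in direction
    [l] for [pderiv f k]. The second difference is symmetric in [k] and [l], whence [pderiv_comm].
    Only positive increments occur, so boundary points are covered. *)
Lemma second_difference V f k l x (e : R) : rel_open V -> Ck 2 V f -> V x -> 0 < e ->
  exists2 d : R, 0 < d & forall h, 0 < h < d ->
    `|f (x + h *: e_ k + h *: e_ l) - f (x + h *: e_ k) - f (x + h *: e_ l) + f x
      - pderiv (pderiv f k) l x * h ^+ 2| <= e * h ^+ 2.
Proof.
move=> Vo Cf Vx e0; have VH := rel_open_sub Vo; have Hx := VH _ Vx.
have [d1 d10 d1P] := rel_openP Vo Vx.
have /within_continuousP/(_ x Vx e e0)[d2 d20 d2P] :=
  Ck_continuous (Ck_pderiv l (Ck_pderiv k Cf)).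
exists (Num.min d1 d2 / 2) => [|h /andP[h0 hd]]; first by rewrite divr_gt0// lt_min d10.
have near s t : 0 <= s <= h -> 0 <= t <= h -> V (x + s *: e_ k + t *: e_ l) /\
    `|x + s *: e_ k + t *: e_ l - x| < d2.
  move=> /andP[s0 sh] /andP[t0 th].
  have : `|x + s *: e_ k + t *: e_ l - x| < Num.min d1 d2.
    rewrite (addrC _ (- x)) !addrA addNr add0r (le_lt_trans (ler_normD _ _))//.
    have := norm_scale_delta k s; have := norm_scale_delta l t.
    rewrite !ger0_norm// => H1 H2.
    have := lerD H2 H1; lra.
  rewrite lt_min => /andP[n1 n2]; split=> //.
  by apply: d1P n1; apply: half_spaceD => //; exact: half_spaceD.
have near0 s : 0 <= s <= h -> V (x + s *: e_ k).
  by move=> sh; have [] := near s 0 sh; rewrite ?lexx ?(ltW h0)// scale0r addr0.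
pose g s := f (x + h *: e_ l + s *: e_ k) - f (x + s *: e_ k).
have C1 := Ck_le (isT : (1 <= 2)%N) Cf.
have swap s t : x + s *: e_ l + t *: e_ k = x + t *: e_ k + s *: e_ l.
  by rewrite addrAC.
have hh : 0 <= h <= h by rewrite lexx ltW.
have gP := @mvt_ineq g (fun s => pderiv f k (x + h *: e_ l + s *: e_ k)
  - pderiv f k (x + s *: e_ k)) 0 h (pderiv (pderiv f k) l x * h) (e * h) (ltW h0).
have -> : f (x + h *: e_ k + h *: e_ l) - f (x + h *: e_ k) - f (x + h *: e_ l) + f x
      - pderiv (pderiv f k) l x * h ^+ 2 = g h - g 0 - pderiv (pderiv f k) l x * h * (h - 0).
  by rewrite /g scale0r !addr0 swap; ring.
have -> : e * h ^+ 2 = e * h * (h - 0) by ring.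
apply: gP.
- have c1 : {within `[0, h], continuous (fun s => f (x + h *: e_ l + s *: e_ k))}.
    apply: (line_continuous (Ck_continuous C1)) => t th; rewrite swap.
    exact: (near _ _ th hh).1.
  have c2 : {within `[0, h], continuous (fun s => f (x + s *: e_ k))}.
    exact: (line_continuous (Ck_continuous C1)).
  by move=> t; apply: continuousB; [exact: c1|exact: c2].
- move=> t /andP[t0 th]; have tth : 0 <= t <= h by rewrite !ltW.
  apply: is_deriveB; apply: (line_derive C1) => //; last exact: near0.
    by apply: half_spaceD => //; rewrite ltW.
  by rewrite swap; exact: (near _ _ tth hh).1.
- move=> t /andP[t0 th]; have tth : 0 <= t <= h by rewrite !ltW.
  rewrite swap; apply: (@line_mvt V) => //; first exact: Ck_pderiv.
  + by rewrite ltW.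
  + by move=> s sh; exact: (near _ _ tth sh).1.
  + by move=> s sh; have [Vs ns] := near _ _ tth sh; exact: d2P.
Qed.

Lemma pderiv_comm V f k l x : rel_open V -> Ck 2 V f -> V x ->
  pderiv (pderiv f k) l x = pderiv (pderiv f l) k x.
Proof.
move=> Vo Cf Vx; apply/eqP; rewrite -subr_eq0 -normr_le0; apply/ler_addgt0Pl => e e0.
rewrite addr0.
have e2 : 0 < e / 2 by rewrite divr_gt0.
have [d1 d10 d1P] := second_difference k l Vo Cf Vx e2.
have [d2 d20 d2P] := second_difference l k Vo Cf Vx e2.
pose h := Num.min d1 d2 / 2.
have m0 : 0 < Num.min d1 d2 by rewrite lt_min d10.
have h0 : 0 < h by rewrite divr_gt0.
have hm : h < Num.min d1 d2 by rewrite ltr_pdivrMr// ltr_pMr// ltr1n.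
have := hm; rewrite lt_min => /andP[hd1 hd2].
have := d1P h; have := d2P h; rewrite h0 hd1 hd2 => /(_ isT) q2 /(_ isT) q1.
have h20 : 0 < h ^+ 2 by rewrite exprn_gt0.
rewrite -(ler_pM2r h20) -(gtr0_norm h20) -normrM.
set a := pderiv (pderiv f k) l x in q1 *; set b := pderiv (pderiv f l) k x in q2 *.
move: q1 q2; rewrite (addrAC x (h *: e_ l) (h *: e_ k)).
set X := f _; set Y := f (x + h *: e_ k); set Z := f (x + h *: e_ l) => q1 q2.
have -> : (a - b) * h ^+ 2 = (X - Z - Y + f x - b * h ^+ 2) - (X - Y - Z + f x - a * h ^+ 2).
  by ring.
rewrite (le_trans (ler_normB _ _))// (gtr0_norm h20).
by apply: (le_trans (lerD q2 q1)); rewrite -mulrDl -splitr.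
Qed.

End MeanValue.

(** * Derivative of a determinant *)

Section Determinant.
Variables (R : realType) (n : nat).
Local Notation vec := 'rV[R]_n.+1.
Implicit Types (k : 'I_n.+1) (x : vec).

Lemma has_pderiv_prod (I : eqType) (r : seq I) (F : I -> vec -> R) k x (a : I -> R) :
  uniq r -> (forall i, has_pderiv (F i) k x (a i)) ->
  has_pderiv (fun y => \prod_(i <- r) F i y) k x
    (\sum_(i <- r) a i * \prod_(j <- r | j != i) F j x).
Proof.
move=> + Fa; elim: r => [_|i r IHr /= /andP[ir ur]].
  by under eq_fun do rewrite big_nil; rewrite big_nil; exact: has_pderiv_cst.
under eq_fun do rewrite big_cons; rewrite big_cons.
have := has_pderivM (Fa i) (IHr ur); congr (has_pderiv _ _ _ (_ + _)).
  rewrite big_cons eqxx /=; congr (_ * _); rewrite [LHS]big_seq [RHS]big_seq_cond.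
  apply: eq_bigl => j; apply/esym/andb_idr => jr.
  by apply: contraNneq ir => <-.
rewrite mulr_sumr; apply: eq_big_seq => j jr.
rewrite big_cons; have -> : i != j by apply: contraNneq ir => ->.
by rewrite mulrCA.
Qed.

(** Jacobi's formula: the terms of the product rule that differentiate row [i] sum to the
    determinant of [A x] with row [i] replaced by that of [A'], here expanded along this row. *)
Lemma has_pderiv_det m (A : vec -> 'M[R]_m) (A' : 'M[R]_m) k x :
  (forall i j, has_pderiv (fun y => A y i j) k x (A' i j)) ->
  has_pderiv (fun y => \det (A y)) k x (\sum_i \sum_j A' i j * cofactor (A x) i j).
Proof.
move=> AA'.
have -> : \sum_i \sum_j A' i j * cofactor (A x) i j =
  \sum_(s : 'S_m) (-1) ^+ s * \sum_i A' i (s i) * \prod_(j | j != i) A x j (s j).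
  under [RHS]eq_bigr do rewrite mulr_sumr.
  rewrite [RHS]exchange_big/=; apply: eq_bigr => i _.
  pose B := \matrix_(a, b) (if a == i then A' i b else A x a b).
  transitivity (\det B).
    rewrite (expand_det_row _ i); apply: eq_bigr => j _; rewrite mxE eqxx; congr (_ * _).
    rewrite /cofactor; congr (_ * \det _); apply/matrixP => a b; rewrite !mxE.
    by rewrite eq_sym (negbTE (neq_lift i a)).
  apply: eq_bigr => s _; congr (_ * _); rewrite (bigD1 i)//= mxE eqxx; congr (_ * _).
  by apply: eq_bigr => j /negbTE ji; rewrite mxE ji.
rewrite /determinant; apply: has_pderiv_sum => s; apply: has_pderivZ.
have := @has_pderiv_prod 'I_m (index_enum 'I_m) (fun i y => A y i (s i)) k x
  (fun i => A' i (s i)) (index_enum_uniq _).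
exact.
Qed.

End Determinant.

(** * Changes of coordinates *)

Section ChangeOfCoordinates.
Variables (R : realType) (n : nat).
Local Notation vec := 'rV[R]_n.+1.
Local Notation H := (@half_space R n).
Local Notation e_ k := (delta_mx 0 k : vec).
Implicit Types (f g : vec -> R) (k l : 'I_n.+1) (x y : vec) (V : set vec).

(** Fermat's rule takes increments of both signs; these exist in tangential directions at every
    point, and in all directions off the boundary. *)
Lemma pderiv_at_min V f k x : rel_open V -> Ck 1 V f -> V x ->
  (forall y, V y -> f x <= f y) -> k != 0 \/ 0 < x 0 0 -> pderiv f k x = 0.
Proof.
move=> Vo Cf Vx fmin kx; apply/eqP; rewrite -normr_le0; apply/ler_addgt0Pl => e e0.
rewrite addr0.
have [d1 d10 d1P] := rel_openP Vo Vx.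
have /has_pderivP/(_ e e0)[d2 d20 d2P] := Ck_has_pderiv (k := k) Cf Vx.
set a := pderiv _ _ _ in d2P *.
have [d3 d30 d3P] : exists2 d : R, 0 < d & forall h, `|h| < d -> H (x + h *: e_ k).
  have Hx := rel_open_sub Vo Vx; case: kx => [k0|x0].
    exists 1 => // h _; rewrite /half_space/= !mxE eqxx /= eq_sym (negbTE k0).
    by rewrite mulr0 addr0.
  exists (x 0 0) => // h hx; rewrite /half_space/= !mxE eqxx /=.
  have [_|_] := eqVneq; last by rewrite mulr0 addr0 ltW.
  by rewrite mulr1; move: hx; rewrite ltr_norml => /andP[]; lra.
pose h := Num.min d1 (Num.min d2 d3) / 2.
have m0 : 0 < Num.min d1 (Num.min d2 d3) by rewrite !lt_min d10 d20.
have h0 : 0 < h by rewrite divr_gt0.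
have : h < Num.min d1 (Num.min d2 d3) by rewrite ltr_pdivrMr// ltr_pMr// ltr1n.
rewrite !lt_min => /and3P[h1 h2 h3].
have est s : `|s| = h -> - (s * a) <= e * h.
  move=> sh; have Hs : H (x + s *: e_ k) by apply: d3P; rewrite sh.
  have Vs : V (x + s *: e_ k).
    by apply: d1P => //; rewrite addrC addKr (le_lt_trans (norm_scale_delta _ _))// sh.
  have := d2P s; rewrite sh => /(_ h2 Hs); rewrite ler_norml => /andP[_].
  by have := fmin _ Vs; lra.
have := est h; have := est (- h); rewrite normrN gtr0_norm// => /(_ erefl) + /(_ erefl).
rewrite mulNr opprK -mulrN [h * a]mulrC [h * - a]mulrC !ler_pM2r// => h4 h5.
by rewrite ler_norml h4 andbT lerNl.
Qed.

Lemma sum_mxtr m (A B : 'M[R]_m) : \tr (A *m B) = \sum_i \sum_j A i j * B j i.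
Proof. by apply: eq_bigr => i _; rewrite mxE. Qed.

Section Piola.
Variables (V V' : set vec) (tau : vec -> vec).
Hypotheses (Vo : rel_open V) (Vo' : rel_open V').
Hypothesis tauV : forall x, V x -> V' (tau x).
Hypothesis tauC : forall l, Ck 2 V (fun x => tau x 0 l).

Definition jacobian x : 'M[R]_n.+1 := \matrix_(k, l) pderiv (fun y => tau y 0 l) k x.
Local Notation J := jacobian.

Hypothesis J_unit : forall x, V x -> J x \in unitmx.

Lemma has_pderiv_transition f k x : Ck 1 V' f -> V x ->
  has_pderiv (f \o tau) k x (\sum_l J x k l * pderiv f l (tau x)).
Proof.
move=> Cf Vx; have [d d0 dP] := rel_openP Vo Vx.
have := @has_pderiv_chain R n V' f tau k x (J x k) d Vo' Cf (tauV Vx) d0; apply.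
  move=> h hd Hh; apply/tauV/dP => //; rewrite addrC addKr.
  exact: le_lt_trans (norm_scale_delta _ _) hd.
by move=> l; rewrite mxE; apply: Ck_has_pderiv (tauC l) Vx.
Qed.

Lemma Ck1_jacobian k l : Ck 1 V (fun x => J x k l).
Proof.
have := Ck_pderiv k (tauC l); congr (Ck 1 V _).
by apply/funext => x; rewrite mxE.
Qed.

(** Freezes the sign of the Jacobian determinant near [x], so that [|det J|], the factor in the
    transformation of vector densities, can be differentiated as a constant times [det J]. *)
Lemma det_sign_near x : V x -> exists2 d : R, 0 < d & forall y, V y -> `|y - x| < d ->
  `|\det (J y)| = Num.sg (\det (J x)) * \det (J y).
Proof.
move=> Vx; have VH := rel_open_sub Vo.
have /Ck_continuous/within_continuousP/(_ x Vx) := Ck1_det VH Ck1_jacobian.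
set D := \det (J x); have D0 : D != 0 by rewrite -unitfE -unitmxE J_unit.
have D2 : 0 < `|D| / 2 by rewrite divr_gt0// normr_gt0.
move=> /(_ _ D2)[d d0 dP]; exists d => // y Vy yx; have := dP y Vy yx.
rewrite -/D; set E := \det (J y).
case: (ltgtP D 0) D0 => // DD _; rewrite ?(gtr0_sg DD) ?(ltr0_sg DD) ?mul1r ?mulN1r.
  rewrite (ltr0_norm DD) ler_norml => /andP[_ h].
  rewrite ler0_norm//; lra.
rewrite (gtr0_norm DD) ler_norml => /andP[h _].
by rewrite ger0_norm//; lra.
Qed.

Variables (W W' : vec -> vec).
Hypothesis WC : forall k, Ck 1 V (fun x => W x 0 k).
Hypothesis WC' : forall k, Ck 1 V' (fun x => W' x 0 k).
Hypothesis WW' : forall x, V x -> W x *m J x = `|\det (J x)| *: W' (tau x).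

(* The Piola identity sum_k d_k (cofactor k l) = 0, in disguise: it amounts to
   the symmetry of second derivatives and Jacobi's formula for d (det J). *)
Lemma divergence_transition x : V x ->
  \sum_k pderiv (fun y => W y 0 k) k x =
  `|\det (J x)| * \sum_l pderiv (fun y => W' y 0 l) l (tau x).
Proof.
move=> Vx; have VH := rel_open_sub Vo; have Hx := VH _ Vx.
have [d1 d10 d1P] := det_sign_near Vx.
have [d2 d20 d2P] := rel_openP Vo Vx.
set s := Num.sg _ in d1P.
pose D m := \sum_a \sum_b pderiv (fun y => J y a b) m x * cofactor (J x) a b.
pose DW : 'M[R]_n.+1 := \matrix_(m, k) pderiv (fun y => W y 0 k) m x.
pose DW' : 'M[R]_n.+1 := \matrix_(m, l) pderiv (fun y => W' y 0 l) m (tau x).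
pose B : 'M[R]_n.+1 := \matrix_(m, l) \sum_k W x 0 k * pderiv (fun y => J y k l) m x.
pose C : 'M[R]_n.+1 := \matrix_(m, l) (s * (D m * W' (tau x) 0 l)).
set K := invmx (J x); have JK : J x *m K = 1%:M by rewrite mulmxV// J_unit.
have KJ : K *m J x = 1%:M by rewrite mulVmx// J_unit.
have absJ : `|\det (J x)| = s * \det (J x) by apply: d1P => //; rewrite subrr normr0.
(* The derivative of the relation [WW'] at [x] in matrix form: [B] collects the derivatives of [J],
   and [C] those of [det J]. *)
have E : DW *m J x + B = C + `|\det (J x)| *: (J x *m DW').
  apply/matrixP => m l.
  have L : has_pderiv (fun y => \sum_k W y 0 k * J y k l) m x
      (\sum_k (DW m k * J x k l + W x 0 k * pderiv (fun y => J y k l) m x)).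
    apply: has_pderiv_sum => k; apply: has_pderivM.
      by rewrite mxE; exact: Ck_has_pderiv (WC k) Vx.
    exact: Ck_has_pderiv (Ck1_jacobian k l) Vx.
  have Rr : has_pderiv (fun y => s * (\det (J y) * ((fun z => W' z 0 l) \o tau) y)) m x
      (s * (D m * W' (tau x) 0 l + \det (J x) * \sum_a J x m a * DW' a l)).
    apply: has_pderivZ; apply: has_pderivM.
      have := @has_pderiv_det _ _ _ J (\matrix_(a, b) pderiv (fun y => J y a b) m x) m x.
      rewrite /D; under eq_bigr do under eq_bigr do rewrite mxE.
      by apply => a b; rewrite mxE; exact: Ck_has_pderiv (Ck1_jacobian a b) Vx.
    have := has_pderiv_transition (k := m) (WC' l) Vx; congr (has_pderiv _ _ _ _).
    by apply: eq_bigr => a _; rewrite [DW' a l]mxE.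
  have : has_pderiv (fun y => \sum_k W y 0 k * J y k l) m x
      (s * (D m * W' (tau x) 0 l + \det (J x) * \sum_a J x m a * DW' a l)).
    have eqn y : V y -> `|y - x| < d1 ->
        s * (\det (J y) * ((fun z => W' z 0 l) \o tau) y) = \sum_k W y 0 k * J y k l.
      move=> Vy yx; rewrite mulrA -d1P//=.
      by have /(congr1 (fun M : 'rV_n.+1 => M 0 l)) := WW' Vy; rewrite !mxE.
    have m0 : 0 < Num.min d1 d2 by rewrite lt_min d10.
    apply: has_pderiv_near m0 _ _ Rr; first by apply: eqn; rewrite // subrr normr0.
    move=> h; rewrite lt_min => /andP[h1 h2] Hh.
    have hn : `|x + h *: e_ m - x| <= `|h|.
      by rewrite addrC addKr norm_scale_delta.
    apply: eqn; last exact: le_lt_trans hn h1.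
    by apply: d2P => //; exact: le_lt_trans hn h2.
  move=> /(has_pderiv_unique Hx L); rewrite !mxE => LR.
  rewrite -big_split/= LR mulrDr mulrA absJ; congr (_ + _).
  by rewrite mulrA.
have := congr1 (fun M => \tr (M *m K)) E.
rewrite !mulmxDl !mxtraceD -mulmxA JK mulmx1 -scalemxAl mxtraceZ -(mulmxA (J x)).
rewrite (mxtrace_mulC (J x)) -mulmxA KJ mulmx1.
(* After multiplication by the inverse Jacobian and a trace, the two correction terms agree: [D m]
   is [det J] times the trace of [K] against the derivative of [J], and [pderiv_comm] exchanges the
   differentiation index [m] with the row index [k] of [J]. *)
have -> : \tr (B *m K) = \tr (C *m K).
  pose T k := \sum_a \sum_b pderiv (fun y => J y a b) k x * K b a.
  have DT k : D k = \det (J x) * T k.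
    rewrite mulr_sumr; apply: eq_bigr => a _; rewrite mulr_sumr; apply: eq_bigr => b _.
    rewrite [RHS]mulrCA; congr (_ * _).
    rewrite /K /invmx J_unit// !mxE mulrA divrr ?mul1r//.
    by rewrite -unitmxE J_unit.
  transitivity (\sum_k W x 0 k * T k).
    rewrite sum_mxtr /T; under eq_bigr => m _.
      under eq_bigr => l _ do rewrite mxE mulr_suml.
      rewrite exchange_big/=; over.
    rewrite exchange_big/=; apply: eq_bigr => k _; rewrite mulr_sumr.
    apply: eq_bigr => m _; rewrite mulr_sumr; apply: eq_bigr => l _.
    rewrite mulrA; congr (_ * _ * _).
    under [in LHS]eq_fun do rewrite mxE; under [in RHS]eq_fun do rewrite mxE.
    exact: pderiv_comm (tauC l) Vx.
  have WE : W x = `|\det (J x)| *: (W' (tau x) *m K).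
    by rewrite scalemxAl -WW'// -mulmxA JK mulmx1.
  rewrite sum_mxtr; apply: eq_bigr => m _.
  have -> : W x 0 m = s * \det (J x) * \sum_l W' (tau x) 0 l * K l m.
    by rewrite WE !mxE absJ.
  rewrite [X in X * _]mulr_sumr [LHS]mulr_suml.
  by apply: eq_bigr => l _; rewrite [C m l]mxE DT; ring.
move=> /(congr1 (fun t => t - \tr (C *m K))); rewrite addrK addrAC subrr add0r => ED.
transitivity (\tr DW); first by apply: eq_bigr => k _; rewrite mxE.
by rewrite ED; congr (_ * _); apply: eq_bigr => l _; rewrite mxE.
Qed.

End Piola.

End ChangeOfCoordinates.

(** * Reciprocals and positive definite matrices *)

Lemma is_derive_inv (R : realType) (t : R) : t != 0 ->
  is_derive t 1 (fun s : R => s^-1) (- t ^- 2).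
Proof.
move=> t0; have := @is_deriveV R id t 1 1 t0 (is_derive_id _ _).
by rewrite /GRing.scale/= mulr1.
Qed.

Lemma posdef_unitmx (R : realType) m (A : 'M[R]_m) :
  (forall v : 'rV[R]_m, v != 0 -> 0 < (v *m A *m v^T) 0 0) -> A \in unitmx.
Proof.
move=> Apos; rewrite -row_free_unit -kermx_eq0; apply/eqP/row_matrixP => a.
rewrite row0; apply/eqP/negPn/negP => v0.
have := Apos _ v0; rewrite (_ : _ *m A = 0) ?mul0mx ?mxE ?ltxx//.
by apply/sub_kermxP; exact: row_sub.
Qed.

(** All matrices on the segment [(1 - t) 1 + t A] are positive definite, so the determinant, a
    polynomial in [t], has no root on [0, 1] and keeps the sign that it has at the identity. *)
Lemma posdef_det_gt0 (R : realType) m (A : 'M[R]_m) :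
  (forall v : 'rV[R]_m, v != 0 -> 0 < (v *m A *m v^T) 0 0) -> 0 < \det A.
Proof.
move=> Apos; pose P : 'M[{poly R}]_m := (1 - 'X)%:M + 'X *: map_mx polyC A.
have PE t : (\det P).[t] = \det ((1 - t)%:M + t *: A).
  rewrite -[LHS]/(horner_eval t _) -det_map_mx; congr (\det _).
  apply/matrixP => i j; rewrite [LHS]mxE/= horner_evalE !mxE.
  by case: eqP => _; rewrite ?mulr1n ?mulr0n !hornerE.
have detN t : 0 <= t <= 1 -> \det ((1 - t)%:M + t *: A) != 0.
  move=> /andP[t0 t1]; rewrite -unitfE -unitmxE; apply: posdef_unitmx => v v0.
  have -> : (v *m ((1 - t)%:M + t *: A) *m v^T) 0 0 =
      (1 - t) * (v *m v^T) 0 0 + t * (v *m A *m v^T) 0 0.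
    rewrite mulmxDr mulmxDl mul_mx_scalar -scalemxAl -scalemxAr -scalemxAl [LHS]mxE.
    by congr (_ + _); rewrite [LHS]mxE.
  have vv : 0 < (v *m v^T) 0 0.
    rewrite mxE; under eq_bigr do rewrite mxE -expr2.
    rewrite lt_neqAle eq_sym sumr_ge0 ?andbT// => [|i _]; last exact: sqr_ge0.
    rewrite psumr_eq0 => [|i _]; last exact: sqr_ge0.
    apply: contra v0 => /allP v0; apply/eqP/rowP => i; rewrite mxE.
    by have := v0 i (mem_index_enum _); rewrite sqrf_eq0 => /eqP.
  have Av := Apos v v0.
  move: t0; rewrite le_eqVlt => /predU1P[<-|t0].
    by rewrite subr0 mul1r mul0r addr0.
  by rewrite ltr_wpDl ?mulr_gt0// mulr_ge0 ?subr_ge0// ltW.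
rewrite ltNge; apply/negP => A0.
have [||t t01] := @poly_ivt R (- \det P) 0 1 => //.
  rewrite !hornerN !PE subr0 subrr scale0r addr0 raddf0 add0r scale1r det1.
  by rewrite lerNl oppr0 ler01 lerNr oppr0.
by rewrite rootN => /rootP; rewrite PE => /eqP; rewrite (negbTE (detN _ t01)).
Qed.

(** * The equation in a chart *)

Section LocalEquation.
Variables (R : realType) (n : nat) (M : ptopologicalType).
Variable S : smooth_manifold R n M.
Local Notation vec := 'rV[R]_n.+1.
Local Notation H := (@half_space R n).
Implicit Types (i j : Defs.index S) (k l : 'I_n.+1) (x y : vec) (u : M -> R).

Definition codom i : set vec := chart i @` dom i.
Definition overlap i j : set vec := chart i @` (dom i `&` dom j).
Local Notation V_ i := (codom i).
Local Notation tau i j := (fun x => chart j (param i x)).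

Lemma rel_open_codom i : rel_open (V_ i).
Proof. by have [U Uo iU] := @image_open _ _ _ S i; exists U. Qed.

Lemma param_dom i x : V_ i x -> dom i (param i x) /\ chart i (param i x) = x.
Proof. by move=> [p ip <-]; rewrite chartK. Qed.

Lemma overlapE i j x : overlap i j x <-> V_ i x /\ dom j (param i x).
Proof.
split=> [[p [ip jp] <-]|[[p ip <-]]]; rewrite chartK//; last by move=> jp; exists p.
by split=> //; exists p.
Qed.

Lemma overlap_codom i j : overlap i j `<=` V_ i.
Proof. by move=> x /overlapE[]. Qed.

Lemma rel_open_overlap i j : rel_open (overlap i j).
Proof.
have Vo := rel_open_codom i.
apply: rel_open_nbhs => [x /overlapE[/(rel_open_sub Vo)]//|x /overlapE[Vx jx]].
have [d1 d10 d1P] := rel_openP Vo Vx.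
have /subspace_continuousP/(_ x Vx) := @param_continuous _ _ _ S i.
have : nbhs (param i x) (dom j) by apply: open_nbhs_nbhs; split=> //; exact: dom_open.
move=> jn /(_ _ jn); rewrite /= /within/= => /nbhs_ballP[d2 /= d20 d2P].
exists (Num.min d1 d2) => [|y Hy]; first by rewrite lt_min d10.
rewrite lt_min => /andP[y1 y2]; have Vy : V_ i y by exact: d1P.
apply/overlapE; split => //; apply: d2P => //.
by rewrite mx_norm_ball /ball_/= distrC.
Qed.

Lemma transition_overlap i j x : overlap i j x -> overlap j i (chart j (param i x)).
Proof. by move=> [p [ip jp] <-]; exists p => //; rewrite chartK. Qed.

Lemma transitionK i j x : overlap i j x -> chart i (param j (chart j (param i x))) = x.
Proof. by move=> [p [ip jp] <-]; rewrite !chartK. Qed.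

Lemma transition_Ck m i j l : Ck m (overlap i j) (fun x => chart j (param i x) 0 l).
Proof. exact: transition_smooth. Qed.

Lemma transition_jacobianE i j : transition_jacobian i j = jacobian (tau i j).
Proof. by []. Qed.

Lemma transition_jacobianK i j x : overlap i j x ->
  transition_jacobian i j x *m transition_jacobian j i (chart j (param i x)) = 1%:M.
Proof.
move=> Vx; have Vo := rel_open_overlap i j; have Hx := rel_open_sub Vo Vx.
apply/matrixP => k l.
have h1 : has_pderiv ((fun y => chart i (param j y) 0 l) \o tau i j) k x
    (\sum_a jacobian (tau i j) x k a *
       pderiv (fun y => chart i (param j y) 0 l) a (tau i j x)).
  apply: (has_pderiv_transition Vo (rel_open_overlap j i)) => //.
  - by move=> y; exact: transition_overlap.
  - by move=> a; exact: transition_Ck.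
  - exact: transition_Ck.
have [d d0 dP] := rel_openP Vo Vx.
have h2 : has_pderiv ((fun y => chart i (param j y) 0 l) \o tau i j) k x (k == l)%:R.
  apply: (@has_pderiv_near _ _ (fun y => y 0 l) _ _ _ _ d) => //; last exact: has_pderiv_coord.
    by rewrite /= transitionK.
  move=> h hd Hh /=; rewrite transitionK//; apply: dP => //.
  by rewrite addrC addKr (le_lt_trans (norm_scale_delta _ _)).
have := has_pderiv_unique Hx h1 h2; rewrite !mxE => <-.
by apply: eq_bigr => a _; rewrite !mxE.
Qed.

Lemma transition_jacobian_unit i j x : overlap i j x ->
  transition_jacobian i j x \in unitmx.
Proof. by move=> /transition_jacobianK/mulmx1_unit[]. Qed.

Lemma pderiv_transition i j u k x : Ck_on S 1 u -> overlap i j x ->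
  pderiv (u \o param i) k x = \sum_l transition_jacobian i j x k l *
    pderiv (u \o param j) l (chart j (param i x)).
Proof.
move=> Cu Vx; have Vo := rel_open_overlap i j; have Hx := rel_open_sub Vo Vx.
apply: pderivE => //.
have h1 : has_pderiv ((u \o param j) \o tau i j) k x
    (\sum_a jacobian (tau i j) x k a * pderiv (u \o param j) a (tau i j x)).
  apply: (has_pderiv_transition Vo (rel_open_codom j)) => //.
  - by move=> y /transition_overlap/overlap_codom.
  - by move=> a; exact: transition_Ck.
  - exact: Cu.
have [d d0 dP] := rel_openP Vo Vx.
have ej y : overlap i j y -> u (param j (chart j (param i y))) = u (param i y).
  by move=> [p [ip jp] <-]; rewrite !chartK.
apply: has_pderiv_near d0 _ _ h1; first by rewrite /= ej.
move=> h hd Hh /=; rewrite ej//; apply: dP => //.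
by rewrite addrC addKr (le_lt_trans (norm_scale_delta _ _)).
Qed.

(** If the image were an interior point, the 0-th coordinate of the inverse transition would have an
    interior minimum there; column 0 of its Jacobian would vanish, against invertibility. *)
Lemma transition_bdry i j x : overlap i j x -> x 0 0 = 0 -> chart j (param i x) 0 0 = 0.
Proof.
move=> Vx x0; set y := chart j (param i x).
have Vy : overlap j i y by exact: transition_overlap.
have Wo := rel_open_overlap j i.
have : 0 <= y 0 0 by exact: rel_open_sub Wo _ Vy.
rewrite le_eqVlt => /predU1P[//|y0].
have yx : chart i (param j y) = x by exact: transitionK.
have J0 k : transition_jacobian j i y k 0 = 0.
  rewrite mxE; apply: (pderiv_at_min Wo (transition_Ck 1 j i 0) Vy _ (or_intror y0)).
  move=> z /transition_overlap/(rel_open_sub (rel_open_overlap i j)).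
  by rewrite yx x0.
have /(congr1 (fun A : 'M[R]_n.+1 => A 0 0)) := transition_jacobianK Vx.
rewrite !mxE big1 => [|k _]; last by rewrite J0 mulr0.
by move=> /eqP; rewrite eq_sym oner_eq0.
Qed.

(** On the boundary the 0-th coordinate of the transition is at its minimum 0, so its tangential
    derivatives vanish. *)
Lemma transition_jacobian_tangent i j x k : overlap i j x -> x 0 0 = 0 -> k != 0 ->
  transition_jacobian i j x k 0 = 0.
Proof.
move=> Vx x0 k0; have Vo := rel_open_overlap i j.
rewrite mxE; apply: (pderiv_at_min Vo (transition_Ck 1 i j 0) Vx _ (or_introl k0)).
move=> z /transition_overlap/(rel_open_sub (rel_open_overlap j i)) Hz.
by rewrite (transition_bdry Vx x0).
Qed.

Variable g : riemannian_metric S.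

Lemma metric_unit i x : V_ i x -> metric g i x \in unitmx.
Proof. by move=> Vx; apply: posdef_unitmx => v; exact: metric_pos. Qed.

Lemma metric_det_gt0 i x : V_ i x -> 0 < \det (metric g i x).
Proof. by move=> Vx; apply: posdef_det_gt0 => v; exact: metric_pos. Qed.

Lemma density_gt0 i x : V_ i x -> 0 < density g i x.
Proof. by move=> Vx; rewrite sqrtr_gt0 metric_det_gt0. Qed.

Lemma Ck1_metric i k l : Ck 1 (V_ i) (fun x => metric g i x k l).
Proof. exact: metric_smooth. Qed.

Lemma Ck1_density i : Ck 1 (V_ i) (density g i).
Proof.
have Vo := rel_open_codom i; have VH := rel_open_sub Vo.
apply: (@Ck1_comp _ _ _ VH Num.sqrt (fun t => (2 * Num.sqrt t)^-1)).
- by apply: Ck1_det => // a b; exact: Ck1_metric.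
- by move=> x Vx; exact: is_derive1_sqrt (metric_det_gt0 Vx).
- move=> x Vx; apply: cvgV; first by rewrite mulf_neq0// gt_eqF// sqrtr_gt0 metric_det_gt0.
  by apply: cvgM; [exact: cvg_cst|exact: sqrt_continuous].
Qed.

Lemma Ck1_inverse_metric i k l : Ck 1 (V_ i) (fun x => invmx (metric g i x) k l).
Proof.
have Vo := rel_open_codom i; have VH := rel_open_sub Vo.
apply: (@Ck1_eq _ _ _ VH (fun x => (\det (metric g i x))^-1 * cofactor (metric g i x) l k)) => //.
  by move=> x Vx; rewrite /invmx metric_unit// !mxE.
apply: Ck1M => //.
  apply: (@Ck1_comp _ _ _ VH (fun t => t^-1) (fun t => - t ^- 2)).
  - by apply: Ck1_det => // a b; exact: Ck1_metric.
  - by move=> x Vx; apply: is_derive_inv; rewrite gt_eqF// metric_det_gt0.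
  - move=> x Vx; apply: cvgN; apply: cvgV; first by rewrite expf_neq0// gt_eqF// metric_det_gt0.
    exact: exprn_continuous.
rewrite /cofactor; apply: Ck1Z => //; apply: Ck1_det => // a b.
by have := Ck1_metric i (lift l a) (lift k b); congr (Ck 1 _ _); apply/funext => x; rewrite !mxE.
Qed.

(** The gradient as a vector density: its coordinate divergence is [density] times the Laplacian,
    and it changes charts in the way required by [divergence_transition]. *)
Definition flux i u x : vec := density g i x *: (differential (u \o param i) x *m invmx (metric g i x)).

Lemma Ck1_flux i u k : Ck_on S 2 u -> Ck 1 (V_ i) (fun x => flux i u x 0 k).
Proof.
move=> Cu; have VH := rel_open_sub (rel_open_codom i).
under eq_fun do rewrite !mxE.
apply: Ck1M => //; first exact: Ck1_density.
apply: Ck1_sum => // l; apply: Ck1M => //; last exact: Ck1_inverse_metric.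
by under eq_fun do rewrite mxE; exact: Ck_pderiv (Cu i).
Qed.

Lemma overlap_chart_at i x : V_ i x -> overlap i (chart_at S (param i x)) x.
Proof. by move=> Vx; apply/overlapE; split=> //; exact: dom_chart_at. Qed.

Lemma differential_transition i j u x : Ck_on S 1 u -> overlap i j x ->
  differential (u \o param i) x = differential (u \o param j) (chart j (param i x))
    *m (transition_jacobian i j x)^T.
Proof.
move=> Cu Vx; apply/rowP => k; rewrite !mxE (pderiv_transition k Cu Vx).
by apply: eq_bigr => l _; rewrite !mxE mulrC.
Qed.

Lemma inverse_metric_transition i j x : overlap i j x ->
  let J := transition_jacobian i j x in
  invmx (metric g j (chart j (param i x))) = J^T *m invmx (metric g i x) *m J.
Proof.
move=> Vx J; have Ju : J \in unitmx by exact: transition_jacobian_unit.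
have Vi := overlap_codom Vx; have Vj := overlap_codom (transition_overlap Vx).
rewrite (metric_transition g Vx) -/J; set G := metric g j _.
have Gu : G \in unitmx by exact: metric_unit.
have JTu : J^T \in unitmx by rewrite unitmx_tr.
set X := invmx (_ *m _); set N := J^T *m X *m J.
have XE : J *m G *m J^T *m X = 1%:M by rewrite mulmxV// !unitmx_mul Ju Gu JTu.
have : G *m N = 1%:M.
  by rewrite -[LHS](mulKmx Ju) /N !mulmxA -!(mulmxA (invmx J)) XE mul1mx mulVmx.
by move=> GN; rewrite -[LHS]mulmx1 -GN mulKmx.
Qed.

Lemma density_transition i j x : overlap i j x ->
  density g i x = `|\det (transition_jacobian i j x)| * density g j (chart j (param i x)).
Proof.
move=> Vx; rewrite /density (metric_transition g Vx) !det_mulmx det_tr mulrC mulrA -expr2.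
by rewrite sqrtrM ?sqr_ge0// sqrtr_sqr.
Qed.

Lemma divergence_gradientE i u x : divergence g i (gradient g i (u \o param i)) x =
  (density g i x)^-1 * \sum_k pderiv (fun y => flux i u y 0 k) k x.
Proof.
congr (_ * _); apply: eq_bigr => k _; congr pderiv.
by apply/funext => y; rewrite [RHS]mxE.
Qed.

(** [laplacian] evaluates each point in its own chart, whereas the analysis takes place on a cube of
    one chart. The fluxes in both charts satisfy the hypothesis of [divergence_transition] because
    metric, density and differential all transform by the Jacobian. *)
Lemma laplacian_chart i u x : Ck_on S 2 u -> V_ i x ->
  laplacian g u (param i x) =
  (density g i x)^-1 * \sum_k pderiv (fun y => flux i u y 0 k) k x.
Proof.
move=> Cu Vx; have [ip cx] := param_dom Vx.
rewrite /laplacian divergence_gradientE; set j := chart_at S _.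
have Ox : overlap i j x by exact: overlap_chart_at.
have Cu1 : Ck_on S 1 u by move=> a; exact: Ck_le (Cu a).
set y := chart j _.
have Oo := rel_open_overlap i j; have Vjo := rel_open_codom j.
have := @divergence_transition R n (overlap i j) (V_ j) (tau i j) Oo Vjo.
move=> /(_ _ _ _ (flux i u) (flux j u)) ->; last first.
- exact: Ox.
- move=> z Oz; rewrite -transition_jacobianE /flux (density_transition Oz).
  rewrite (differential_transition Cu1 Oz) (inverse_metric_transition Oz).
  by rewrite -!scalemxAl scalerA !mulmxA.
- by move=> k; exact: Ck1_flux.
- by move=> k; apply: (Ck_sub _ (@Ck1_flux i u k Cu)); exact: overlap_codom.
- by move=> z; exact: transition_jacobian_unit.
- by move=> l; exact: transition_Ck.
- by move=> z /transition_overlap/overlap_codom.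
rewrite (density_transition Ox) -transition_jacobianE invfM mulrACA mulVf ?mul1r//.
by rewrite normr_eq0 -unitfE -unitmxE transition_jacobian_unit.
Qed.

Lemma dirichlet_chart i u x : dirichlet S u -> V_ i x -> x 0 0 = 0 -> u (param i x) = 0.
Proof.
move=> du Vx x0; have [ip cx] := param_dom Vx; apply: du; rewrite /bdry/=.
by apply: (@transition_bdry i) => //; exact: overlap_chart_at.
Qed.

(** On the boundary the conormal derivatives in two charts differ by a nonzero factor: entry 0 of
    [J^T] applied to the gradient only sees [J 0 0], the rest of column 0 being zero by tangency. *)
Lemma neumann_chart i u x : Ck_on S 1 u -> neumann g u -> V_ i x -> x 0 0 = 0 ->
  flux i u x 0 0 = 0.
Proof.
move=> Cu nu Vx x0; have [ip cx] := param_dom Vx.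
set j := chart_at S (param i x).
have Ox : overlap i j x by exact: overlap_chart_at.
have := nu (param i x); rewrite /bdry/= (transition_bdry Ox x0) => /(_ erefl).
rewrite /normal_derivative -/j /outward_normal; set y := chart j _.
set G := invmx (metric g j y).
have Vy : V_ j y by exact: overlap_codom (transition_overlap Ox).
set J := transition_jacobian i j x.
have gu := metric_unit Vy.
have Gsym : G^T = G by rewrite /G trmx_inv (Defs.metric_sym g Vy).
have G00 : 0 < G 0 0.
  have e0 : delta_mx 0 0 *m G != 0 :> vec.
    apply/eqP => /(congr1 (fun A => A *m metric g j y)); rewrite -mulmxA mulVmx// mulmx1 mul0mx.
    by move=> /matrixP/(_ 0 0); rewrite !mxE eqxx /= => /eqP; rewrite oner_eq0.
  have := metric_pos g Vy e0; rewrite -mulmxA trmx_mul Gsym trmx_delta !mulmxA.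
  by rewrite mulmxKV// -rowE -colE !mxE.
set s := (Num.sqrt (G 0 0))^-1.
have s0 : - s != 0 by rewrite oppr_eq0 invr_eq0 gt_eqF// sqrtr_gt0.
have -> : \sum_k (- (s *: row 0 G)) 0 k * pderiv (u \o param j) k y =
    - s * (G *m (differential (u \o param j) y)^T) 0 0.
  rewrite mxE mulr_sumr; apply: eq_bigr => k _; rewrite !mxE; ring.
rewrite /G (inverse_metric_transition Ox) -/J -!mulmxA -[J *m _]trmxK trmx_mul trmxK.
rewrite -(differential_transition Cu Ox) => /eqP; rewrite mulf_eq0 (negbTE s0)/= => /eqP.
rewrite mxE (bigD1 0)//= big1 => [|a a0]; last first.
  by rewrite mxE (transition_jacobian_tangent Ox)// mul0r.
rewrite addr0 mxE => /eqP; rewrite mulf_eq0 => /orP[/eqP J00|/eqP FG].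
  (* With [J 0 0 = 0] the whole column 0 of [J] would vanish, although [J] is invertible. *)
  have := transition_jacobianK (transition_overlap Ox); rewrite -/y (transitionK Ox) -/J.
  move=> /matrixP/(_ 0 0); rewrite !mxE big1 => [/eqP|a _]; first by rewrite eq_sym oner_eq0.
  have [->|a0] := eqVneq a 0; first by rewrite J00 mulr0.
  by rewrite [J a 0](transition_jacobian_tangent Ox)// mulr0.
rewrite /flux mxE -[differential _ _ *m _]trmxK trmx_mul trmx_inv (Defs.metric_sym g Vx).
by rewrite mxE FG mulr0.
Qed.

End LocalEquation.

(** * Riemann sums *)

Section CountInterval.
Variables (R : realType).

Lemma min_spec (x y : R) :
  [/\ Num.min x y <= x, Num.min x y <= y & Num.min x y = x \/ Num.min x y = y].
Proof. by case: (leP x y) => [xy|/ltW yx]; split=> //; [left|right]. Qed.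

Lemma max_spec (x y : R) :
  [/\ x <= Num.max x y, y <= Num.max x y & Num.max x y = x \/ Num.max x y = y].
Proof. by case: (leP x y) => [xy|/ltW yx]; split=> //; [right|left]. Qed.

(** Each counted [k] is paid for by a unit increment of [k - al] clamped to [0, be + 1], and these
    increments telescope. *)
Lemma count_interval_le (T : nat) (al be : R) : 0 <= be ->
  \sum_(k < T) ((al <= k%:R <= al + be)%R%:R : R) <= be + 1.
Proof.
move=> be0; pose c (k : nat) : R := Num.min (Num.max (k%:R - al) 0) (be + 1).
have cc (k : nat) : ((al <= k%:R <= al + be)%R%:R : R) <= c k.+1 - c k.
  rewrite /c -natr1.
  have [p1 p2 p3] := max_spec (k%:R - al) 0; set M0 := Num.max (k%:R - al) 0 in p1 p2 p3 *.
  have [q1 q2 q3] := max_spec (k%:R + 1 - al) 0.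
  set M1 := Num.max (k%:R + 1 - al) 0 in q1 q2 q3 *.
  have [r1 r2 r3] := min_spec M0 (be + 1); set m0 := Num.min M0 _ in r1 r2 r3 *.
  have [s1 s2 s3] := min_spec M1 (be + 1); set m1 := Num.min M1 _ in s1 s2 s3 *.
  have [/andP[k1 k2]|_] := boolP (al <= k%:R <= al + be).
    by rewrite mulr1n; case: p3 => ?; case: q3 => ?; case: r3 => ?; case: s3 => ?; lra.
  by rewrite mulr0n; case: p3 => ?; case: q3 => ?; case: r3 => ?; case: s3 => ?; lra.
rewrite (le_trans (ler_sum _ (fun (k : 'I_T) _ => cc k)))//.
rewrite -(big_mkord xpredT (fun k => c k.+1 - c k)) telescope_sumr//.
rewrite lerBlDr /c; rewrite ge_min; apply/orP; right.
by rewrite lerDl le_min le_max lexx orbT/= addr_ge0.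
Qed.

(** The clamp of [count_interval_le], moved one unit to the right and shortened by two, has
    increments at most the indicator; [0 <= al] and [al + be <= T] let it run through its whole
    range [be - 1]. *)
Lemma count_interval_ge (T : nat) (al be : R) : 0 <= al -> 1 <= be -> al + be <= T%:R ->
  be - 1 <= \sum_(k < T) ((al <= k%:R <= al + be)%R%:R : R).
Proof.
move=> al0 be1 abT; pose c (k : nat) : R := Num.min (Num.max (k%:R - 1 - al) 0) (be - 1).
have cc (k : nat) : c k.+1 - c k <= ((al <= k%:R <= al + be)%R%:R : R).
  rewrite /c -natr1.
  have [p1 p2 p3] := max_spec (k%:R - 1 - al) 0.
  set M0 := Num.max (k%:R - 1 - al) 0 in p1 p2 p3 *.
  have [q1 q2 q3] := max_spec (k%:R + 1 - 1 - al) 0.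
  set M1 := Num.max (k%:R + 1 - 1 - al) 0 in q1 q2 q3 *.
  have [r1 r2 r3] := min_spec M0 (be - 1); set m0 := Num.min M0 _ in r1 r2 r3 *.
  have [s1 s2 s3] := min_spec M1 (be - 1); set m1 := Num.min M1 _ in s1 s2 s3 *.
  have [/andP[k1 k2]|/nandP[]] := boolP (al <= k%:R <= al + be).
  - by rewrite mulr1n; case: p3 => ?; case: q3 => ?; case: r3 => ?; case: s3 => ?; lra.
  - rewrite -ltNge mulr0n => ?.
    by case: p3 => ?; case: q3 => ?; case: r3 => ?; case: s3 => ?; lra.
  - rewrite -ltNge mulr0n => ?.
    by case: p3 => ?; case: q3 => ?; case: r3 => ?; case: s3 => ?; lra.
rewrite (le_trans _ (ler_sum _ (fun (k : 'I_T) _ => cc k)))//.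
rewrite -(big_mkord xpredT (fun k => c k.+1 - c k)) telescope_sumr//.
rewrite /c max_l; last lra; rewrite min_r; last lra.
rewrite max_r; last lra; rewrite min_l; lra.
Qed.

End CountInterval.

(** * Averages over grids of a cube *)

Section RiemannSums.
Variables (R : realType) (n : nat).
Local Notation vec := 'rV[R]_n.+1.
Local Notation H := (@half_space R n).
Local Notation e_ k := (delta_mx 0 k : vec).
Variables (a : vec) (L : R).
Hypothesis L0 : 0 < L.
Implicit Types (f g : vec -> R) (k l : 'I_n.+1) (x y : vec).

Definition cube : set vec := [set x | forall j, a 0 j <= x 0 j <= a 0 j + L].

(** The points are the lower corners of the cells, so the upper faces are never sampled. *)
Definition grid T (s : {ffun 'I_n.+1 -> 'I_T}) : vec :=
  \row_j (a 0 j + L * (s j)%:R / T%:R).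

Definition avg T f : R := T%:R^-1 ^+ n.+1 * \sum_(s : {ffun 'I_n.+1 -> 'I_T}) f (grid s).

Lemma grid_cube T (s : {ffun 'I_n.+1 -> 'I_T}) : cube (grid s).
Proof.
move=> j; rewrite mxE lerDl lerD2l; have T0 : (0 : R) < T%:R.
  by rewrite ltr0n (leq_ltn_trans _ (ltn_ord (s j))).
rewrite !mulr_ge0 ?invr_ge0 ?ler0n ?(ltW L0)//=.
by rewrite ler_pdivrMr// ler_pM2l// ler_nat ltnW.
Qed.

Lemma avgD T f g : avg T (fun x => f x + g x) = avg T f + avg T g.
Proof. by rewrite /avg big_split mulrDr. Qed.

Lemma avgZ T c f : avg T (fun x => c * f x) = c * avg T f.
Proof. by rewrite /avg -mulr_sumr mulrCA. Qed.

Lemma avg_le T f g : (forall x, cube x -> f x <= g x) -> avg T f <= avg T g.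
Proof.
move=> fg; rewrite /avg ler_wpM2l ?exprn_ge0 ?invr_ge0//.
by apply: ler_sum => s _; exact/fg/grid_cube.
Qed.

Lemma eq_avg T f g : (forall x, cube x -> f x = g x) -> avg T f = avg T g.
Proof. by move=> fg; congr (_ * _); apply: eq_bigr => s _; exact/fg/grid_cube. Qed.

(** Stands for a vanishing integral; the index [T.+1] keeps the grid nonempty. Estimates follow by
    averaging pointwise inequalities at one large [T]. *)
Definition null f : Prop := (avg T.+1 f) @[T --> \oo] --> 0.

Lemma null0 : null (fun=> 0).
Proof.
rewrite /null; under eq_fun do rewrite /avg big1// mulr0; exact: cvg_cst.
Qed.

Lemma nullD f g : null f -> null g -> null (fun x => f x + g x).
Proof.
move=> fn gn; rewrite /null; under eq_fun do rewrite avgD.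
by rewrite -[0]addr0; exact: cvgD.
Qed.

Lemma nullZ c f : null f -> null (fun x => c * f x).
Proof.
move=> fn; rewrite /null; under eq_fun do rewrite avgZ.
by rewrite -[0](mulr0 c); apply: cvgM => //; exact: cvg_cst.
Qed.

Lemma null_sum (I : Type) (r : seq I) (F : I -> vec -> R) :
  (forall i, null (F i)) -> null (fun x => \sum_(i <- r) F i x).
Proof.
move=> FN; elim: r => [|i r IHr].
  by under eq_fun do rewrite big_nil; exact: null0.
by under eq_fun do rewrite big_cons; exact: nullD.
Qed.

Lemma eq_null f g : (forall x, cube x -> f x = g x) -> null f -> null g.
Proof.
move=> fg; apply: cvg_trans; apply: near_eq_cvg; apply: nearW => T.
exact: eq_avg.
Qed.

Lemma null_avg_le f e : null f -> 0 < e -> exists T0 : nat, forall T, (T0 <= T)%N ->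
  `|avg T.+1 f| <= e.
Proof.
move=> /cvgrPdist_le + e0 => /(_ e e0)[T0 _ T0P]; exists T0 => T TT.
by have := T0P T TT; rewrite sub0r normrN.
Qed.

Lemma compact_cube : compact cube.
Proof.
rewrite (_ : cube = [set v : vec | forall j, `[a 0 j, a 0 j + L]%classic (v ord0 j)]).
  apply: (@rV_compact R n.+1 (fun j => `[a 0 j, a 0 j + L]%classic)) => j.
  exact: segment_compact.
by apply/seteqP; split => x xc j; have := xc j; rewrite /= in_itv.
Qed.

Lemma uniform_cube f (e : R) : {within cube, continuous f} -> 0 < e ->
  exists2 d : R, 0 < d & forall x y, cube x -> cube y -> `|y - x| < d -> `|f y - f x| <= e.
Proof.
move=> /within_continuousP fc e0.
have e2 : 0 < e / 2 by rewrite divr_gt0.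
have /compact_near_coveringP cov := compact_cube.
have [|d /= d0 dP] := cov R (0^'+)
  (fun d x => cube x -> forall y, cube y -> `|y - x| < d -> `|f y - f x| <= e) _.
- move=> x cx; have [d d0 dP] := fc x cx _ e2.
  exists (ball x (d / 2), [set r : R | 0 < r < d / 2]) => /=.
    split; first by apply: nbhsx_ballx; rewrite divr_gt0.
    by near=> r; apply/andP; split; near: r; [exact: nbhs_right_gt|
      by apply: nbhs_right_lt; rewrite divr_gt0].
  move=> [z r] /= [+ /andP[r0 rd]] cz y cy yz.
  rewrite mx_norm_ball /ball_/= distrC => zx.
  rewrite -(subrK (f x) (f y)) -addrA (le_trans (ler_normD _ _))// [leRHS]splitr lerD//.
    apply: dP => //; rewrite -(subrK z y) -addrA (le_lt_trans (ler_normD _ _))//.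
    by rewrite [ltRHS]splitr ltrD// (lt_trans yz).
  by rewrite distrC; apply: dP => //; rewrite (lt_trans zx)// ltr_pdivrMr// ltr_pMr// ltr1n.
- exists (d / 2); rewrite ?divr_gt0// => x y cx cy yx.
  apply: (dP (d / 2)) => //=; last by rewrite divr_gt0.
  by rewrite /ball_/= sub0r normrN gtr0_norm ?divr_gt0// ltr_pdivrMr// ltr_pMr// ltr1n.
Unshelve. all: by end_near. Qed.

Lemma null_pderiv (V : set vec) f k : V `<=` H -> Ck 1 V f -> cube `<=` V ->
  (forall x, cube x -> x 0 k = a 0 k -> f x = 0) ->
  (forall x, cube x -> x 0 k = a 0 k + L -> f x = 0) -> null (pderiv f k).
Proof.
move=> VH Cf cV f0 f1; apply/cvgrPdist_le => e e0.
have fc : {within cube, continuous (pderiv f k)}.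
  exact: continuous_subspaceW cV (Ck_continuous (Ck_pderiv k Cf)).
have [d d0 dP] := uniform_cube fc e0.
have [T0 T0P] : exists T0 : nat, forall T, (T0 <= T)%N -> L / T.+1%:R < d.
  exists (Num.truncn (L / d)) => T TT; rewrite ltr_pdivrMr// mulrC -ltr_pdivrMr//.
  rewrite (lt_le_trans (truncnS_gt _))// ler_nat ltnS//.
exists T0 => // T /= TT; rewrite sub0r normrN.
set h := L / T.+1%:R; have hd : h < d by exact: T0P.
have h0 : 0 < h by rewrite divr_gt0.
pose shift (s : {ffun 'I_n.+1 -> 'I_T.+1}) : {ffun 'I_n.+1 -> 'I_T.+1} :=
  [ffun j => if j == k then ordS (s j) else s j].
pose unshift (s : {ffun 'I_n.+1 -> 'I_T.+1}) : {ffun 'I_n.+1 -> 'I_T.+1} :=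
  [ffun j => if j == k then ord_pred (s j) else s j].
have shiftK : cancel shift unshift.
  by move=> s; apply/ffunP => j; rewrite !ffunE; case: eqP => // _; rewrite ordSK.
have unshiftK : cancel unshift shift.
  by move=> s; apply/ffunP => j; rewrite !ffunE; case: eqP => // _; rewrite ord_predK.
have T10 : (T.+1%:R : R) != 0 by [].
have up (s : {ffun 'I_n.+1 -> 'I_T.+1}) : cube (grid s + h *: e_ k).
  move=> j; have := grid_cube s j; rewrite !mxE eqxx /=.
  have [->|_] := eqVneq j k; last by rewrite mulr0 addr0.
  move=> /andP[g1 _]; rewrite mulr1; apply/andP; split.
    by rewrite (le_trans g1)// lerDl ltW.
  rewrite -addrA lerD2l /h -mulrDl -[X in _ + X]mulr1 -mulrDr ler_pdivrMr//.
  by rewrite ler_pM2l// natr1 ler_nat.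
(* If [s k] is the last index, the next point lies on the upper face and its cyclic successor on the
   lower face. Since [f] vanishes at both, the forward differences sum to zero exactly. *)
have fshift (s : {ffun 'I_n.+1 -> 'I_T.+1}) : f (grid s + h *: e_ k) = f (grid (shift s)).
  have gk : (grid s + h *: e_ k) 0 k = a 0 k + L * (s k).+1%:R / T.+1%:R.
    by rewrite !mxE !eqxx /= mulr1 -[(s k).+1%:R]natr1 mulrDr mulr1 mulrDl addrA.
  have [sT|sT] := ltnP (s k).+1 T.+1.
    congr f; apply/rowP => j; have [->|jk] := eqVneq j k.
      by rewrite gk [RHS]mxE ffunE eqxx /= modn_small.
    by rewrite !mxE ffunE eqxx /= (negbTE jk) mulr0 addr0.
  have sTE : (s k).+1 = T.+1 by apply/eqP; rewrite eqn_leq sT ltn_ord.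
  rewrite f1; [|exact: up|by rewrite gk sTE mulfK].
  rewrite f0//; first exact: grid_cube.
  by rewrite mxE ffunE eqxx /= sTE modnn mulr0 mul0r addr0.
have tele : \sum_(s : {ffun 'I_n.+1 -> 'I_T.+1}) (f (grid s + h *: e_ k) - f (grid s)) = 0.
  rewrite sumrB; under eq_bigr do rewrite fshift.
  rewrite [X in _ - X](reindex shift)/= ?subrr//.
  by exists unshift => s _; [exact: shiftK|exact: unshiftK].
have step (s : {ffun 'I_n.+1 -> 'I_T.+1}) : `|f (grid s + h *: e_ k) - f (grid s) - pderiv f k (grid s) * h| <= e * h.
  have gt t : 0 <= t <= h -> cube (grid s + t *: e_ k).
    move=> /andP[t0 th] j; have := grid_cube s j; have := up s j; rewrite !mxE eqxx /=.
    have [->|_] := eqVneq j k; last by rewrite !mulr0 !addr0.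
    rewrite /= !mulr1 => /andP[_ u2] /andP[u3 _]; apply/andP; split.
      by rewrite (le_trans u3)// lerDl.
    by rewrite (le_trans _ u2)// lerD2l.
  apply: (@line_mvt _ _ V) => //; first exact: ltW.
    by move=> t th; exact/cV/gt.
  move=> t th; apply: dP; [exact: grid_cube|exact: gt|].
  rewrite addrC addKr (le_lt_trans (norm_scale_delta _ _))// (le_lt_trans _ hd)//.
  by move: th => /andP[t0 th]; rewrite ger0_norm.
have -> : avg T.+1 (pderiv f k) = - (h^-1 * avg T.+1 (fun x => f (x + h *: e_ k) - f x
    - pderiv f k x * h)).
  rewrite /avg sumrB tele sub0r !mulrN opprK -mulr_suml mulrA [h^-1 * _]mulrC -mulrA.
  by rewrite [X in _ = _ * X]mulrCA mulVf ?mulr1// gt_eqF.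
rewrite normrN normrM gtr0_norm ?invr_gt0// mulrC ler_pdivrMr//.
rewrite /avg normrM ger0_norm ?exprn_ge0 ?invr_ge0//.
rewrite (@le_trans _ _ (T.+1%:R^-1 ^+ n.+1 * ((e * h) *+ (T.+1 ^ n.+1))))//.
  rewrite ler_wpM2l ?exprn_ge0 ?invr_ge0// (le_trans (ler_norm_sum _ _ _))//.
  rewrite (@le_trans _ _ (\sum_(s : {ffun 'I_n.+1 -> 'I_T.+1}) (e * h)))//.
    by apply: ler_sum => s _; exact: step.
  by rewrite sumr_const card_ffun !card_ord.
by rewrite -[X in _ * X]mulr_natr natrX exprVn mulrCA mulVf ?mulr1// expf_neq0.
Qed.

End RiemannSums.

(** * Averages of indicators of balls and boxes *)

Section Counting.
Variables (R : realType).
Variables (n : nat).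
Local Notation vec := 'rV[R]_n.+1.
Variables (a : vec) (L : R).
Hypothesis L0 : 0 < L.

Lemma avg_product T (P : 'I_n.+1 -> R -> bool) :
  avg a L T.+1 (fun x => [forall j, P j (x 0 j)]%:R) =
  \prod_j (T.+1%:R^-1 * \sum_(k < T.+1) (P j (a 0 j + L * k%:R / T.+1%:R))%:R).
Proof.
rewrite big_split/= prodr_const card_ord; congr (_ * _).
rewrite bigA_distr_bigA/=; apply: eq_bigr => s _.
have [/forallP sP|/forallPn[j /negbTE jP]] := boolP [forall j, P j (grid a L s 0 j)].
  by rewrite big1// => j _; have := sP j; rewrite mxE => ->.
by move: jP; rewrite mxE => jP; rewrite (bigD1 j)//= jP mul0r.
Qed.

(** Balls are cubes for the maximum norm. Each coordinate admits one grid value more than the length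
    [2 r] allows on average, and the 4 absorbs this extra value on a fine grid. *)
Lemma avg_ball_le (c : vec) (r : R) : 0 < r -> exists T0 : nat, forall T, (T0 <= T)%N ->
  avg a L T.+1 (fun x => (`|x - c| <= r)%R%:R) <= (4 * r / L) ^+ n.+1.
Proof.
move=> r0; exists (Num.truncn (L / (2 * r))) => T TT.
have TL : L <= 2 * r * T.+1%:R.
  rewrite mulrC -ler_pdivrMr ?mulr_gt0// ltW// (lt_le_trans (truncnS_gt _))// ler_nat ltnS//.
rewrite (_ : avg _ _ _ _ = avg a L T.+1 (fun x => [forall j, `|x 0 j - c 0 j| <= r]%:R)); last first.
  apply: eq_avg => // x _; congr (_%:R); congr nat_of_bool; apply/idP/forallP => [h j|h].
    by have /coord_normP/(_ j) := h; rewrite !mxE; apply; exact: ltW.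
  by apply/coord_normP => [|j]; [exact: ltW|rewrite !mxE].
rewrite (avg_product _ (fun j t => `|t - c 0 j| <= r)).
have -> : (4 * r / L) ^+ n.+1 = \prod_(j < n.+1) (4 * r / L) by rewrite prodr_const card_ord.
apply: ler_prod => j _; rewrite mulr_ge0 ?invr_ge0 ?sumr_ge0//=.
have q0 : 0 < T.+1%:R / L by rewrite divr_gt0.
set q := T.+1%:R / L in q0; have Lq : L * q = T.+1%:R by rewrite mulrC divfK// gt_eqF.
under eq_bigr => k _.
  rewrite (_ : (`|_| <= r) = ((c 0 j - r - a 0 j) * q <= k%:R <= (c 0 j - r - a 0 j) * q + 2 * r * q)).
    over.
  have -> : (c 0 j - r - a 0 j) * q + 2 * r * q = (c 0 j + r - a 0 j) * q by ring.
  set w := L * k%:R / T.+1%:R; have -> : k%:R = w * q.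
    by rewrite /q /w -mulrA mulKf// mulrAC divff ?mul1r// gt_eqF.
  rewrite !ler_pM2r// ler_norml; apply/andP/andP; case; split; lra.
rewrite mulrC ler_pdivrMr//.
have rq : 0 <= 2 * r * q by rewrite mulr_ge0 ?(ltW q0)// mulr_ge0// ltW.
rewrite (le_trans (count_interval_le _ _ rq))//.
have -> : 4 * r / L * T.+1%:R = 2 * r * q + 2 * r * q by rewrite /q; ring.
by rewrite lerD2l /q mulrA ler_pdivlMr// mul1r.
Qed.

(** The box extends in the positive directions from its corner [c], so it stays in the half-space
    when [c] is a boundary point. The 2 in [2 * L] absorbs the rounding of the count. *)
Lemma avg_box_ge (c : vec) (r : R) : 0 < r ->
  (forall j, a 0 j <= c 0 j /\ c 0 j + r <= a 0 j + L) ->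
  exists T0 : nat, forall T, (T0 <= T)%N ->
  (r / (2 * L)) ^+ n.+1 <=
    avg a L T.+1 (fun x => [forall j, c 0 j <= x 0 j <= c 0 j + r]%R%:R).
Proof.
move=> r0 cP; exists (Num.truncn (2 * L / r)) => T TT.
have TL : 2 * L <= r * T.+1%:R.
  rewrite [leRHS]mulrC -ler_pdivrMr// ltW// (lt_le_trans (truncnS_gt _))// ler_nat ltnS//.
rewrite (avg_product _ (fun j t => c 0 j <= t <= c 0 j + r)).
have -> : (r / (2 * L)) ^+ n.+1 = \prod_(j < n.+1) (r / (2 * L)) by rewrite prodr_const card_ord.
apply: ler_prod => j _; rewrite divr_ge0 ?mulr_ge0 ?(ltW L0) ?(ltW r0)//=.
have q0 : 0 < T.+1%:R / L by rewrite divr_gt0.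
set q := T.+1%:R / L in q0; have Lq : L * q = T.+1%:R by rewrite mulrC divfK// gt_eqF.
under eq_bigr => k _.
  rewrite (_ : (_ <= _ <= _ + r) = ((c 0 j - a 0 j) * q <= k%:R <= (c 0 j - a 0 j) * q + r * q)).
    over.
  rewrite -mulrDl; set w := L * k%:R / T.+1%:R; have -> : k%:R = w * q.
    by rewrite /q /w -mulrA mulKf// mulrAC divff ?mul1r// gt_eqF.
  by rewrite !ler_pM2r//; apply/andP/andP; case; split; lra.
rewrite [leRHS]mulrC ler_pdivlMr//.
have [ac cL] := cP j; have rq : 2 <= r * q by rewrite /q mulrA ler_pdivlMr.
apply: (@le_trans _ _ (r * q - 1)).
  have -> : r / (2 * L) * T.+1%:R = r * q / 2 by rewrite /q; field; rewrite gt_eqF.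
  lra.
apply: count_interval_ge; [|lra|].
  by rewrite mulr_ge0 ?subr_ge0 ?(ltW q0).
by rewrite -mulrDl -Lq ler_pM2r//; lra.
Qed.

End Counting.

Arguments has_pderiv_coord {R n} j k x.
Arguments has_pderiv_cst {R n} c k x.

(** * Radial functions *)

Section QuadraticForms.
Variables (R : realType) (n : nat).
Local Notation vec := 'rV[R]_n.+1.
Implicit Types (z w : vec).

Definition dot z w : R := \sum_k z 0 k * w 0 k.

Lemma dotC z w : dot z w = dot w z.
Proof. by apply: eq_bigr => k _; rewrite mulrC. Qed.

Lemma dotDl z z' w : dot (z + z') w = dot z w + dot z' w.
Proof. by rewrite -big_split; apply: eq_bigr => k _; rewrite mxE mulrDl. Qed.

Lemma dotZl c z w : dot (c *: z) w = c * dot z w.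
Proof. by rewrite mulr_sumr; apply: eq_bigr => k _; rewrite mxE mulrA. Qed.

Lemma dotDr z w w' : dot z (w + w') = dot z w + dot z w'.
Proof. by rewrite dotC dotDl !(dotC z). Qed.

Lemma dotZr c z w : dot z (c *: w) = c * dot z w.
Proof. by rewrite dotC dotZl dotC. Qed.

Lemma dotE z w : dot z w = (z *m w^T) 0 0.
Proof. by rewrite mxE; apply: eq_bigr => k _; rewrite mxE. Qed.

Lemma dot_mulmx z w (B : 'M[R]_n.+1) : dot (z *m B) w = dot z (w *m B^T).
Proof. by rewrite !dotE trmx_mul trmxK mulmxA. Qed.

Lemma dot_ge0 z : 0 <= dot z z.
Proof. by apply: sumr_ge0 => k _; rewrite -expr2 sqr_ge0. Qed.

Lemma sqr_coord_le_dot z k : z 0 k ^+ 2 <= dot z z.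
Proof.
rewrite /dot (bigD1 k)//= -expr2 lerDl; apply: sumr_ge0 => j _.
by rewrite -expr2 sqr_ge0.
Qed.

Lemma coord_le_sqrt_dot z k : `|z 0 k| <= Num.sqrt (dot z z).
Proof. by rewrite -sqrtr_sqr ler_wsqrtr// sqr_coord_le_dot. Qed.

Lemma dot_le_norm z : dot z z <= n.+1%:R * `|z| ^+ 2.
Proof.
rewrite (@le_trans _ _ (\sum_(k < n.+1) `|z| ^+ 2))//; last first.
  by rewrite sumr_const card_ord mulr_natl.
apply: ler_sum => k _; rewrite -expr2 -real_normK ?num_real//.
by rewrite ler_sqr ?nnegrE// coord_norm_le.
Qed.

Section form.
Variables (B : 'M[R]_n.+1) (th La : R).
Hypotheses (Bsym : B^T = B) (th0 : 0 < th).
Hypothesis Bell : forall w, th * dot w w <= dot (w *m B) w.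
Hypothesis Bbd : forall k l, `|B k l| <= La.

Let A := invmx B.

Lemma form_unit : B \in unitmx.
Proof.
apply: posdef_unitmx => v v0; rewrite -dotE (lt_le_trans _ (Bell v))// mulr_gt0//.
rewrite lt_neqAle dot_ge0 andbT eq_sym psumr_eq0 => [|k _]; last by rewrite -expr2 sqr_ge0.
apply: contra v0 => /allP v0; apply/eqP/rowP => k; rewrite mxE.
by have := v0 k (mem_index_enum _); rewrite -expr2 sqrf_eq0 => /eqP.
Qed.

Lemma form_inv_sym : A^T = A.
Proof. by rewrite /A trmx_inv Bsym. Qed.

Lemma form_mulVK z : z *m A *m B = z.
Proof. by rewrite mulmxKV// form_unit. Qed.

Lemma form_mulKV z : z *m B *m A = z.
Proof. by rewrite mulmxK// form_unit. Qed.

Lemma form_le w : dot (w *m B) w <= n.+1%:R * La * dot w w.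
Proof.
have La0 : 0 <= La by exact: le_trans (Bbd 0 0).
rewrite (@le_trans _ _ (\sum_k \sum_l La * ((w 0 l ^+ 2 + w 0 k ^+ 2) / 2)))//.
  apply: ler_sum => k _; rewrite mxE mulr_suml; apply: ler_sum => l _.
  rewrite mulrAC (le_trans (ler_norm _))// normrM mulrC ler_pM//.
  rewrite normrM; have := sqr_ge0 (`|w 0 l| - `|w 0 k|).
  by rewrite -(real_normK (num_real (w 0 l))) -(real_normK (num_real (w 0 k))); nra.
under eq_bigr => k _.
  rewrite -mulr_sumr -mulr_suml big_split/= sumr_const card_ord; over.
rewrite -mulr_sumr -mulr_suml big_split/= sumr_const card_ord.
have E : dot w w = \sum_k w 0 k ^+ 2 by apply: eq_bigr => k _; rewrite expr2.
rewrite sumrMnl -E.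
have -> : dot w w *+ n.+1 + dot w w *+ n.+1 = 2 * (n.+1%:R * dot w w).
  by rewrite -[dot w w *+ _]mulr_natl; ring.
by rewrite (mulrC 2) mulfK// mulrCA mulrA.
Qed.

Lemma inv_form_ge z : th * dot (z *m A) (z *m A) <= dot (z *m A) z.
Proof. by rewrite (le_trans (Bell _))// form_mulVK dotC. Qed.

Lemma inv_form_ge0 z : 0 <= dot (z *m A) z.
Proof. by rewrite (le_trans _ (inv_form_ge z))// mulr_ge0 ?dot_ge0// ltW. Qed.

(** Expansion of the square of [z A - z / th], combined with [inv_form_ge]. *)
Lemma inv_form_le z : dot (z *m A) z <= th^-1 * dot z z.
Proof.
have h := inv_form_ge z.
have : 0 <= dot (z *m A - th^-1 *: z) (z *m A - th^-1 *: z) by exact: dot_ge0.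
rewrite -scaleNr dotDl !dotDr !dotZl !dotZr (dotC z (z *m A)).
set s := dot (z *m A) z in h *; set b := dot (z *m A) _ in h *; set c := dot z z => h2.
have : 0 <= th * (b + - th^-1 * s + (- th^-1 * s + - th^-1 * (- th^-1 * c))).
  by rewrite mulr_ge0// ltW.
have -> : th * (b + - th^-1 * s + (- th^-1 * s + - th^-1 * (- th^-1 * c))) =
  th * b - 2 * s + th^-1 * c by field; rewrite gt_eqF.
lra.
Qed.

(** Cauchy-Schwarz between the form and its inverse, from the nonnegativity of the inverse form at
    [z - t w B] for all [t]. *)
Lemma form_cauchy z w : dot z w ^+ 2 <= dot (z *m A) z * dot (w *m B) w.
Proof.
have pos t : 0 <= dot (z *m A) z - 2 * t * dot z w + t ^+ 2 * dot (w *m B) w.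
  have := inv_form_ge0 (z - t *: (w *m B)).
  rewrite mulmxDl -scaleNr -scalemxAl form_mulKV dotDl !dotDr !dotZl !dotZr.
  rewrite [dot (z *m A) (w *m B)]dot_mulmx form_inv_sym form_mulKV (dotC w z) (dotC w (w *m B)).
  lra.
set s := dot (z *m A) z in pos *; set b := dot (w *m B) w in pos *; set c := dot z w in pos *.
have b0 : 0 <= b by rewrite (le_trans _ (Bell w))// mulr_ge0 ?dot_ge0// ltW.
move: b0; rewrite le_eqVlt => /predU1P[b0|b0].
  have [c0|c0] := eqVneq c 0; first by rewrite c0 -b0 mulr0 expr0n.
  (* When the form vanishes at [w] the quadratic is affine in [t], and this [t] gives it the value
     -1. *)
  have := pos ((s + 1) / (2 * c)); rewrite -b0 mulr0 addr0.
  have -> : s - 2 * ((s + 1) / (2 * c)) * c = - 1 by field.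
  by rewrite lerNr oppr0 ler10.
have := pos (c / b).
have -> : s - 2 * (c / b) * c + (c / b) ^+ 2 * b = s - c ^+ 2 / b by field; rewrite gt_eqF.
by rewrite subr_ge0 ler_pdivrMr.
Qed.

Lemma dot_le_inv_form z : dot z z <= n.+1%:R * La * dot (z *m A) z.
Proof.
have La0 : 0 <= La by exact: le_trans (Bbd 0 0).
have := form_cauchy z z; have := form_le z; have := dot_ge0 z.
rewrite le_eqVlt => /predU1P[<-|c0] h1 h2.
  by rewrite !mulr_ge0// inv_form_ge0.
rewrite -(ler_pM2r c0) -expr2 (le_trans h2)//.
rewrite mulrAC [leRHS]mulrC; exact/(ler_wpM2l (inv_form_ge0 z)).
Qed.

End form.

End QuadraticForms.

Lemma has_pderiv_shift (R : realType) n (y : 'rV[R]_n.+1) l k x :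
  has_pderiv (fun u : 'rV[R]_n.+1 => (u - y) 0 l) k x (k == l)%:R.
Proof.
have := has_pderivB (has_pderiv_coord l k x) (has_pderiv_cst (y 0 l) k x).
by rewrite subr0; congr has_pderiv; apply/funext => u; rewrite !mxE.
Qed.
Arguments has_pderiv_shift {R n} y l k x.

(** * Functions and fields of a regularised distance *)

Section RadialFunctions.
Variables (R : realType) (n : nat).
Local Notation vec := 'rV[R]_n.+1.
Local Notation H := (@half_space R n).
Implicit Types (k l : 'I_n.+1) (x y : vec).
Variables (A : 'M[R]_n.+1) (eps : R).
Hypotheses (Asym : A^T = A) (eps0 : 0 < eps).
Hypothesis A_ge0 : forall z : vec, 0 <= dot (z *m A) z.
Variable y : vec.

Definition sqdist x : R := dot ((x - y) *m A) (x - y).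
(* The inverse of the distance to [y] for the scalar product A, regularised at
   scale [eps]. *)
Definition rtau x : R := (Num.sqrt (sqdist x + eps ^+ 2))^-1.
(** Half the differential of [sqdist]. Paired with the conormal derivative at frozen coefficients,
    it gives the pairing of [x - y] with the differential, see [center_adist_conormal]. *)
Definition adist x : vec := (x - y) *m A.

Lemma rtau_gt0 x : 0 < rtau x.
Proof. by rewrite invr_gt0 sqrtr_gt0 ltr_wpDl// ?A_ge0 ?exprn_gt0. Qed.

Lemma sqr_rtau x : rtau x ^+ 2 * (sqdist x + eps ^+ 2) = 1.
Proof.
have q0 : 0 < sqdist x + eps ^+ 2 by rewrite ltr_wpDl// ?A_ge0 ?exprn_gt0.
by rewrite /rtau exprVn sqr_sqrtr ?ltW// mulVf// gt_eqF.
Qed.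

(** The defect [(eps * rtau)^2] is the trace left by the regularisation; it is what becomes the
    smoothed pole [core] in the mean value inequality. *)
Lemma sqr_rtauE x : rtau x ^+ 2 * sqdist x = 1 - (eps * rtau x) ^+ 2.
Proof. by rewrite -(sqr_rtau x); ring. Qed.

Lemma sqr_rtau_le1 x : rtau x ^+ 2 * sqdist x <= 1.
Proof. by rewrite sqr_rtauE lerBlDr lerDl sqr_ge0. Qed.

Lemma eps_rtau_le1 x : eps * rtau x <= 1.
Proof.
have e0 : 0 <= eps * rtau x by rewrite mulr_ge0 ?(ltW eps0)// ltW ?rtau_gt0.
rewrite -(@expr_le1 _ 2)//.
by have := mulr_ge0 (sqr_ge0 (rtau x)) (A_ge0 (x - y)); rewrite -/(sqdist x) sqr_rtauE subr_ge0.
Qed.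

Lemma has_pderiv_sqdist k x : has_pderiv sqdist k x (2 * adist x 0 k).
Proof.
have hz l := has_pderiv_shift y l k x.
have ha l : has_pderiv (fun u : vec => adist u 0 l) k x (A k l).
  have := has_pderiv_sum (r := index_enum 'I_n.+1) (fun j => has_pderivM (hz j) (has_pderiv_cst (A j l) k x)).
  rewrite (bigD1 k)//= big1 => [|j jk].
    rewrite eqxx mulr0 !addr0 mul1r; congr has_pderiv.
    by apply/funext => u; rewrite mxE.
  by rewrite eq_sym (negbTE jk) mul0r mulr0 addr0.
have := has_pderiv_sum (r := index_enum 'I_n.+1) (fun l => has_pderivM (ha l) (hz l)).
congr (has_pderiv _ _ _ _); rewrite big_split/= mulr2n mulrDl mul1r; congr (_ + _).
  rewrite mxE; apply: eq_bigr => j _; rewrite mulrC; congr (_ * _).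
  by rewrite -[in RHS]Asym mxE.
rewrite (bigD1 k)//= big1 => [|j jk]; first by rewrite eqxx mulr1 addr0.
by rewrite eq_sym (negbTE jk) mulr0.
Qed.

Arguments has_pderiv_sqdist : clear implicits.

Lemma Ck1_adist V l : V `<=` H -> Ck 1 V (fun x => adist x 0 l).
Proof.
move=> VH; under eq_fun do rewrite mxE; apply: Ck1_sum => // j; apply: Ck1M => //; last exact: Ck1_cst.
by under eq_fun do rewrite !mxE; apply: Ck1B => //; [exact: Ck1_coord|exact: Ck1_cst].
Qed.

Lemma Ck1_sqdist V : V `<=` H -> Ck 1 V sqdist.
Proof.
move=> VH; apply: Ck1_sum => // j; apply: Ck1M => //; first exact: Ck1_adist.
by under eq_fun do rewrite !mxE; apply: Ck1B => //; [exact: Ck1_coord|exact: Ck1_cst].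
Qed.

Lemma is_derive_rtau (t : R) : 0 < t ->
  is_derive t 1 (fun s : R => (Num.sqrt s)^-1) (- ((Num.sqrt t)^-1 ^+ 3) / 2).
Proof.
move=> t0; have s0 : Num.sqrt t != 0 by rewrite gt_eqF// sqrtr_gt0.
have -> : - ((Num.sqrt t)^-1 ^+ 3) / 2 = - Num.sqrt t ^- 2 *: (2 * Num.sqrt t)^-1.
  by rewrite /GRing.scale/=; field.
exact: is_deriveV s0 (is_derive1_sqrt t0).
Qed.

Lemma has_pderiv_rtau k x : has_pderiv rtau k x (- (rtau x ^+ 3 * adist x 0 k)).
Proof.
have q0 : 0 < sqdist x + eps ^+ 2 by rewrite ltr_wpDl// ?A_ge0 ?exprn_gt0.
have hs := has_pderivD (has_pderiv_sqdist k x) (has_pderiv_cst (eps ^+ 2) k x).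
have := has_pderiv_comp hs (is_derive_rtau q0); congr (has_pderiv _ _ _ _).
by rewrite /rtau; field; rewrite gt_eqF// sqrtr_gt0.
Qed.

Arguments has_pderiv_rtau : clear implicits.

Lemma Ck1_rtau V : V `<=` H -> Ck 1 V rtau.
Proof.
move=> VH.
have q0 x : 0 < sqdist x + eps ^+ 2 by rewrite ltr_wpDl// ?A_ge0 ?exprn_gt0.
apply: (@Ck1_comp _ _ _ VH (fun s => (Num.sqrt s)^-1) (fun t => - ((Num.sqrt t)^-1 ^+ 3) / 2)).
- by apply: Ck1D => //; [exact: Ck1_sqdist|exact: Ck1_cst].
- by move=> x _; exact: is_derive_rtau.
- move=> x _; apply: cvgM; last exact: cvg_cst.
  apply: cvgN; apply: (@cvg_comp _ _ _ (fun t : R => (Num.sqrt t)^-1) (fun t => t ^+ 3)); last first.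
    exact: exprn_continuous.
  by apply: cvgV; [rewrite gt_eqF// sqrtr_gt0|exact: sqrt_continuous].
Qed.

Variables (phi dphi : R -> R).
Hypothesis phiD : forall t : R, 0 < t -> is_derive t 1 phi (dphi t).
Hypothesis phiC : forall t : R, 0 < t -> {for t, continuous dphi}.

Lemma Ck1_radial V : V `<=` H -> Ck 1 V (fun x => phi (rtau x)).
Proof.
move=> VH; apply: (@Ck1_comp _ _ _ VH phi dphi); first exact: Ck1_rtau.
- by move=> x _; exact/phiD/rtau_gt0.
- by move=> x _; exact/phiC/rtau_gt0.
Qed.

Lemma has_pderiv_radial k x : has_pderiv (fun x => phi (rtau x)) k x
  (- (dphi (rtau x) * rtau x ^+ 3 * adist x 0 k)).
Proof.
have := has_pderiv_comp (has_pderiv_rtau k x) (phiD (rtau_gt0 x)).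
by rewrite mulrN mulrA.
Qed.

Arguments has_pderiv_radial : clear implicits.

Definition radial_field l x : R := phi (rtau x) * (x - y) 0 l.

Lemma Ck1_radial_field V l : V `<=` H -> Ck 1 V (radial_field l).
Proof.
move=> VH; apply: Ck1M => //; first exact: Ck1_radial.
by under eq_fun do rewrite !mxE; apply: Ck1B => //; [exact: Ck1_coord|exact: Ck1_cst].
Qed.

Lemma has_pderiv_radial_field k l x : has_pderiv (radial_field l) k x
  (phi (rtau x) * (k == l)%:R - dphi (rtau x) * rtau x ^+ 3 * adist x 0 k * (x - y) 0 l).
Proof.
have := has_pderivM (has_pderiv_radial k x) (has_pderiv_shift y l k x).
by rewrite mulNr addrC.
Qed.

Arguments has_pderiv_radial_field : clear implicits.

Lemma div_radial_field x : H x -> \sum_k pderiv (radial_field k) k x =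
  n.+1%:R * phi (rtau x) - dphi (rtau x) * rtau x * (1 - (eps * rtau x) ^+ 2).
Proof.
move=> Hx; under eq_bigr => k _ do
  rewrite (pderivE Hx (has_pderiv_radial_field k k x)) eqxx mulr1.
rewrite sumrB sumr_const card_ord mulr_natl; congr (_ - _).
under eq_bigr do rewrite -mulrA.
rewrite -mulr_sumr -[\sum_k _]/(dot (adist x) (x - y)) -/(sqdist x) -sqr_rtauE; ring.
Qed.

End RadialFunctions.

(** * Integral identities *)

Section Fluxes.
Variables (R : realType) (n : nat).
Local Notation vec := 'rV[R]_n.+1.
Local Notation H := (@half_space R n).
Implicit Types (k l m : 'I_n.+1) (x y : vec).
Variables (V : set vec) (a : vec) (L : R).
Hypotheses (Vo : rel_open V) (L0 : 0 < L) (cV : cube a L `<=` V).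
Variables (G : vec -> 'M[R]_n.+1) (rho v : vec -> R) (lam : R).
Hypothesis GC : forall k l, Ck 1 V (fun x => G x k l).
Hypothesis Gsym : forall x, V x -> (G x)^T = G x.
Hypothesis rhoC : Ck 1 V rho.
Hypothesis vC : Ck 2 V v.

Local Notation xi x := (differential v x).
Definition conormal x : vec := differential v x *m G x.
Local Notation p := conormal.

Hypothesis vE : forall x, V x ->
  \sum_k pderiv (fun y => p y 0 k) k x = - (lam ^+ 2 * rho x * v x).

(* The faces of the cube other than its intersection with the boundary of the
   half-space. *)
Definition outer_face x : Prop := exists k, x 0 k = a 0 k + L \/
  (x 0 k = a 0 k /\ ~ (k = 0 /\ a 0 0 = 0)).

Let VH : V `<=` H := rel_open_sub Vo.

Lemma Ck1_conormal k : Ck 1 V (fun x => p x 0 k).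
Proof.
under eq_fun do rewrite mxE; apply: Ck1_sum => // l; apply: Ck1M => //.
by under eq_fun do rewrite mxE; exact: Ck_pderiv vC.
Qed.

Lemma Ck1_solution : Ck 1 V v. Proof. exact: Ck_le vC. Qed.

Lemma outer_face_or k x : cube a L x -> x 0 k = a 0 k ->
  outer_face x \/ (k = 0 /\ x 0 0 = 0).
Proof.
move=> _ xk; case: (pselect (k = 0 /\ a 0 0 = 0)) => [[k0 a0]|ka].
  by right; split=> //; move: xk; rewrite k0 a0.
by left; exists k; right.
Qed.

(** Averages the divergence of [f p]. Only the component [p 0] crosses the boundary face, which is
    where the boundary condition enters. *)
Lemma null_conormal_flux f : Ck 1 V f ->
  (forall x, cube a L x -> outer_face x -> f x = 0) ->
  (forall x, V x -> x 0 0 = 0 -> f x * p x 0 0 = 0) ->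
  null a L (fun x => - (lam ^+ 2 * rho x * v x * f x) + \sum_k pderiv f k x * p x 0 k).
Proof.
move=> fC fo fp.
have N k : null a L (pderiv (fun x => f x * p x 0 k) k).
  have C : Ck 1 V (fun x => f x * p x 0 k) by apply: Ck1M => //; exact: Ck1_conormal.
  apply: null_pderiv VH C cV _ _ => // x cx xk.
    have [/(fo _ cx)->|[-> x0]] := outer_face_or cx xk; first by rewrite mul0r.
    by apply: fp => //; exact: cV.
  by rewrite fo ?mul0r//; exists k; left.
have := null_sum (index_enum 'I_n.+1) N; apply: eq_null => // x cx.
have Vx := cV cx; have Hx := VH Vx.
transitivity (\sum_k (pderiv f k x * p x 0 k + f x * pderiv (fun y => p y 0 k) k x)).
  apply: eq_bigr => k _; apply: pderivE => //; apply: has_pderivM.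
    exact: Ck_has_pderiv fC Vx.
  exact: Ck_has_pderiv (Ck1_conormal k) Vx.
by rewrite big_split/= -mulr_sumr vE// addrC mulrN; congr (- _ + _); ring.
Qed.

Lemma null_divergence (Y : 'I_n.+1 -> vec -> R) e : (forall k, Ck 1 V (Y k)) -> Ck 1 V e ->
  (forall x k, cube a L x -> outer_face x -> Y k x = 0) ->
  (forall x, V x -> x 0 0 = 0 -> Y 0 x = 0) ->
  null a L (fun x => e x * \sum_k pderiv (Y k) k x + \sum_k Y k x * pderiv e k x).
Proof.
move=> YC eC Yo Y0.
have N k : null a L (pderiv (fun x => e x * Y k x) k).
  have C : Ck 1 V (fun x => e x * Y k x) by exact: Ck1M.
  apply: null_pderiv VH C cV _ _ => // x cx xk.
    have [/(Yo _ k cx)->|[-> x0]] := outer_face_or cx xk; first by rewrite mulr0.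
    by rewrite Y0 ?mulr0//; exact: cV.
  by rewrite Yo ?mulr0//; exists k; left.
have := null_sum (index_enum 'I_n.+1) N; apply: eq_null => // x cx.
have Vx := cV cx; have Hx := VH Vx.
rewrite mulr_sumr -big_split/=; apply: eq_bigr => k _; apply: pderivE => //.
rewrite addrC [Y k x * _]mulrC; apply: has_pderivM; first exact: Ck_has_pderiv eC Vx.
exact: Ck_has_pderiv (YC k) Vx.
Qed.

(** The Lagrangian density of the equation, of indefinite sign. It multiplies the divergence of the
    field in Rellich's identity, and [null_multiplier] makes its weighted averages lower order. *)
Definition energy x : R := lam ^+ 2 * rho x * v x ^+ 2 - dot (p x) (xi x).

Lemma Ck1_energy : Ck 1 V energy.
Proof.
apply: Ck1B => //.
  by apply: Ck1M => //; [exact: Ck1Z|apply: Ck1_exp => //; exact: Ck1_solution].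
apply: Ck1_sum => // k; apply: Ck1M => //; first exact: Ck1_conormal.
by under eq_fun do rewrite mxE; exact: Ck_pderiv vC.
Qed.

Lemma pderiv_energy k x : V x -> pderiv energy k x =
  lam ^+ 2 * (pderiv rho k x * v x ^+ 2 + 2 * rho x * v x * pderiv v k x)
  - \sum_m \sum_l pderiv (fun y => G y m l) k x * pderiv v l x * pderiv v m x
  - 2 * \sum_m p x 0 m * pderiv (pderiv v m) k x.
Proof.
move=> Vx; apply: pderivE; first exact: VH.
have hv := Ck_has_pderiv (k := k) Ck1_solution Vx.
have hr := Ck_has_pderiv (k := k) rhoC Vx.
have hx m : has_pderiv (fun y => xi y 0 m) k x (pderiv (pderiv v m) k x).
  have := Ck_has_pderiv (k := k) (Ck_pderiv m vC) Vx; congr has_pderiv.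
  by apply/funext => y; rewrite mxE.
have hp m : has_pderiv (fun y => p y 0 m) k x (\sum_l (pderiv (pderiv v l) k x * G x l m
    + xi x 0 l * pderiv (fun y => G y l m) k x)).
  under eq_fun do rewrite mxE; apply: has_pderiv_sum => l; apply: has_pderivM => //.
  exact: Ck_has_pderiv (GC l m) Vx.
have h1 := has_pderivM (has_pderivZ (c := lam ^+ 2) hr) (has_pderivM hv hv).
have h2 := has_pderiv_sum (r := index_enum 'I_n.+1) (fun m => has_pderivM (hp m) (hx m)).
have := has_pderivB h1 h2; congr has_pderiv.
pose D m := pderiv (pderiv v m) k x.
have S1 : \sum_m (\sum_l D l * G x l m) * xi x 0 m = \sum_m p x 0 m * D m.
  under eq_bigr do rewrite mulr_suml; rewrite exchange_big/=; apply: eq_bigr => l _.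
  rewrite mxE mulr_suml; apply: eq_bigr => m _.
  have -> : G x m l = G x l m by rewrite -[in LHS](Gsym Vx) mxE.
  ring.
have S2 : \sum_m (\sum_l xi x 0 l * pderiv (fun y => G y l m) k x) * xi x 0 m =
    \sum_m \sum_l pderiv (fun y => G y m l) k x * pderiv v l x * pderiv v m x.
  under eq_bigr do rewrite mulr_suml; rewrite exchange_big/=; apply: eq_bigr => l _.
  by apply: eq_bigr => m _; rewrite !mxE; ring.
under eq_bigr do rewrite big_split mulrDl/=.
rewrite !big_split/= S1 S2 -/(D _); ring.
Qed.

Hypothesis bc : (forall x, V x -> x 0 0 = 0 -> v x = 0) \/
  (forall x, V x -> x 0 0 = 0 -> p x 0 0 = 0).

(** The boundary term of Rellich's identity. Under Dirichlet conditions the tangential derivatives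
    of [v] vanish, and a tangent field sees no others; under Neumann conditions the conormal
    component vanishes. *)
Lemma tangential_derivative (Y : 'I_n.+1 -> vec -> R) x : V x -> x 0 0 = 0 -> Y 0 x = 0 ->
  (2 * \sum_l Y l x * pderiv v l x) * p x 0 0 = 0.
Proof.
move=> Vx x0 Y0; have [v0|p0] := bc; last by rewrite p0 ?mulr0.
rewrite big1 ?mulr0 ?mul0r// => l _; have [->|l0] := eqVneq l 0; first by rewrite Y0 mul0r.
have [d d0 dP] := rel_openP Vo Vx.
suff -> : pderiv v l x = 0 by rewrite mulr0.
apply: pderivE; first exact: VH.
apply: (@has_pderiv_near _ _ (fun=> 0) _ _ _ _ d) => //.
- by rewrite v0.
- move=> h hd Hh; rewrite v0//.
    by apply: dP => //; rewrite addrC addKr (le_lt_trans (norm_scale_delta _ _)).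
  by rewrite !mxE x0 eqxx /= eq_sym (negbTE l0) mulr0 addr0.
- exact: has_pderiv_cst.
Qed.

(** The equation tested with [2 Y . dv], plus the divergence of [energy * Y]. Both contain the
    Hessian of [v] along [Y], with opposite signs, so only first derivatives of [v] survive. *)
Lemma null_rellich (Y : 'I_n.+1 -> vec -> R) : (forall k, Ck 1 V (Y k)) ->
  (forall x k, cube a L x -> outer_face x -> Y k x = 0) ->
  (forall x, V x -> x 0 0 = 0 -> Y 0 x = 0) ->
  null a L (fun x => 2 * \sum_k \sum_l pderiv (Y l) k x * pderiv v l x * p x 0 k
    + energy x * \sum_k pderiv (Y k) k x
    + lam ^+ 2 * v x ^+ 2 * \sum_k Y k x * pderiv rho k x
    - \sum_k Y k x *
        \sum_m \sum_l pderiv (fun y => G y m l) k x * pderiv v l x * pderiv v m x).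
Proof.
move=> YC Yo Y0; pose f x := 2 * \sum_l Y l x * pderiv v l x.
have fC : Ck 1 V f.
  by apply: Ck1Z => //; apply: Ck1_sum => // l; apply: Ck1M => //; exact: Ck_pderiv vC.
have N1 : null a L (fun x => - (lam ^+ 2 * rho x * v x * f x) + \sum_k pderiv f k x * p x 0 k).
  apply: null_conormal_flux => // x.
    by move=> cx fx; rewrite /f big1 ?mulr0// => l _; rewrite Yo ?mul0r.
  by move=> Vx x0; apply: tangential_derivative => //; exact: Y0.
have N2 := null_divergence YC Ck1_energy Yo Y0.
apply: eq_null (nullD N1 N2) => // x cx; have Vx := cV cx; have Hx := VH Vx.
have df k : pderiv f k x = 2 * \sum_l (pderiv (Y l) k x * pderiv v l x
    + Y l x * pderiv (pderiv v l) k x).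
  apply: pderivE => //; apply: has_pderivZ; apply: has_pderiv_sum => l; apply: has_pderivM.
    exact: Ck_has_pderiv (YC l) Vx.
  exact: Ck_has_pderiv (Ck_pderiv l vC) Vx.
pose Q k := \sum_m \sum_l pderiv (fun y => G y m l) k x * pderiv v l x * pderiv v m x.
pose D l k := pderiv (pderiv v l) k x.
(* Symmetry of the Hessian of [v] is what makes the second order terms of [E1] and [E2] cancel. *)
have Dsym l k : D l k = D k l by exact: pderiv_comm vC Vx.
have E1 : \sum_k pderiv f k x * p x 0 k =
    2 * \sum_k \sum_l pderiv (Y l) k x * pderiv v l x * p x 0 k
    + 2 * \sum_k \sum_l Y l x * D l k * p x 0 k.
  rewrite !mulr_sumr -big_split; apply: eq_bigr => k _ /=.
  rewrite df -mulrA mulr_suml -mulrDr -big_split/=; congr (_ * _).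
  by apply: eq_bigr => l _; rewrite /D; ring.
have E2 : \sum_k Y k x * pderiv energy k x =
    lam ^+ 2 * v x ^+ 2 * (\sum_k Y k x * pderiv rho k x)
    + lam ^+ 2 * rho x * v x * f x - (\sum_k Y k x * Q k)
    - 2 * \sum_k \sum_l Y l x * D l k * p x 0 k.
  have -> : \sum_k \sum_l Y l x * D l k * p x 0 k = \sum_k Y k x * \sum_m p x 0 m * D m k.
    rewrite exchange_big/=; apply: eq_bigr => l _; rewrite mulr_sumr.
    by apply: eq_bigr => k _; rewrite Dsym; ring.
  rewrite /f !mulr_sumr -!sumrN -!big_split/=; apply: eq_bigr => k _.
  by rewrite pderiv_energy// -/(Q k) -/(D _ _); under [in RHS]eq_bigr do rewrite -/(D _ _); rewrite /D; ring.
rewrite E1 E2; ring.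
Qed.

(** The test function is [w v]: either boundary condition annihilates [v p 0], so [w] is
    unconstrained on the boundary face. *)
Lemma null_multiplier w : Ck 1 V w -> (forall x, cube a L x -> outer_face x -> w x = 0) ->
  null a L (fun x => - (w x * energy x) + v x * \sum_k pderiv w k x * p x 0 k).
Proof.
move=> wC wo; pose f x := w x * v x.
have fC : Ck 1 V f by apply: Ck1M => //; exact: Ck1_solution.
have N : null a L (fun x => - (lam ^+ 2 * rho x * v x * f x) + \sum_k pderiv f k x * p x 0 k).
  apply: null_conormal_flux => // x; first by move=> cx fx; rewrite /f wo ?mul0r.
  move=> Vx x0; have [v0|p0] := bc; last by rewrite p0 ?mulr0.
  by rewrite /f v0// mulr0 mul0r.
apply: eq_null N => // x cx; have Vx := cV cx; have Hx := VH Vx.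
have df k : pderiv f k x = pderiv w k x * v x + w x * pderiv v k x.
  apply: pderivE => //; apply: has_pderivM; first exact: Ck_has_pderiv wC Vx.
  exact: Ck_has_pderiv Ck1_solution Vx.
have -> : \sum_k pderiv f k x * p x 0 k =
    v x * (\sum_k pderiv w k x * p x 0 k) + w x * dot (p x) (xi x).
  rewrite !mulr_sumr -big_split/=; apply: eq_bigr => k _; rewrite df !mxE; ring.
rewrite /energy /f; ring.
Qed.

End Fluxes.

(** * Morawetz estimate *)

Section Centers.
Variables (R : realType) (n : nat).
Local Notation vec := 'rV[R]_n.+1.
Local Notation H := (@half_space R n).
Implicit Types (k l m : 'I_n.+1) (x y z w : vec).
Variables (V : set vec) (a : vec) (L : R).
Hypotheses (Vo : rel_open V) (cV : cube a L `<=` V).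
Variables (G : vec -> 'M[R]_n.+1) (M : R).
Hypothesis GC : forall k l, Ck 1 V (fun x => G x k l).
Hypothesis Gsym : forall x, V x -> (G x)^T = G x.
Hypotheses (M1 : 1 <= M) (dM : n.+1%:R <= M).
Hypothesis Gbd : forall x k l, cube a L x -> `|G x k l| <= M.
Hypothesis dGbd : forall x m k l, cube a L x -> `|pderiv (fun y => G y k l) m x| <= M.
Hypothesis Gell : forall x w, cube a L x -> dot w w <= M * dot (w *m G x) w.
Variables (x0 : vec) (eps : R).
Hypotheses (cx0 : cube a L x0) (eps0 : 0 < eps).

Definition Bmx := G x0.
Definition Amx := invmx (G x0).
Local Notation B := Bmx.
Local Notation A := Amx.

(* The reflection of the centre across the boundary hyperplane, orthogonal for
   the scalar product given by A. *)
Definition mirror : vec := x0 - (2 * x0 0 0 / B 0 0) *: row 0 B.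

Let M0 : 0 < M. Proof. exact: lt_le_trans M1. Qed.

Lemma Bsym : B^T = B. Proof. exact/Gsym/cV. Qed.

Lemma Bell w : M^-1 * dot w w <= dot (w *m B) w.
Proof. by rewrite mulrC ler_pdivrMr// mulrC; exact: Gell. Qed.

Lemma Bbd k l : `|B k l| <= M. Proof. exact: Gbd. Qed.

Let iM0 : 0 < M^-1. Proof. by rewrite invr_gt0. Qed.

Lemma Asym : A^T = A. Proof. exact: form_inv_sym Bsym. Qed.

Lemma A_ge0 z : 0 <= dot (z *m A) z.
Proof. exact: (inv_form_ge0 iM0 Bell). Qed.

Lemma mulmx_BA z : z *m B *m A = z.
Proof. exact: (form_mulKV iM0 Bell). Qed.

Lemma B00_gt0 : 0 < B 0 0.
Proof.
have := Gell (delta_mx 0 0) cx0; rewrite -rowE dotE trmx_delta -rowE !mxE eqxx /=.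
rewrite dotE trmx_delta -colE !mxE -/B.
by move=> /(lt_le_trans ltr01); rewrite pmulr_rgt0.
Qed.

Lemma x00_ge0 : 0 <= x0 0 0.
Proof. by have := rel_open_sub Vo (cV cx0). Qed.

Lemma coord_bound y x k : (rtau A eps y x * `|(x - y) 0 k|) <= M.
Proof.
have t0 := rtau_gt0 eps0 A_ge0 y x; set t := rtau _ _ _ _ in t0 *.
rewrite -(@ler_pXn2r _ 2)// ?nnegrE ?mulr_ge0 ?(ltW t0) ?(ltW M0)// exprMn.
rewrite (@le_trans _ _ (t ^+ 2 * (n.+1%:R * M * sqdist A y x)))//.
  rewrite ler_wpM2l ?sqr_ge0// real_normK ?num_real//.
  rewrite (le_trans (sqr_coord_le_dot _ _))//.
  exact: (dot_le_inv_form Bsym iM0 Bell Bbd).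
rewrite mulrCA -[leRHS]mulr1; apply: ler_pM.
- by rewrite mulr_ge0// ltW.
- by rewrite mulr_ge0 ?sqr_ge0 ?A_ge0.
- by rewrite expr2 ler_wpM2r// ltW.
- exact: (sqr_rtau_le1 eps0 A_ge0).
Qed.

Lemma adist_bound y x k : (rtau A eps y x * `|adist A y x 0 k|) <= M.
Proof.
have t0 := rtau_gt0 eps0 A_ge0 y x; set t := rtau _ _ _ _ in t0 *.
rewrite -(@ler_pXn2r _ 2)// ?nnegrE ?mulr_ge0 ?(ltW t0) ?(ltW M0)// exprMn.
rewrite (@le_trans _ _ (t ^+ 2 * (M * sqdist A y x)))//.
  rewrite ler_wpM2l ?sqr_ge0// real_normK ?num_real//.
  rewrite (le_trans (sqr_coord_le_dot _ _))//.
  have := inv_form_ge iM0 Bell (x - y); rewrite -/A.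
  by rewrite mulrC ler_pdivrMr// mulrC.
rewrite mulrCA [leRHS]expr2; apply: ler_pM; rewrite ?(ltW M0)//.
  by rewrite mulr_ge0 ?sqr_ge0 ?A_ge0.
by rewrite (le_trans _ M1)//; exact: (sqr_rtau_le1 eps0 A_ge0).
Qed.

(** [A] turns [row 0 B] into the coordinate vector of index 0, so the cross terms only see
    coordinates of index 0. The extra term is nonnegative on the half-space and zero on its
    boundary: the mirror image is the farther centre, at equal distance from boundary points. *)
Lemma sqdist_mirror x : sqdist A mirror x =
  sqdist A x0 x + 4 * x0 0 0 * x 0 0 / B 0 0.
Proof.
have B0 := B00_gt0; set c := 2 * x0 0 0 / B 0 0.
have zE : x - mirror = (x - x0) + c *: row 0 B by rewrite /mirror opprB addrCA addrC.
have rA : row 0 B *m A = delta_mx 0 0.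
  by rewrite rowE -mulmxA; have := mulmx_BA (delta_mx 0 0); rewrite -mulmxA.
rewrite /sqdist zE mulmxDl -scalemxAl rA dotDl !dotDr !dotZl !dotZr.
have d0 (z : vec) : dot (delta_mx 0 0) z = z 0 0.
  rewrite /dot (bigD1 0)//= big1 => [|j j0]; first by rewrite mxE !eqxx mul1r addr0.
  by rewrite mxE eqxx (negbTE j0) mul0r.
rewrite [dot (_ *m A) (row 0 B)]dot_mulmx Asym rA (dotC _ (delta_mx 0 0)) !d0 !mxE /c.
by field; rewrite gt_eqF.
Qed.

Lemma rtau_mirror_le x : H x -> rtau A eps mirror x <= rtau A eps x0 x.
Proof.
move=> Hx; have q0 y : 0 < sqdist A y x + eps ^+ 2.
  by rewrite ltr_wpDl// ?A_ge0 ?exprn_gt0.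
rewrite /rtau lef_pV2 ?posrE ?sqrtr_gt0// ler_wsqrtr// lerD2r sqdist_mirror lerDl.
by rewrite !mulr_ge0 ?x00_ge0 ?invr_ge0 ?(ltW B00_gt0).
Qed.

Lemma rtau_mirror_bdry x : x 0 0 = 0 -> rtau A eps mirror x = rtau A eps x0 x.
Proof. by move=> xb; rewrite /rtau sqdist_mirror xb mulr0 mul0r addr0. Qed.

Lemma mirror_bdry x : x 0 0 = 0 -> (x - mirror) 0 0 = - (x - x0) 0 0.
Proof.
move=> xb; rewrite /mirror !mxE xb; have B0 := B00_gt0; field.
by rewrite gt_eqF.
Qed.

Definition mirror_field (phi : R -> R) k x : R :=
  radial_field A eps x0 phi k x + radial_field A eps mirror phi k x.

(** On the boundary both radial factors agree, and the normal components of the two position vectors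
    are opposite. *)
Lemma mirror_field_tangent phi x : x 0 0 = 0 -> mirror_field phi 0 x = 0.
Proof.
move=> xb; rewrite /mirror_field /radial_field rtau_mirror_bdry// mirror_bdry//.
by rewrite mulrN subrr.
Qed.

(** Freezing the coefficients at [x0] costs the distance to [x0], which one factor [rtau]
    compensates. *)
Lemma G_lipschitz x k l : cube a L x ->
  `|G x k l - B k l| * rtau A eps x0 x <= M ^+ 3.
Proof.
move=> cx; have VH := rel_open_sub Vo.
have t0 := rtau_gt0 eps0 A_ge0 x0 x; set t := rtau _ _ _ _ in t0 *.
have bG : `|G x k l - B k l - \sum_j 0 * (x 0 j - x0 0 j)| <= M * \sum_j `|x 0 j - x0 0 j|.
  apply: (box_mvt VH (GC k l)) => z zP.
  have cz : cube a L z.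
    move=> j; have := cx j; have := cx0 j; have := zP j.
    by case: (leP (x0 0 j) (x 0 j)) => _ /andP[h1 h2] /andP[h3 h4] /andP[h5 h6];
       apply/andP; split; lra.
  by split=> [|m]; [exact: cV|rewrite subr0; exact: dGbd].
move: bG; rewrite big1 => [|j _]; last by rewrite mul0r.
rewrite subr0 -(ler_pM2r t0) => /le_trans; apply.
rewrite -mulrA exprS ler_wpM2l ?(ltW M0)// mulr_suml.
rewrite (@le_trans _ _ (\sum_(j < n.+1) M))//.
  by apply: ler_sum => j _; rewrite mulrC; have := coord_bound x0 x j; rewrite !mxE.
by rewrite sumr_const card_ord -mulr_natl expr2 ler_wpM2r// ltW.
Qed.

End Centers.

(** The bookkeeping of [mor_main_ge] in plain variables: the [g]s are the eight terms of [mor_main];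
    the [m]s are powers of [M] times [q] or [z], or the absorbable quantities with a factor [c]. *)
Lemma mor_arith (F : realFieldType) (g1 g2 g3 g4 g5 g6 g7 g8 m0 m1 m2 m3 m4 m5 m6 m7 mcq q z : F) :
  0 <= q -> 0 <= z -> - (2 * m0) <= g1 -> 2 * mcq - 4 * m2 <= g2 -> - (2 * (m0 + m3)) <= g3 ->
  2 * m7 - 2 * mcq <= g4 -> - (2 * m4) <= g5 -> g6 <= 2 * m1 -> - ((q + z) / 2) <= g7 ->
  - (m6 + m7) <= g8 -> m6 <= mcq -> m0 <= m2 -> m1 <= m2 -> q <= m2 ->
  m3 <= m5 -> m4 <= m5 -> z <= m5 ->
  m6 + m7 - 21 * (m2 + m5) <= 2 * (g1 + g2) + (g3 + g4) + (g5 - g6) + (g7 + g8).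
Proof. lra. Qed.

(** * Rellich's identity for the regularised distance *)

Section Morawetz.
Variables (R : realType) (n : nat).
Local Notation vec := 'rV[R]_n.+1.
Local Notation H := (@half_space R n).
Implicit Types (k l m : 'I_n.+1) (x y z w : vec).

(** One constant [M] bounds the coefficients, their derivatives, the ellipticity and the dimension:
    a sum over indices costs a factor [M], and error terms are compared through their exponents. *)
Record elliptic (V : set vec) (a : vec) (L : R) (G : vec -> 'M[R]_n.+1) (rho : vec -> R)
    (M : R) : Prop := Elliptic {
  el_open : rel_open V;
  el_side : 0 < L;
  el_cube : cube a L `<=` V;
  el_GC : forall k l, Ck 1 V (fun x => G x k l);
  el_sym : forall x, V x -> (G x)^T = G x;
  el_rhoC : Ck 1 V rho;
  el_M1 : 1 <= M;
  el_dim : n.+1%:R <= M;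
  el_G : forall x k l, cube a L x -> `|G x k l| <= M;
  el_dG : forall x m k l, cube a L x -> `|pderiv (fun y => G y k l) m x| <= M;
  el_ell : forall x w, cube a L x -> dot w w <= M * dot (w *m G x) w;
  el_rho_ge : forall x, cube a L x -> 1 <= M * rho x;
  el_rho_le : forall x, cube a L x -> rho x <= M;
  el_drho : forall x k, cube a L x -> `|pderiv rho k x| <= M }.

Record solution (V : set vec) (G : vec -> 'M[R]_n.+1) (rho : vec -> R) (lam : R)
    (v : vec -> R) : Prop := Solution {
  sol_C : Ck 2 V v;
  sol_eq : forall x, V x -> \sum_k pderiv (fun y => conormal G v y 0 k) k x
    = - (lam ^+ 2 * rho x * v x);
  sol_bc : (forall x, V x -> x 0 0 = 0 -> v x = 0) \/
    (forall x, V x -> x 0 0 = 0 -> conormal G v x 0 0 = 0) }.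

Variables (V : set vec) (a : vec) (L : R) (G : vec -> 'M[R]_n.+1) (rho : vec -> R) (M : R).
Hypothesis E : elliptic V a L G rho M.
Variables (lam : R) (v : vec -> R).
Hypothesis lam1 : 1 <= lam.
Hypothesis S : solution V G rho lam v.

Local Notation p := (conormal G v).
Local Notation xi := (differential v).

Lemma M_gt0 : 0 < M. Proof. exact: lt_le_trans (el_M1 E). Qed.
Lemma M_ge0 : 0 <= M. Proof. exact: ltW M_gt0. Qed.

Lemma M_exp_le (i j : nat) : (i <= j)%N -> M ^+ i <= M ^+ j.
Proof. by move=> ij; rewrite ler_weXn2l ?(el_M1 E). Qed.

Lemma M_exp_ge0 (i : nat) : 0 <= M ^+ i. Proof. by rewrite exprn_ge0 ?M_ge0. Qed.

Lemma norm_sum_le (F : 'I_n.+1 -> R) c : (forall k, `|F k| <= c) -> `|\sum_k F k| <= M * c.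
Proof.
move=> Fc; have c0 : 0 <= c by exact: le_trans (Fc 0).
rewrite (le_trans (ler_norm_sum _ _ _))// (@le_trans _ _ (\sum_(k < n.+1) c))//.
  exact: ler_sum.
by rewrite sumr_const card_ord -mulr_natl ler_wpM2r// (el_dim E).
Qed.

Lemma norm_dot_le z w c c' : (forall k, `|z 0 k| <= c) -> (forall k, `|w 0 k| <= c') ->
  `|dot z w| <= M * (c * c').
Proof.
move=> zc wc; apply: norm_sum_le => k; rewrite normrM.
by apply: ler_pM.
Qed.

Definition grad_norm x : R := Num.sqrt (dot (xi x) (xi x)).
Local Notation r := grad_norm.

Lemma grad_norm_ge0 x : 0 <= r x. Proof. exact: sqrtr_ge0. Qed.

Lemma sqr_grad_norm x : r x ^+ 2 = dot (xi x) (xi x).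
Proof. by rewrite sqr_sqrtr// dot_ge0. Qed.

Lemma xi_le x k : `|xi x 0 k| <= r x. Proof. exact: coord_le_sqrt_dot. Qed.

Lemma conormal_le x k : cube a L x -> `|p x 0 k| <= M ^+ 2 * r x.
Proof.
move=> cx; rewrite mxE expr2 -mulrA; apply: norm_sum_le => l.
by rewrite normrM mulrC; apply: ler_pM => //; [exact: el_G E _ _ _ cx|exact: xi_le].
Qed.

Lemma conormal_xi_ge x : cube a L x -> r x ^+ 2 <= M * dot (p x) (xi x).
Proof. by move=> cx; rewrite sqr_grad_norm; exact: el_ell E _ _ cx. Qed.

Lemma conormal_xi_le x : cube a L x -> `|dot (p x) (xi x)| <= M ^+ 3 * r x ^+ 2.
Proof.
move=> cx; rewrite (le_trans (norm_dot_le (fun k => conormal_le k cx) (xi_le x)))//.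
by rewrite le_eqVlt; apply/orP; left; apply/eqP; ring.
Qed.

Lemma energy_ge x : cube a L x ->
  lam ^+ 2 * v x ^+ 2 - M ^+ 4 * r x ^+ 2 <= M * energy G rho v lam x.
Proof.
move=> cx; rewrite /energy mulrBr lerB//.
  have := el_rho_ge E cx; have := mulr_ge0 (sqr_ge0 lam) (sqr_ge0 (v x)).
  by set e := lam ^+ 2 * v x ^+ 2 => e0 h; have := ler_wpM2l e0 h; rewrite /e; lra.
rewrite exprS -mulrA ler_wpM2l ?M_ge0//.
exact: le_trans (ler_norm _) (conormal_xi_le cx).
Qed.

Lemma energy_norm_le x : cube a L x ->
  `|energy G rho v lam x| <= M ^+ 3 * (r x ^+ 2 + lam ^+ 2 * v x ^+ 2).
Proof.
move=> cx; rewrite (le_trans (ler_normB _ _))// mulrDr addrC lerD//.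
  exact: conormal_xi_le.
have rho0 : 0 <= rho x.
  by have := lt_le_trans ltr01 (el_rho_ge E cx); rewrite pmulr_rgt0 ?M_gt0// => /ltW.
have e0 : 0 <= lam ^+ 2 * v x ^+ 2 by rewrite mulr_ge0 ?sqr_ge0.
have -> : lam ^+ 2 * rho x * v x ^+ 2 = rho x * (lam ^+ 2 * v x ^+ 2) by ring.
rewrite normrM !ger0_norm// ler_wpM2r//.
by rewrite (le_trans (el_rho_le E cx))// -[leLHS]expr1 M_exp_le.
Qed.

Lemma lam_mixed x : lam * `|v x| * r x <= (r x ^+ 2 + lam ^+ 2 * v x ^+ 2) / 2.
Proof.
have := sqr_ge0 (lam * `|v x| - r x); rewrite -(real_normK (num_real (v x))).
by lra.
Qed.

Variable x0 : vec.
Hypothesis cx0 : cube a L x0.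
Variable eps : R.
Hypothesis eps0 : 0 < eps.

Local Notation A := (Amx G x0).
Local Notation B := (Bmx G x0).

Lemma Asym' : A^T = A. Proof. exact: (Asym (el_cube E) (el_sym E) cx0). Qed.
Lemma A_ge0' z : 0 <= dot (z *m A) z.
Proof. exact: (A_ge0 (el_M1 E) (el_ell E) cx0). Qed.

Section center.
Variables (y x : vec).
Hypothesis cx : cube a L x.
Let t := rtau A eps y x.
Hypothesis tle : t <= rtau A eps x0 x.

Lemma center_t0 : 0 < t. Proof. exact: rtau_gt0 eps0 A_ge0' _ _. Qed.
Lemma center_et : eps * t <= 1. Proof. exact: eps_rtau_le1 eps0 A_ge0' _ _. Qed.

Lemma center_coord k : t * `|(x - y) 0 k| <= M.
Proof.
exact: (coord_bound (el_cube E) (el_sym E) (el_M1 E) (el_dim E) (el_G E) (el_ell E) cx0 eps0).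
Qed.

Lemma center_adist k : t * `|adist A y x 0 k| <= M.
Proof.
exact: (adist_bound (el_M1 E) (el_ell E) cx0 eps0).
Qed.

(** The Lipschitz bound refers to the distance to [x0]. The hypothesis [tle] transfers it to the
    centre [y]; the mirror image satisfies it because it is the farther centre. *)
Lemma center_delta k : t * `|(xi x *m (G x - B)) 0 k| <= M ^+ 4 * r x.
Proof.
have t0 := center_t0; rewrite -{1}(gtr0_norm t0) -normrM mxE mulr_sumr exprS -mulrA.
apply: norm_sum_le => l; rewrite !mxE mulrCA !normrM (gtr0_norm t0) mulrC.
apply: ler_pM; rewrite ?mulr_ge0 ?(ltW t0)//; last by have := xi_le x l; rewrite mxE.
have h := G_lipschitz (el_open E) (el_cube E) (el_GC E) (el_sym E) (el_M1 E) (el_dim E)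
  (el_G E) (el_dG E) (el_ell E) cx0 eps0 l k cx.
by rewrite (le_trans _ h)// mulrC ler_wpM2l.
Qed.

Lemma center_adist_conormal : dot (adist A y x) (xi x *m B) = dot (x - y) (xi x).
Proof.
rewrite /adist dot_mulmx Asym'.
by rewrite (mulmx_BA (el_M1 E) (el_ell E) cx0).
Qed.

Lemma conormal_split : p x = xi x *m B + xi x *m (G x - B).
Proof. by rewrite -mulmxDr addrC subrK. Qed.

(* The Hessian of the regularised distance to [y], evaluated on the conormal
   derivative and the differential. *)
Lemma center_hessian :
  eps * t ^+ 2 / (2 * M) * r x ^+ 2 - 2 * M ^+ 9 * r x ^+ 2 <=
  (t - eps / 2 * t ^+ 2) * dot (p x) (xi x)
  - (1 - eps * t) * t ^+ 3 * (dot (adist A y x) (p x) * dot (x - y) (xi x)).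
Proof.
have t0 := center_t0; have e1 := center_et; have M0 := M_gt0.
have e0 : 0 <= eps * t by rewrite mulr_ge0 ?ltW.
set del := xi x *m (G x - B); set f := dot (xi x *m B) (xi x).
have fge : r x ^+ 2 <= M * f by rewrite sqr_grad_norm; exact: el_ell E _ _ cx0.
have f0 : 0 <= f by rewrite -(pmulr_rge0 _ M0) (le_trans _ fge)// sqr_ge0.
set c := dot (x - y) (xi x).
have cauchy : c ^+ 2 <= sqdist A y x * f.
  have iM0 : 0 < M^-1 by rewrite invr_gt0.
  exact: (form_cauchy (Bsym (el_cube E) (el_sym E) cx0) iM0 (Bell (el_M1 E) (el_ell E) cx0)).
have ts : t ^+ 2 * sqdist A y x = 1 - (eps * t) ^+ 2 by exact: sqr_rtauE eps0 A_ge0' _ _.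
have dp : dot (p x) (xi x) = f + dot del (xi x) by rewrite conormal_split dotDl.
have da : dot (adist A y x) (p x) = c + dot (adist A y x) del.
  by rewrite conormal_split dotDr center_adist_conormal.
have d1 : `|t * dot del (xi x)| <= M ^+ 5 * r x ^+ 2.
  rewrite -dotZl (le_trans (norm_dot_le (c := M ^+ 4 * r x) (c' := r x) _ _))//.
  - by move=> k; rewrite mxE normrM gtr0_norm//; exact: center_delta.
  - exact: xi_le.
  - by rewrite le_eqVlt; apply/orP; left; apply/eqP; ring.
have d2 : `|t ^+ 3 * (dot (adist A y x) del * c)| <= M ^+ 8 * r x ^+ 2.
  have -> : t ^+ 3 * (dot (adist A y x) del * c) =
      dot (t *: adist A y x) (t *: del) * dot (t *: (x - y)) (xi x).
    by rewrite !dotZl !dotZr /c; ring.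
  have b1 : `|dot (t *: adist A y x) (t *: del)| <= M * (M * (M ^+ 4 * r x)).
    apply: norm_dot_le => k; rewrite mxE normrM gtr0_norm//; first exact: center_adist.
    exact: center_delta.
  have b2 : `|dot (t *: (x - y)) (xi x)| <= M * (M * r x).
    apply: norm_dot_le => k; last exact: xi_le.
    by rewrite mxE normrM gtr0_norm//; exact: center_coord.
  rewrite normrM (le_trans (ler_pM _ _ b1 b2))//.
  by rewrite le_eqVlt; apply/orP; left; apply/eqP; ring.
(* Since [t^2 * sqdist = 1 - (eps t)^2], Cauchy-Schwarz leaves the coefficient
   [phi - t phi' (1 - (eps t)^2)], which for [phi = t - eps/2 t^2] equals
   [eps/2 t^2 + t (eps t)^2 (1 - eps t)]. *)
have main : eps * t ^+ 2 / 2 * f <= (t - eps / 2 * t ^+ 2) * f - (1 - eps * t) * t ^+ 3 * c ^+ 2.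
  have h : (1 - eps * t) * t ^+ 3 * c ^+ 2 <= (1 - eps * t) * t * (1 - (eps * t) ^+ 2) * f.
    rewrite -ts; have -> : (1 - eps * t) * t * (t ^+ 2 * sqdist A y x) * f =
      (1 - eps * t) * t ^+ 3 * (sqdist A y x * f) by ring.
    by rewrite ler_wpM2l// mulr_ge0 ?exprn_ge0 ?subr_ge0 ?(ltW t0).
  have pos : 0 <= t * ((eps * t) ^+ 2 * (1 - eps * t)) * f.
    by rewrite mulr_ge0// mulr_ge0 ?(ltW t0)// mulr_ge0 ?sqr_ge0 ?subr_ge0.
  lra.
have g0 : 0 <= 1 - eps * t by rewrite subr_ge0.
have T1 : - (M ^+ 5 * r x ^+ 2) <= (t - eps / 2 * t ^+ 2) * dot del (xi x).
  have -> : (t - eps / 2 * t ^+ 2) * dot del (xi x) = (1 - eps * t / 2) * (t * dot del (xi x)).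
    by ring.
  have k0 : 0 <= 1 - eps * t / 2 by lra.
  have k1 : 1 - eps * t / 2 <= 1 by lra.
  rewrite lerNl -mulrN (le_trans (ler_wpM2l k0 (_ : _ <= M ^+ 5 * r x ^+ 2)))//.
    by rewrite lerNl; move: d1; rewrite ler_norml => /andP[].
  by rewrite ler_piMl// mulr_ge0 ?sqr_ge0 ?M_exp_ge0.
have T2 : - (M ^+ 8 * r x ^+ 2) <= - ((1 - eps * t) * (t ^+ 3 * (dot (adist A y x) del * c))).
  rewrite lerN2 (le_trans (ler_wpM2l g0 (le_trans (ler_norm _) d2)))//.
  by rewrite ler_piMl ?lerBlDr ?lerDl// mulr_ge0 ?sqr_ge0 ?M_exp_ge0.
have f1 : eps * t ^+ 2 / (2 * M) * r x ^+ 2 <= eps * t ^+ 2 / 2 * f.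
  have -> : eps * t ^+ 2 / (2 * M) * r x ^+ 2 = eps * t ^+ 2 / 2 * (r x ^+ 2 / M).
    by field; rewrite gt_eqF.
  apply: ler_wpM2l; first by rewrite mulr_ge0 ?invr_ge0// mulr_ge0 ?sqr_ge0// ltW.
  by rewrite ler_pdivrMr// mulrC.
have M59 : M ^+ 5 * r x ^+ 2 <= M ^+ 9 * r x ^+ 2 by rewrite ler_wpM2r ?sqr_ge0 ?M_exp_le.
have M89 : M ^+ 8 * r x ^+ 2 <= M ^+ 9 * r x ^+ 2 by rewrite ler_wpM2r ?sqr_ge0 ?M_exp_le.
rewrite dp da; move: main T1 T2 f1 M59 M89.
have -> : (t - eps / 2 * t ^+ 2) * (f + dot del (xi x)) -
  (1 - eps * t) * t ^+ 3 * ((c + dot (adist A y x) del) * c) =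
  ((t - eps / 2 * t ^+ 2) * f - (1 - eps * t) * t ^+ 3 * c ^+ 2)
  + (t - eps / 2 * t ^+ 2) * dot del (xi x)
  - ((1 - eps * t) * (t ^+ 3 * (dot (adist A y x) del * c))) by ring.
lra.
Qed.

End center.

Lemma el_half_space x : cube a L x -> H x.
Proof. by move=> /(el_cube E); exact: rel_open_sub (el_open E) _. Qed.

Definition near_tau x := rtau A eps x0 x.
Definition far_tau x := rtau A eps (mirror G x0) x.

Lemma near_tau_gt0 x : 0 < near_tau x. Proof. exact: rtau_gt0 eps0 A_ge0' _ _. Qed.
Lemma far_tau_gt0 x : 0 < far_tau x. Proof. exact: rtau_gt0 eps0 A_ge0' _ _. Qed.

Lemma far_tau_le x : H x -> far_tau x <= near_tau x.
Proof.
exact: (rtau_mirror_le (el_open E) (el_cube E) (el_sym E) (el_M1 E) (el_ell E) cx0 eps0).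
Qed.

Section radial.
Variables (phi dphi : R -> R).
Hypothesis phiD : forall t : R, 0 < t -> is_derive t 1 phi (dphi t).
Hypothesis phiC : forall t : R, 0 < t -> {for t, continuous dphi}.

Lemma Ck1_near_radial : Ck 1 V (fun x => phi (near_tau x)).
Proof. exact: (Ck1_radial eps0 A_ge0' _ phiD phiC (rel_open_sub (el_open E))). Qed.

Lemma Ck1_far_radial : Ck 1 V (fun x => phi (far_tau x)).
Proof. exact: (Ck1_radial eps0 A_ge0' _ phiD phiC (rel_open_sub (el_open E))). Qed.

Lemma has_pderiv_near_radial k x : has_pderiv (fun x => phi (near_tau x)) k x
  (- (dphi (near_tau x) * near_tau x ^+ 3 * adist A x0 x 0 k)).
Proof. exact: (@has_pderiv_radial _ _ _ _ Asym' eps0 A_ge0' x0 _ _ phiD k x). Qed.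

Lemma has_pderiv_far_radial k x : has_pderiv (fun x => phi (far_tau x)) k x
  (- (dphi (far_tau x) * far_tau x ^+ 3 * adist A (mirror G x0) x 0 k)).
Proof. exact: (@has_pderiv_radial _ _ _ _ Asym' eps0 A_ge0' (mirror G x0) _ _ phiD k x). Qed.

Lemma Ck1_mirror_field l : Ck 1 V (mirror_field G x0 eps phi l).
Proof.
have VH := rel_open_sub (el_open E).
by apply: Ck1D => //; exact: (Ck1_radial_field eps0 A_ge0' _ phiD phiC).
Qed.

Lemma pderiv_mirror_field k l x : H x -> pderiv (mirror_field G x0 eps phi l) k x =
  (phi (near_tau x) * (k == l)%:R
    - dphi (near_tau x) * near_tau x ^+ 3 * adist A x0 x 0 k * (x - x0) 0 l)
  + (phi (far_tau x) * (k == l)%:R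
    - dphi (far_tau x) * far_tau x ^+ 3 * adist A (mirror G x0) x 0 k * (x - mirror G x0) 0 l).
Proof.
move=> Hx; apply: pderivE => //.
have h y := @has_pderiv_radial_field _ _ _ _ Asym' eps0 A_ge0' y _ _ phiD k l x.
exact: has_pderivD (h x0) (h (mirror G x0)).
Qed.

Definition radial_div (t : R) : R := n.+1%:R * phi t - dphi t * t * (1 - (eps * t) ^+ 2).

Lemma div_mirror_field x : H x -> \sum_k pderiv (mirror_field G x0 eps phi k) k x =
  radial_div (near_tau x) + radial_div (far_tau x).
Proof.
move=> Hx; have VH := rel_open_sub (el_open E).
have h y : \sum_k pderiv (radial_field A eps y phi k) k x = radial_div (rtau A eps y x).
  exact: (div_radial_field Asym' eps0 A_ge0' y phiD Hx).
rewrite -!h -big_split/=; apply: eq_bigr => k _; apply: pderivE => //.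
have hr y := @has_pderiv_radial_field _ _ _ _ Asym' eps0 A_ge0' y _ _ phiD k k x.
by apply: has_pderivD; apply/pderivableP; exact: has_pderivW (hr _).
Qed.
End radial.

(** The field [phi(t) (x - y)] is the gradient, for the scalar product [A], of
    [1/t + (eps/2) log t]: the regularised distance with a logarithmic correction. With polynomials,
    the divergence and its derivative are formal computations. *)
Definition mor_phi : {poly R} := 'X - (eps / 2) *: 'X^2.
Definition mor_div : {poly R} :=
  n.+1%:R *: mor_phi - deriv mor_phi * 'X * (1 - (eps *: 'X) ^+ 2).

Lemma mor_phiE t : mor_phi.[t] = t - eps / 2 * t ^+ 2.
Proof. by rewrite !hornerE. Qed.

Lemma deriv_mor_phiE t : (deriv mor_phi).[t] = 1 - eps * t.
Proof. by rewrite /mor_phi !poly.derivE !hornerE /=; field. Qed.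

Lemma mor_divE t : mor_div.[t] = radial_div (horner mor_phi) (horner (deriv mor_phi)) t.
Proof. by rewrite /mor_div /radial_div; move: mor_phi => q; rewrite !hornerE. Qed.

Lemma deriv_mor_divE t : (deriv mor_div).[t] = n.+1%:R * (1 - eps * t)
  - ((1 - 2 * (eps * t)) * (1 - (eps * t) ^+ 2) - 2 * (eps * t) ^+ 2 * (1 - eps * t)).
Proof. by rewrite /mor_div /mor_phi !poly.derivE !hornerE /=; field. Qed.

Lemma horner_is_derive (q : {poly R}) (t : R) : 0 < t -> is_derive t 1 (horner q) (deriv q).[t].
Proof. by move=> _; exact: is_derive_poly. Qed.

Lemma horner_continuous (q : {poly R}) (t : R) : 0 < t -> {for t, continuous (horner q)}.
Proof. by move=> _; exact: continuous_horner. Qed.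

Hypothesis epsK : eps * lam = 20 * M ^+ 10.

Local Notation t1 := (near_tau _).
Local Notation X := (mirror_field G x0 eps (horner mor_phi)).

(** The divergence of the field, lowered by a fraction of [eps t^2]. The difference leaves [energy]
    with a positive weight, which produces the [lam^2 v^2] part of the gain; the factor [M^4], from
    [energy_ge], keeps its negative gradient part below the Hessian. *)
Definition mor_w : {poly R} := mor_div - (eps / (2 * M ^+ 4)) *: 'X^2.
Definition multiplier x : R := mor_w.[near_tau x] + mor_div.[far_tau x].

Lemma mor_phi_le t : 0 < t -> eps * t <= 1 -> `|mor_phi.[t]| <= t.
Proof.
move=> t0 et; rewrite mor_phiE; have e0 : 0 <= eps * t by rewrite mulr_ge0 ?ltW.
have -> : t - eps / 2 * t ^+ 2 = t * (1 - eps * t / 2) by ring.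
rewrite normrM (gtr0_norm t0) ler_piMr ?(ltW t0)// ler_norml; lra.
Qed.

Lemma mor_div_le t : 0 < t -> eps * t <= 1 -> `|mor_div.[t]| <= M * t.
Proof.
move=> t0 et; rewrite mor_divE /radial_div mor_phiE deriv_mor_phiE.
have e0 : 0 <= eps * t by rewrite mulr_ge0 ?ltW.
have -> : n.+1%:R * (t - eps / 2 * t ^+ 2) - (1 - eps * t) * t * (1 - (eps * t) ^+ 2) =
  (n.+1%:R * (1 - eps * t / 2) - (1 - eps * t) * (1 - (eps * t) ^+ 2)) * t by field.
rewrite normrM (gtr0_norm t0) ler_wpM2r ?(ltW t0)// ler_norml.
have d1 : (1 : R) <= n.+1%:R by rewrite ler1n.
set s := eps * t in e0 et *; have s2 : 0 <= s ^+ 2 by exact: sqr_ge0.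
have s21 : s ^+ 2 <= 1 by rewrite expr_le1.
have h0 : 0 <= (1 - s) * (1 - s ^+ 2) by rewrite mulr_ge0// subr_ge0.
have h1 : (1 - s) * (1 - s ^+ 2) <= 1 * 1.
  by apply: ler_pM; rewrite ?subr_ge0// lerBlDr lerDl.
have h2 : n.+1%:R * (1 - s / 2) <= (n.+1%:R : R) by rewrite ler_piMr// lerBlDr lerDl divr_ge0.
have h3 : 0 <= n.+1%:R * (1 - s / 2) by rewrite mulr_ge0//; lra.
have := el_dim E; have := el_M1 E; lra.
Qed.

Lemma deriv_mor_div_le t : 0 < t -> eps * t <= 1 -> `|(deriv mor_div).[t]| <= 2 * M.
Proof.
move=> t0 et; rewrite deriv_mor_divE.
have e0 : 0 <= eps * t by rewrite mulr_ge0 ?ltW.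
have d1 : (1 : R) <= n.+1%:R by rewrite ler1n.
set s := eps * t in e0 et *; have s2 : 0 <= s ^+ 2 by exact: sqr_ge0.
have s21 : s ^+ 2 <= 1 by rewrite expr_le1.
have h2 : n.+1%:R * (1 - s) <= (n.+1%:R : R) by rewrite ler_piMr// lerBlDr lerDl.
have h3 : 0 <= n.+1%:R * (1 - s) by rewrite mulr_ge0//; lra.
have h : -1 <= (1 - 2 * s) * (1 - s ^+ 2) - 2 * s ^+ 2 * (1 - s) <= 1.
  apply/andP; split; rewrite -subr_ge0.
    have -> : (1 - 2 * s) * (1 - s ^+ 2) - 2 * s ^+ 2 * (1 - s) - -1 =
      s * (2 * s - 1) ^+ 2 + (1 - s) * (2 - s) by ring.
    have h5 : 0 <= 1 - s by lra.
    have h6 : 0 <= 2 - s by lra.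
    by apply: addr_ge0; apply: mulr_ge0 => //; exact: sqr_ge0.
  have -> : 1 - ((1 - 2 * s) * (1 - s ^+ 2) - 2 * s ^+ 2 * (1 - s)) =
      2 * s * (1 - s ^+ 2) + s ^+ 2 + 2 * s ^+ 2 * (1 - s) by ring.
  have h5 : 0 <= 1 - s by lra.
  have h6 : 0 <= 1 - s ^+ 2 by lra.
  have h7 := mulr_ge0 e0 h6; have h8 := mulr_ge0 s2 h5; lra.
move: h => /andP[h4 h5]; rewrite ler_norml; have := el_dim E; have := el_M1 E; lra.
Qed.

Lemma inv_M4_ge0 : 0 <= eps / (2 * M ^+ 4).
Proof.
by apply: divr_ge0; [exact: ltW|apply: mulr_ge0 => //; exact: M_exp_ge0].
Qed.

Lemma near_et x : eps * near_tau x <= 1.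
Proof. exact: eps_rtau_le1 eps0 A_ge0' _ _. Qed.

Lemma far_et x : eps * far_tau x <= 1.
Proof. exact: eps_rtau_le1 eps0 A_ge0' _ _. Qed.

Lemma mor_field_le k x : cube a L x -> `|X k x| <= 2 * M.
Proof.
move=> cx; have -> : 2 * M = M + M by ring.
rewrite (le_trans (ler_normD _ _))// lerD// normrM.
- rewrite (le_trans _ (@center_coord x0 x k))// ler_wpM2r//.
  exact: mor_phi_le (near_tau_gt0 x) (near_et x).
- rewrite (le_trans _ (@center_coord (mirror G x0) x k))// ler_wpM2r//.
  exact: mor_phi_le (far_tau_gt0 x) (far_et x).
Qed.

Lemma multiplierE x : multiplier x =
  mor_div.[near_tau x] + mor_div.[far_tau x] - eps / (2 * M ^+ 4) * near_tau x ^+ 2.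
Proof. by rewrite /multiplier /mor_w; move: mor_div => q; rewrite !hornerE /=; ring. Qed.

Lemma div_mor_field x : H x -> \sum_k pderiv (X k) k x =
  multiplier x + eps / (2 * M ^+ 4) * near_tau x ^+ 2.
Proof.
move=> Hx; rewrite (div_mirror_field (horner_is_derive _) Hx) multiplierE !mor_divE; ring.
Qed.

Lemma Ck1_multiplier : Ck 1 V multiplier.
Proof.
apply: Ck1D; first exact: rel_open_sub (el_open E).
- exact: Ck1_near_radial (@horner_is_derive _) (@horner_continuous _).
- exact: Ck1_far_radial (@horner_is_derive _) (@horner_continuous _).
Qed.

Lemma inv_M4_le : eps / (2 * M ^+ 4) <= eps / 2.
Proof.
by rewrite invfM mulrA ler_piMr ?divr_ge0 ?(ltW eps0)// invf_le1 ?exprn_ege1 ?exprn_gt0 ?M_gt0 ?(el_M1 E).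
Qed.

Lemma multiplier_le x : cube a L x -> `|multiplier x| <= 3 * M * near_tau x.
Proof.
move=> cx; rewrite multiplierE; have t10 := near_tau_gt0 x.
have d1 := mor_div_le t10 (near_et x); have d2 := mor_div_le (far_tau_gt0 x) (far_et x).
have t21 := ler_wpM2l M_ge0 (far_tau_le (el_half_space cx)).
have h : `|eps / (2 * M ^+ 4) * near_tau x ^+ 2| <= M * near_tau x.
  rewrite ger0_norm; last by apply: mulr_ge0; [exact: inv_M4_ge0|exact: sqr_ge0].
  rewrite expr2 mulrA ler_wpM2r ?(ltW t10)//.
  have := ler_wpM2r (ltW t10) inv_M4_le; have := near_et x; have := el_M1 E; lra.
rewrite (le_trans (ler_normB _ _))//; have := ler_normD (mor_div.[near_tau x]) (mor_div.[far_tau x]).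
lra.
Qed.

(** The gradient of [t] is of order [t^2], hence so is that of the divergence of the field: the same
    decay as the gain in [mor_hessian]. *)
Lemma pderiv_multiplier_le k x : cube a L x -> `|pderiv multiplier k x| <= 5 * M ^+ 2 * near_tau x ^+ 2.
Proof.
move=> cx; have Hx := el_half_space cx; have t10 := near_tau_gt0 x; have t20 := far_tau_gt0 x.
have hw : has_pderiv multiplier k x _ := has_pderivD
  (@has_pderiv_near_radial _ _ (@horner_is_derive mor_w) k x)
  (@has_pderiv_far_radial _ _ (@horner_is_derive mor_div) k x).
rewrite (pderivE Hx hw) -opprD normrN.
have -> : (deriv mor_w).[near_tau x] = (deriv mor_div).[near_tau x] - eps / M ^+ 4 * near_tau x.
  rewrite /mor_w !poly.derivE !hornerE /=; have := M_gt0 => m; field; by rewrite gt_eqF.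
have a1 := @center_adist x0 x k; have a2 := @center_adist (mirror G x0) x k.
have d1 := deriv_mor_div_le t10 (near_et x); have d2 := deriv_mor_div_le t20 (far_et x).
have e1 : `|eps / M ^+ 4 * near_tau x| <= M.
  rewrite ger0_norm; last by rewrite mulr_ge0 ?(ltW t10)// divr_ge0 ?M_exp_ge0 ?(ltW eps0).
  have -> : eps / M ^+ 4 = 2 * (eps / (2 * M ^+ 4)).
    by field; rewrite gt_eqF ?M_gt0.
  have := ler_wpM2r (ltW t10) inv_M4_le; have := near_et x; have := el_M1 E; lra.
have g (c d s t : R) : 0 < t -> `|c| <= d -> t * `|s| <= M -> `|c * t ^+ 3 * s| <= d * M * t ^+ 2.
  move=> tt cd sM; have -> : c * t ^+ 3 * s = c * (t * s) * t ^+ 2 by ring.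
  rewrite normrM (ger0_norm (sqr_ge0 t)) ler_wpM2r ?sqr_ge0// !normrM (gtr0_norm tt).
  by apply: ler_pM => //; rewrite mulr_ge0// ltW.
have b1 : `|(deriv mor_div).[near_tau x] - eps / M ^+ 4 * near_tau x| <= 3 * M.
  rewrite (le_trans (ler_normB _ _))//; lra.
have c1 := g _ _ _ _ t10 b1 a1; have c2 := g _ _ _ _ t20 d2 a2.
have t21 : far_tau x ^+ 2 <= near_tau x ^+ 2.
  by rewrite ler_pXn2r ?nnegrE ?(ltW t10) ?(ltW t20)// far_tau_le.
have M2 : 0 <= 2 * M * M by rewrite !mulr_ge0 ?M_ge0.
rewrite (le_trans (ler_normD _ _))//; have := ler_wpM2l M2 t21; lra.
Qed.

Local Notation En x := (r x ^+ 2 + lam ^+ 2 * v x ^+ 2).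

(** Both centres contribute through [center_hessian]; the nonnegative gain of the mirror image is
    dropped and its error, of order [M^9], is kept. *)
Lemma mor_hessian x : cube a L x ->
  eps * near_tau x ^+ 2 / (2 * M) * r x ^+ 2 - 4 * M ^+ 9 * r x ^+ 2 <=
  \sum_k \sum_l pderiv (X l) k x * pderiv v l x * p x 0 k.
Proof.
move=> cx; have Hx := el_half_space cx.
have t21 := far_tau_le Hx; have t20 := far_tau_gt0 x.
pose Q y := (mor_phi.[rtau A eps y x]) * dot (p x) (xi x)
  - (deriv mor_phi).[rtau A eps y x] * rtau A eps y x ^+ 3
    * (dot (adist A y x) (p x) * dot (x - y) (xi x)).
have QE y : Q y = \sum_k \sum_l (mor_phi.[rtau A eps y x] * (k == l)%:R
    - (deriv mor_phi).[rtau A eps y x] * rtau A eps y x ^+ 3 * adist A y x 0 k * (x - y) 0 l)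
      * pderiv v l x * p x 0 k.
  rewrite /Q; set c := mor_phi.[_]; set d := _.[_] * _ ^+ 3.
  have xE l : xi x 0 l = pderiv v l x by rewrite mxE.
  transitivity (\sum_k \sum_l (c * ((k == l)%:R * xi x 0 l * p x 0 k)
      - d * (adist A y x 0 k * p x 0 k * ((x - y) 0 l * xi x 0 l)))); last first.
    by apply: eq_bigr => k _; apply: eq_bigr => l _; rewrite -xE; ring.
  under eq_bigr => k _ do rewrite big_split/= sumrN -!mulr_sumr.
  rewrite big_split/= sumrN -!mulr_sumr; congr (c * _ - d * _); last by rewrite -mulr_suml.
  apply: eq_bigr => k _; rewrite (bigD1 k)//= eqxx mul1r big1 ?addr0 1?mulrC// => l lk.
  by rewrite eq_sym (negbTE lk) !mul0r.
have -> : \sum_k \sum_l pderiv (X l) k x * pderiv v l x * p x 0 k = Q x0 + Q (mirror G x0).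
  rewrite !QE -big_split/=; apply: eq_bigr => k _; rewrite -big_split/=; apply: eq_bigr => l _.
  by rewrite (pderiv_mirror_field (horner_is_derive _))// !mulrDl.
have h y : rtau A eps y x <= near_tau x ->
    eps * rtau A eps y x ^+ 2 / (2 * M) * r x ^+ 2 - 2 * M ^+ 9 * r x ^+ 2 <= Q y.
  by move=> /(@center_hessian y x cx); rewrite /Q mor_phiE deriv_mor_phiE.
have h1 := h x0 (lexx _); have h2 := h (mirror G x0) t21.
have h3 : 0 <= eps * rtau A eps (mirror G x0) x ^+ 2 / (2 * M) * r x ^+ 2.
  apply: mulr_ge0; last exact: sqr_ge0.
  by apply: divr_ge0; apply: mulr_ge0; rewrite ?sqr_ge0 ?M_ge0// ltW.
rewrite -/(near_tau x) in h1; lra.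
Qed.

Variables chi chi1 : vec -> R.
Hypothesis chiC : Ck 1 V chi.
Hypothesis chi1C : Ck 1 V chi1.
Hypothesis chi_itv : forall x, cube a L x -> 0 <= chi x <= 1.
Hypothesis chi1_itv : forall x, cube a L x -> 0 <= chi1 x <= 1.
Hypothesis dchi : forall x k, cube a L x -> `|pderiv chi k x| <= M.
Hypothesis dchi1 : forall x k, cube a L x -> `|pderiv chi1 k x| <= M.
Hypothesis chi1_out : forall x, cube a L x -> outer_face a L x -> chi1 x = 0.
Hypothesis chi_chi1 : forall x, cube a L x ->
  chi1 x = 1 \/ (chi x = 0 /\ forall k, pderiv chi k x = 0).

Lemma chi_out x : cube a L x -> outer_face a L x -> chi x = 0.
Proof.
move=> cx /(chi1_out cx) c0; have [] := chi_chi1 cx; last by case.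
by rewrite c0 => /eqP; rewrite eq_sym oner_eq0.
Qed.

Local Notation Y := (fun k x => chi x * X k x).
Local Notation w := (fun x => chi x * multiplier x).

(** Rellich's identity for [chi * X] plus [null_multiplier] for [chi * multiplier]; the terms
    [chi * multiplier * energy] have cancelled. *)
Definition mor_main x : R :=
  2 * ((\sum_k pderiv chi k x * p x 0 k) * (\sum_l X l x * pderiv v l x)
       + chi x * \sum_k \sum_l pderiv (X l) k x * pderiv v l x * p x 0 k)
  + energy G rho v lam x * (\sum_k pderiv chi k x * X k x
       + chi x * (eps / (2 * M ^+ 4) * near_tau x ^+ 2))
  + chi x * (lam ^+ 2 * v x ^+ 2 * \sum_k X k x * pderiv rho k x
     - \sum_k X k x * \sum_m \sum_l pderiv (fun y => G y m l) k x * pderiv v l x * pderiv v m x)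
  + v x * (multiplier x * (\sum_k pderiv chi k x * p x 0 k)
     + chi x * \sum_k pderiv multiplier k x * p x 0 k).

Lemma null_mor_main : null a L mor_main.
Proof.
have VH := rel_open_sub (el_open E); have cV := el_cube E.
have XC k : Ck 1 V (X k) := @Ck1_mirror_field _ _ (@horner_is_derive _) (@horner_continuous _) k.
have YC k : Ck 1 V (Y k) by exact: Ck1M.
have wC : Ck 1 V w by apply: Ck1M => //; exact: Ck1_multiplier.
have Yo x k : cube a L x -> outer_face a L x -> Y k x = 0.
  by move=> cx /(chi_out cx) ->; rewrite mul0r.
have Y0 x : V x -> x 0 0 = 0 -> Y 0 x = 0.
  move=> Vx x0b; by rewrite (mirror_field_tangent (el_cube E) (el_sym E) (el_M1 E) (el_ell E) eps cx0 _ x0b) mulr0.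
have N1 := null_rellich (el_open E) (el_side E) (el_cube E) (el_GC E) (el_sym E) (el_rhoC E)
  (sol_C S) (sol_eq S) (sol_bc S) YC Yo Y0.
have wo x : cube a L x -> outer_face a L x -> w x = 0.
  by move=> cx /(chi_out cx) ->; rewrite mul0r.
have N2 := null_multiplier (el_open E) (el_side E) (el_cube E) (el_GC E)
  (sol_C S) (sol_eq S) (sol_bc S) wC wo.
apply: (eq_null (el_side E) _ (nullD N1 N2)) => x cx; have Vx := cV _ cx; have Hx := VH _ Vx.
have dY k l : pderiv (Y l) k x = pderiv chi k x * X l x + chi x * pderiv (X l) k x.
  apply: pderivE => //.
  exact: has_pderivM (Ck_has_pderiv chiC Vx) (Ck_has_pderiv (XC l) Vx).
have dw k : pderiv w k x = pderiv chi k x * multiplier x + chi x * pderiv multiplier k x.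
  apply: pderivE => //.
  exact: has_pderivM (Ck_has_pderiv chiC Vx) (Ck_has_pderiv Ck1_multiplier Vx).
have E1 : \sum_k \sum_l pderiv (Y l) k x * pderiv v l x * p x 0 k =
    (\sum_k pderiv chi k x * p x 0 k) * (\sum_l X l x * pderiv v l x)
    + chi x * \sum_k \sum_l pderiv (X l) k x * pderiv v l x * p x 0 k.
  rewrite mulr_suml mulr_sumr -big_split/=; apply: eq_bigr => k _.
  rewrite !mulr_sumr -big_split/=; apply: eq_bigr => l _; rewrite dY; ring.
have E2 : \sum_k pderiv (Y k) k x = \sum_k pderiv chi k x * X k x
    + chi x * (multiplier x + eps / (2 * M ^+ 4) * near_tau x ^+ 2).
  rewrite -(div_mor_field Hx) mulr_sumr -big_split/=; apply: eq_bigr => k _; exact: dY.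
have E3 (F : 'I_n.+1 -> R) : \sum_k chi x * X k x * F k = chi x * \sum_k X k x * F k.
  by rewrite mulr_sumr; apply: eq_bigr => k _; rewrite mulrA.
have E4 : \sum_k pderiv w k x * p x 0 k = multiplier x * (\sum_k pderiv chi k x * p x 0 k)
     + chi x * \sum_k pderiv multiplier k x * p x 0 k.
  rewrite !mulr_sumr -big_split/=; apply: eq_bigr => k _; rewrite dw; ring.
rewrite E1 E2 E4 !E3 /mor_main; ring.
Qed.

(** Where [chi] and its gradient vanish, so does [mor_main]; elsewhere [chi1 = 1]. The terms of size
    [t^2] are absorbed by the gain, the bounded ones are charged to [chi1^2] times mass and
    gradient. *)
Lemma mor_main_ge x : cube a L x ->
  chi x * (eps * near_tau x ^+ 2 / (4 * M ^+ 5) * En x) - 21 * M ^+ 9 * (chi1 x ^+ 2 * En x)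
  <= mor_main x.
Proof.
move=> cx; have [c1|[c0 dc0]] := chi_chi1 cx; last first.
  have d0 (F : 'I_n.+1 -> R) : \sum_k pderiv chi k x * F k = 0.
    by rewrite big1// => k _; rewrite dc0 mul0r.
  rewrite /mor_main c0 !d0.
  rewrite !(mul0r, mulr0, addr0) add0r oppr_le0; have c2 := sqr_ge0 (chi1 x).
  apply: mulr_ge0; first by apply: mulr_ge0 => //; exact: M_exp_ge0.
  apply: mulr_ge0 => //; apply: addr_ge0; first exact: sqr_ge0.
  by apply: mulr_ge0; exact: sqr_ge0.
rewrite c1 expr1n mul1r.
have Hx := el_half_space cx; have t10 := near_tau_gt0 x.
have M1 := el_M1 E; have M0 := M_gt0; have r0 := grad_norm_ge0 x.
have lam0 : 0 < lam by exact: lt_le_trans lam1.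
have r2 : 0 <= r x ^+ 2 by exact: sqr_ge0.
have v2 : 0 <= lam ^+ 2 * v x ^+ 2 by rewrite mulr_ge0 ?sqr_ge0.
have En0 : 0 <= En x by rewrite addr_ge0.
have /andP[k0 k1] := chi_itv cx.
have Xb k := @mor_field_le k x cx.
have xib k : `|xi x 0 k| <= r x := xi_le x k.
have vb k : `|pderiv v k x| <= r x by have := xib k; rewrite mxE.
have pb k := @conormal_le x k cx.
have dp : `|\sum_k pderiv chi k x * p x 0 k| <= M ^+ 4 * r x.
  have -> : M ^+ 4 * r x = M * (M * (M ^+ 2 * r x)) by ring.
  by apply: norm_sum_le => k; rewrite normrM; apply: ler_pM => //; exact: dchi.
have Xv : `|\sum_l X l x * pderiv v l x| <= 2 * M ^+ 2 * r x.
  have -> : 2 * M ^+ 2 * r x = M * (2 * M * r x) by ring.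
  by apply: norm_sum_le => k; rewrite normrM; apply: ler_pM.
have dX : `|\sum_k pderiv chi k x * X k x| <= 2 * M ^+ 3.
  have -> : 2 * M ^+ 3 = M * (M * (2 * M)) by ring.
  by apply: norm_sum_le => k; rewrite normrM; apply: ler_pM => //; exact: dchi.
have Xr : `|\sum_k X k x * pderiv rho k x| <= 2 * M ^+ 3.
  have -> : 2 * M ^+ 3 = M * (2 * M * M) by ring.
  by apply: norm_sum_le => k; rewrite normrM; apply: ler_pM => //; exact: el_drho E _ _ cx.
have XQ : `|\sum_k X k x * \sum_m \sum_l pderiv (fun y => G y m l) k x * pderiv v l x * pderiv v m x|
    <= 2 * M ^+ 5 * r x ^+ 2.
  have -> : 2 * M ^+ 5 * r x ^+ 2 = M * (2 * M * (M * (M * (M * r x * r x)))) by ring.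
  apply: norm_sum_le => k; rewrite normrM; apply: ler_pM => //.
  apply: norm_sum_le => m; apply: norm_sum_le => l; rewrite !normrM.
  apply: ler_pM => //.
  by apply: ler_pM => //; exact: el_dG E _ _ _ _ cx.
have wp : `|\sum_k pderiv multiplier k x * p x 0 k| <= 5 * M ^+ 5 * near_tau x ^+ 2 * r x.
  have -> : 5 * M ^+ 5 * near_tau x ^+ 2 * r x =
    M * (5 * M ^+ 2 * near_tau x ^+ 2 * (M ^+ 2 * r x)) by ring.
  apply: norm_sum_le => k; rewrite normrM; apply: ler_pM => //; exact: pderiv_multiplier_le.
have wb := multiplier_le cx; have hess := mor_hessian cx.
have eb := energy_norm_le cx; have eg := energy_ge cx; have lm := lam_mixed x.
rewrite /mor_main; move: dp Xv dX Xr XQ wp wb hess eb eg lm.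
set Dp := \sum_k pderiv chi k x * p x 0 k; set XV := \sum_l X l x * _.
set DX := \sum_k pderiv chi k x * X k x; set XR := \sum_k X k x * pderiv rho k x.
set XQ := \sum_k X k x * _; set WP := \sum_k pderiv multiplier k x * _.
set w0 := multiplier x; set Hs := \sum_k \sum_l _; set e := energy _ _ _ _ _.
move: k0 k1 r2 v2 En0; set q := r x ^+ 2; set z := lam ^+ 2 * v x ^+ 2; set t := near_tau x in t10 *.
move=> k0 k1 q0 z0 En0 dp Xv dX Xr XQb wp wb hess eb eg lm.
set c := chi x * (eps * t ^+ 2 / (4 * M ^+ 5)).
have M50 : 0 < M ^+ 5 by rewrite exprn_gt0.
have c0 : 0 <= c.
  apply: mulr_ge0 => //; apply: divr_ge0; apply: mulr_ge0; rewrite ?sqr_ge0// ltW//.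
have cE : chi x * (eps * t ^+ 2) = 4 * M ^+ 5 * c.
  by rewrite /c; field; rewrite gt_eqF.
have P1 : `|Dp * XV| <= 2 * M ^+ 6 * q.
  rewrite normrM (le_trans (ler_pM _ _ dp Xv))//.
  by rewrite le_eqVlt; apply/orP; left; apply/eqP; rewrite /q; ring.
have P2 : 2 * M ^+ 4 * c * q - 4 * M ^+ 9 * q <= chi x * Hs.
  have h := ler_wpM2l k0 hess; rewrite (le_trans _ h)// mulrBr.
  have -> : chi x * (eps * t ^+ 2 / (2 * M) * q) = 2 * M ^+ 4 * c * q.
    by rewrite /c; field; rewrite gt_eqF.
  rewrite lerD2l lerN2 ler_piMl// mulr_ge0// mulr_ge0// M_exp_ge0//.
have P3 : `|e * DX| <= 2 * M ^+ 6 * (q + z).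
  rewrite normrM (le_trans (ler_pM _ _ eb dX))//.
  by rewrite le_eqVlt; apply/orP; left; apply/eqP; ring.
(* The gain in [lam^2 v^2]. Its cost [2 M^4 c q] is half of the [4 M^4 c q] that [P2] provides after
   doubling. *)
have P4 : 2 * c * z - 2 * (M ^+ 4 * c * q) <= e * (chi x * (eps / (2 * M ^+ 4) * t ^+ 2)).
  have -> : e * (chi x * (eps / (2 * M ^+ 4) * t ^+ 2)) = 2 * c * (M * e).
    by rewrite /c; field; rewrite gt_eqF.
  have c20 : 0 <= 2 * c by exact: mulr_ge0.
  rewrite (le_trans _ (ler_wpM2l c20 eg))// le_eqVlt; apply/orP; left; apply/eqP; ring.
have P5 : `|chi x * (z * XR)| <= 2 * M ^+ 3 * z.
  rewrite normrM (ger0_norm k0) normrM [`|z|]ger0_norm// mulrCA mulrC ler_wpM2r//.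
  by rewrite (le_trans _ Xr)// ler_piMl.
have P6 : `|chi x * XQ| <= 2 * M ^+ 5 * q.
  by rewrite normrM (ger0_norm k0) (le_trans _ XQb)// ler_piMl.
(* From [eps * t <= 1]: a product of [t] with [|v| r] becomes a product of [lam] with [|v| r], which
   [lam_mixed] bounds. *)
have tl : 20 * M ^+ 10 * t <= lam.
  rewrite -epsK mulrAC ler_piMl ?(ltW lam0)//; exact: near_et.
have M510 : M ^+ 5 <= M ^+ 10 by exact: M_exp_le.
have P7 : `|v x * (w0 * Dp)| <= (q + z) / 2.
  rewrite (le_trans _ lm)// normrM [`|w0 * _|]normrM.
  rewrite (le_trans (ler_wpM2l (normr_ge0 _) (ler_pM (normr_ge0 _) (normr_ge0 _) wb dp)))//.
  have -> : `|v x| * (3 * M * t * (M ^+ 4 * r x)) = (3 * M ^+ 5 * t) * (`|v x| * r x) by ring.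
  rewrite -[leRHS]mulrA ler_wpM2r ?mulr_ge0// (le_trans _ tl)// ler_wpM2r ?(ltW t10)//.
  by apply: ler_pM; rewrite ?ler_nat ?M_exp_ge0.
(* The critical term, [v] times the gradient of the multiplier. The value [20 M^10] of [eps * lam]
   is chosen to let [c (q + z)] dominate it. *)
have P8 : `|v x * (chi x * WP)| <= c * (q + z).
  have -> : v x * (chi x * WP) = chi x * (v x * WP) by ring.
  rewrite normrM (ger0_norm k0) /c -mulrA ler_wpM2l// normrM.
  rewrite (le_trans (ler_wpM2l (normr_ge0 _) wp))//.
  have -> : eps * t ^+ 2 / (4 * M ^+ 5) * (q + z) =
      (eps * t ^+ 2 / (2 * M ^+ 5)) * ((q + z) / 2) by field; rewrite gt_eqF.
  have h0 : 0 <= eps * t ^+ 2 / (2 * M ^+ 5).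
    by apply: divr_ge0; apply: mulr_ge0; rewrite ?sqr_ge0// ltW.
  rewrite (le_trans _ (ler_wpM2l h0 lm))//.
  have -> : eps * t ^+ 2 / (2 * M ^+ 5) * (lam * `|v x| * r x) =
      (eps * lam) * t ^+ 2 / (2 * M ^+ 5) * (`|v x| * r x) by field; rewrite gt_eqF.
  rewrite epsK; have -> : 20 * M ^+ 10 * t ^+ 2 / (2 * M ^+ 5) = 10 * M ^+ 5 * t ^+ 2.
    by field; rewrite gt_eqF.
  have -> : `|v x| * (5 * M ^+ 5 * t ^+ 2 * r x) = (5 * M ^+ 5 * t ^+ 2) * (`|v x| * r x) by ring.
  rewrite ler_wpM2r ?mulr_ge0// ler_wpM2r ?sqr_ge0// ler_wpM2r ?(ltW M50)//.
  by rewrite ler_nat.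
move: P1 P3 P5 P6 P7 P8; rewrite !ler_norml => /andP[P1 _] /andP[P3 _] /andP[P5 _] /andP[_ P6].
move=> /andP[P7 _] /andP[P8 _].
have cq : c * q <= M ^+ 4 * c * q.
  rewrite ler_wpM2r// ler_peMl//; exact: exprn_ege1.
have bq i : (i <= 9)%N -> M ^+ i * q <= M ^+ 9 * q by move=> ?; rewrite ler_wpM2r// M_exp_le.
have bz i : (i <= 9)%N -> M ^+ i * z <= M ^+ 9 * z by move=> ?; rewrite ler_wpM2r// M_exp_le.
have bq6 := bq 6 isT; have bq5 := bq 5 isT; have bq0 := bq 0 isT; rewrite expr0 mul1r in bq0.
have bz6 := bz 6 isT; have bz3 := bz 3 isT; have bz0 := bz 0 isT; rewrite expr0 mul1r in bz0.
have G1 : e * (DX + chi x * (eps / (2 * M ^+ 4) * t ^+ 2)) =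
  e * DX + e * (chi x * (eps / (2 * M ^+ 4) * t ^+ 2)) by rewrite mulrDr.
have G2 : v x * (w0 * Dp + chi x * WP) = v x * (w0 * Dp) + v x * (chi x * WP) by rewrite mulrDr.
have G3 : chi x * (z * XR - XQ) = chi x * (z * XR) - chi x * XQ by rewrite mulrBr.
rewrite G1 G2 G3.
move: P1 P2 P3 P4 P5 P6 P7 P8 cq bq6 bq5 bq0 bz6 bz3 bz0.
rewrite [chi x * (_ * (q + z))](_ : _ = c * q + c * z); last by rewrite /c; ring.
have := @mor_arith R (Dp * XV) (chi x * Hs) (e * DX) (e * (chi x * (eps / (2 * M ^+ 4) * t ^+ 2)))
  (chi x * (z * XR)) (chi x * XQ) (v x * (w0 * Dp)) (v x * (chi x * WP)) (M ^+ 6 * q) (M ^+ 5 * q)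
  (M ^+ 9 * q) (M ^+ 6 * z) (M ^+ 3 * z) (M ^+ 9 * z) (c * q) (c * z) (M ^+ 4 * c * q) q z q0 z0.
by rewrite !(mulrDr, mulrA).
Qed.

(** From the test function [chi1^2 v]: it trades the gradient on the support of [chi1] for
    [lam^2 v^2]. *)
Definition caccioppoli x : R :=
  - (chi1 x ^+ 2 * energy G rho v lam x)
  + v x * \sum_k pderiv (fun x => chi1 x ^+ 2) k x * p x 0 k.

Lemma null_caccioppoli : null a L caccioppoli.
Proof.
have VH := rel_open_sub (el_open E).
apply: (null_multiplier (el_open E) (el_side E) (el_cube E) (el_GC E)
  (sol_C S) (sol_eq S) (sol_bc S)).
  exact: Ck1_exp.
by move=> x cx /(chi1_out cx) ->; rewrite expr0n.
Qed.

Lemma caccioppoli_ge x : cube a L x ->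
  chi1 x ^+ 2 * r x ^+ 2 / (2 * M) - 3 * M ^+ 9 * (lam ^+ 2 * v x ^+ 2) <= caccioppoli x.
Proof.
move=> cx; have Hx := el_half_space cx; have Vx := el_cube E cx; have M0 := M_gt0; have r0 := grad_norm_ge0 x.
have VH := rel_open_sub (el_open E).
have /andP[k0 k1] := chi1_itv cx.
have dE k : pderiv (fun x => chi1 x ^+ 2) k x = 2 * (chi1 x * pderiv chi1 k x).
  apply: pderivE => //; have h := Ck_has_pderiv (k := k) chi1C Vx.
  have := has_pderivM h h; rewrite (_ : _ + _ = 2 * (chi1 x * pderiv chi1 k x)); last by ring.
  by congr has_pderiv; apply/funext => y; rewrite expr2.
pose Dp := \sum_k pderiv chi1 k x * p x 0 k.
have dp : `|Dp| <= M ^+ 4 * r x.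
  have -> : M ^+ 4 * r x = M * (M * (M ^+ 2 * r x)) by ring.
  by apply: norm_sum_le => k; rewrite normrM; apply: ler_pM => //; [exact: dchi1|exact: conormal_le].
have sE : \sum_k pderiv (fun x => chi1 x ^+ 2) k x * p x 0 k = 2 * chi1 x * Dp.
  by rewrite /Dp mulr_sumr; apply: eq_bigr => k _; rewrite dE; ring.
rewrite /caccioppoli sE.
have P1 : `|chi1 x * (v x * Dp)| <= chi1 x ^+ 2 * r x ^+ 2 / (4 * M) + M ^+ 9 * v x ^+ 2.
  rewrite !normrM (ger0_norm k0).
  rewrite (le_trans (ler_wpM2l k0 (ler_wpM2l (normr_ge0 _) dp)))//.
  have := sqr_ge0 (chi1 x * r x / (2 * M) - M ^+ 4 * `|v x|).
  rewrite -(pmulr_rge0 _ M0) -(real_normK (num_real (v x))).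
  set av := `|v x|; have -> : M * (chi1 x * r x / (2 * M) - M ^+ 4 * av) ^+ 2 =
    chi1 x ^+ 2 * r x ^+ 2 / (4 * M) + M ^+ 9 * av ^+ 2 - chi1 x * (av * (M ^+ 4 * r x)).
    by field; rewrite gt_eqF.
  lra.
have P2 : chi1 x ^+ 2 * r x ^+ 2 / M - M * (lam ^+ 2 * v x ^+ 2) <= - (chi1 x ^+ 2 * energy G rho v lam x).
  have h1 := conormal_xi_ge cx; have c2 := sqr_ge0 (chi1 x).
  have h2 : r x ^+ 2 / M <= dot (p x) (xi x) by rewrite ler_pdivrMr// mulrC.
  have h3 := ler_wpM2l c2 h2.
  have z0 : 0 <= lam ^+ 2 * v x ^+ 2 by rewrite mulr_ge0 ?sqr_ge0.
  have h4 : chi1 x ^+ 2 * (rho x * (lam ^+ 2 * v x ^+ 2)) <= M * (lam ^+ 2 * v x ^+ 2).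
    have rho0 : 0 <= rho x.
      by have := lt_le_trans ltr01 (el_rho_ge E cx); rewrite pmulr_rgt0 ?M_gt0// => /ltW.
    rewrite mulrA ler_wpM2r// -[leRHS]mul1r; apply: ler_pM => //; last exact: el_rho_le E _ cx.
    by rewrite expr_le1.
  rewrite /energy; move: h3 h4.
  have -> : chi1 x ^+ 2 * (lam ^+ 2 * rho x * v x ^+ 2 - dot (p x) (xi x)) =
    chi1 x ^+ 2 * (rho x * (lam ^+ 2 * v x ^+ 2)) - chi1 x ^+ 2 * dot (p x) (xi x) by ring.
  rewrite mulrA; lra.
have V2 : v x ^+ 2 <= lam ^+ 2 * v x ^+ 2 by rewrite ler_peMl ?sqr_ge0// exprn_ege1.
have M9 : 0 <= M ^+ 9 := M_exp_ge0 9.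
have V3 := ler_wpM2l M9 V2.
have V4 : M * (lam ^+ 2 * v x ^+ 2) <= M ^+ 9 * (lam ^+ 2 * v x ^+ 2).
  apply: ler_wpM2r; first by apply: mulr_ge0; exact: sqr_ge0.
  by rewrite -[leLHS]expr1 M_exp_le.
move: P1; rewrite ler_norml => /andP[P1 _].
have -> : v x * (2 * chi1 x * Dp) = 2 * (chi1 x * (v x * Dp)) by ring.
have e1 : chi1 x ^+ 2 * r x ^+ 2 / M = 2 * (chi1 x ^+ 2 * r x ^+ 2 / (2 * M)).
  by field; rewrite gt_eqF.
have e2 : chi1 x ^+ 2 * r x ^+ 2 / (2 * M) = 2 * (chi1 x ^+ 2 * r x ^+ 2 / (4 * M)).
  by field; rewrite gt_eqF.
move: P1 P2; rewrite e1 e2; lra.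
Qed.

(** The factor [4 M^5] normalises the gain of [mor_main]. Its gradient error
    [4 M^5 * 21 M^9 = 84 M^14] is cancelled by the [168 M^15 / (2 M)] of [caccioppoli], and
    [504 + 84 <= 600] remains on [v^2]. Division by [lam^2] makes the bound uniform in [lam]. *)
Lemma morawetz : exists2 D, null a L D & forall x, cube a L x ->
  chi x * (eps * near_tau x ^+ 2 * v x ^+ 2) <= D x + 600 * M ^+ 24 * v x ^+ 2.
Proof.
exists (fun x => lam ^- 2 * (4 * M ^+ 5 * mor_main x + 168 * M ^+ 15 * caccioppoli x)).
  by apply: nullZ; apply: nullD; apply: nullZ; [exact: null_mor_main|exact: null_caccioppoli].
move=> x cx; have M0 := M_gt0; have lam0 : 0 < lam by exact: lt_le_trans lam1.
have h1 := mor_main_ge cx; have h2 := caccioppoli_ge cx.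
have l2 : 0 < lam ^+ 2 by rewrite exprn_gt0.
rewrite -(ler_pM2l l2) mulrDr mulVKf ?gt_eqF//.
have M50 : 0 <= 4 * M ^+ 5 by apply: mulr_ge0 => //; exact: M_exp_ge0.
have M150 : 0 <= 168 * M ^+ 15 by apply: mulr_ge0 => //; exact: M_exp_ge0.
have h3 := ler_wpM2l M50 h1; have h4 := ler_wpM2l M150 h2.
have /andP[k0 _] := chi_itv cx; have /andP[c0 c1] := chi1_itv cx.
have z0 : 0 <= lam ^+ 2 * v x ^+ 2 by rewrite mulr_ge0 ?sqr_ge0.
have q0 : 0 <= r x ^+ 2 by exact: sqr_ge0.
have m0 : 0 <= chi x * (eps * near_tau x ^+ 2) * r x ^+ 2.
  by apply: mulr_ge0 => //; apply: mulr_ge0 => //; apply: mulr_ge0; rewrite ?sqr_ge0// ltW.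
have cz : chi1 x ^+ 2 * (lam ^+ 2 * v x ^+ 2) <= lam ^+ 2 * v x ^+ 2 by rewrite ler_piMl// expr_le1.
have M14 : 0 <= M ^+ 14 := M_exp_ge0 14.
have cz' := ler_wpM2l M14 cz.
have Mz : M ^+ 14 * (lam ^+ 2 * v x ^+ 2) <= M ^+ 24 * (lam ^+ 2 * v x ^+ 2).
  by rewrite ler_wpM2r// M_exp_le.
move: h3 h4.
have -> : 4 * M ^+ 5 * (chi x * (eps * near_tau x ^+ 2 / (4 * M ^+ 5) * En x)
   - 21 * M ^+ 9 * (chi1 x ^+ 2 * En x)) = chi x * (eps * near_tau x ^+ 2) * r x ^+ 2
   + lam ^+ 2 * (chi x * (eps * near_tau x ^+ 2 * v x ^+ 2))
   - 84 * (M ^+ 14 * (chi1 x ^+ 2 * r x ^+ 2))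
   - 84 * (M ^+ 14 * (chi1 x ^+ 2 * (lam ^+ 2 * v x ^+ 2))) by field; rewrite gt_eqF.
have -> : 168 * M ^+ 15 * (chi1 x ^+ 2 * r x ^+ 2 / (2 * M) - 3 * M ^+ 9 * (lam ^+ 2 * v x ^+ 2))
  = 84 * (M ^+ 14 * (chi1 x ^+ 2 * r x ^+ 2)) - 504 * (M ^+ 24 * (lam ^+ 2 * v x ^+ 2)).
  by field; rewrite gt_eqF.
have -> : lam ^+ 2 * (600 * M ^+ 24 * v x ^+ 2) = 600 * (M ^+ 24 * (lam ^+ 2 * v x ^+ 2)) by ring.
have : 0 <= M ^+ 24 * (lam ^+ 2 * v x ^+ 2) by apply: mulr_ge0 => //; exact: M_exp_ge0.
move: cz' Mz m0; move: (M ^+ 24 * _) (M ^+ 14 * (chi1 x ^+ 2 * (lam ^+ 2 * _))) (M ^+ 14 * (lam ^+ 2 * _))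
  (M ^+ 14 * (chi1 x ^+ 2 * r x ^+ 2)) (chi x * _ * r x ^+ 2) (lam ^+ 2 * (chi x * _))
  (4 * M ^+ 5 * mor_main x) (168 * M ^+ 15 * caccioppoli x).
clear h1 h2 M50 M150 z0 q0 cz M14 k0 c0 c1 l2 M0 lam0; move=> *; lra.
Qed.

End Morawetz.

(** * A cutoff spline, monotonicity and antiderivatives *)

Section Step.
Variable R : realType.
Implicit Types (s t : R).

Definition pos_part s : R := Num.max s 0.

Lemma pos_partE s : pos_part s = s /\ 0 <= s \/ pos_part s = 0 /\ s <= 0.
Proof. by rewrite /pos_part; case: (leP s 0) => [|/ltW]; [right|left]. Qed.

Lemma continuous_pos_part : continuous pos_part.
Proof.
move=> s; apply: (@continuous_max R R id (fun=> 0)) => //; exact: cvg_cst.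
Qed.

Lemma sqr_pos_part_ineq s h :
  `|pos_part (s + h) ^+ 2 - pos_part s ^+ 2 - 2 * pos_part s * h| <= h ^+ 2.
Proof.
have h2 := sqr_ge0 h; have s2 := sqr_ge0 s; have sh2 := sqr_ge0 (s + h).
have [[-> sh]|[-> sh]] := pos_partE (s + h); have [[-> s0]|[-> s0]] := pos_partE s;
  rewrite ler_norml; apply/andP; split; try lra.
- have m : 0 <= - s * (s + h) by rewrite mulr_ge0// oppr_ge0.
  lra.
- have m : 0 <= s * - (s + h) by rewrite mulr_ge0// oppr_ge0.
  lra.
Qed.

Lemma is_derive_sqr_pos_part s : is_derive s 1 (fun t => pos_part t ^+ 2) (2 * pos_part s).
Proof.
suff h : (fun h => h^-1 *: ((pos_part (h *: 1 + s) ^+ 2 : R^o) - pos_part s ^+ 2))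
    @ 0^' --> 2 * pos_part s.
  by split; [apply/cvg_ex; exists (2 * pos_part s)|exact: cvg_lim h].
apply/cvgrPdist_le => e e0; near=> h.
have h0 : h != 0 by near: h; exact: nbhs_dnbhs_neq.
have he : `|h| <= e.
  by near: h; apply: dnbhs0_le.
rewrite /GRing.scale/= mulr1 (le_trans _ he)// distrC.
have n0 : 0 < `|h| by rewrite normr_gt0.
rewrite -(ler_pM2l n0) -normrM mulrBr mulVKf// (addrC h s).
have := sqr_pos_part_ineq s h; rewrite -(real_normK (num_real h)) expr2.
by rewrite (mulrC h).
Unshelve. all: by end_near.
Qed.

(* A quadratic spline increasing from 0 at 0 to 1 at 1. *)
Definition step s : R :=
  2 * pos_part s ^+ 2 - 4 * pos_part (s - 2^-1) ^+ 2 + 2 * pos_part (s - 1) ^+ 2.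
Definition dstep s : R :=
  4 * pos_part s - 8 * pos_part (s - 2^-1) + 4 * pos_part (s - 1).

Lemma is_derive_step s : is_derive s 1 step (dstep s).
Proof.
have h c : is_derive s 1 (fun t => pos_part (t - c) ^+ 2) (2 * pos_part (s - c)).
  have hc : is_derive s 1 (fun t : R => t - c) 1.
    by apply: is_derive_eq; rewrite subr0.
  have := @is_derive1_comp _ (fun t => pos_part t ^+ 2) (fun t => t - c) s _ _
    (is_derive_sqr_pos_part (s - c)) hc.
  by rewrite mulr1.
have h0 := is_derive_sqr_pos_part s; have h1 := h 2^-1; have h2 := h 1.
rewrite /step /dstep; apply: is_derive_eq; rewrite /GRing.scale/=.
move: (pos_part s) (pos_part (s - 2^-1)) (pos_part (s - 1)) => x y z; ring.
Qed.

Lemma continuous_dstep : continuous dstep.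
Proof.
have h c s : {for s, continuous (fun t => pos_part (t - c))}.
  apply: (@continuous_comp _ _ _ (fun t : R => t - c) pos_part); last exact: continuous_pos_part.
  by apply: cvgB; [exact: cvg_id|exact: cvg_cst].
move=> s; apply: cvgD; last by apply: cvgM; [exact: cvg_cst|exact: h].
apply: cvgB; apply: cvgM; try exact: cvg_cst; [exact: continuous_pos_part|exact: h].
Qed.

Lemma step_le0 s : s <= 0 -> step s = 0.
Proof.
move=> s0; rewrite /step.
have [[-> ?]|[-> ?]] := pos_partE s; have [[-> ?]|[-> ?]] := pos_partE (s - 2^-1);
have [[-> ?]|[-> ?]] := pos_partE (s - 1); nra.
Qed.

Lemma step_ge1 s : 1 <= s -> step s = 1.
Proof.
move=> s0; rewrite /step.
have [[-> ?]|[-> ?]] := pos_partE s; have [[-> ?]|[-> ?]] := pos_partE (s - 2^-1);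
have [[-> ?]|[-> ?]] := pos_partE (s - 1); first [lra | have -> : s = 1 by lra]; by field.
Qed.

Lemma step_itv s : 0 <= step s <= 1.
Proof.
rewrite /step.
have [[-> ?]|[-> ?]] := pos_partE s; have [[-> ?]|[-> ?]] := pos_partE (s - 2^-1);
have [[-> ?]|[-> ?]] := pos_partE (s - 1); apply/andP; split; nra.
Qed.

Lemma dstep_itv s : 0 <= dstep s <= 2.
Proof.
rewrite /dstep.
have [[-> ?]|[-> ?]] := pos_partE s; have [[-> ?]|[-> ?]] := pos_partE (s - 2^-1);
have [[-> ?]|[-> ?]] := pos_partE (s - 1); apply/andP; split; lra.
Qed.

Lemma dstep_eq0 s : s <= 0 \/ 1 <= s -> dstep s = 0.
Proof.
rewrite /dstep => -[] ?.
all: have [[-> ?]|[-> ?]] := pos_partE s; have [[-> ?]|[-> ?]] := pos_partE (s - 2^-1);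
have [[-> ?]|[-> ?]] := pos_partE (s - 1); lra.
Qed.

Lemma derive_ge0_le (f df : R -> R) (a b : R) : a <= b ->
  (forall t, a <= t <= b -> is_derive t 1 f (df t)) ->
  (forall t, a <= t <= b -> 0 <= df t) -> f a <= f b.
Proof.
move=> ab fD f0; have [| |c ci e] := @MVT_segment R f df a b ab.
- by move=> x; rewrite in_itv/= => /andP[ax xb]; apply: fD; rewrite !ltW.
- apply: derivable_within_continuous => x; rewrite in_itv/= => xi.
  exact: @ex_derive _ _ _ _ _ _ _ (fD x xi).
- by rewrite -subr_ge0 e mulr_ge0 ?subr_ge0// f0//; rewrite in_itv/= in ci.
Qed.

(** Used for the fundamental solution, whose closed form turns from a power into a logarithm when
    [n = 1]. *)
Lemma antiderivative (h : R -> R) : continuous h ->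
  exists F : R -> R, forall t : R, 0 < t -> is_derive t 1 F (h t).
Proof.
move=> hc; exists (fun x => \int[@lebesgue_measure R]_(t in `[0, x]) h t)%R => t t0.
have tu : t < t + 1 by rewrite ltrDl.
have hi : (@lebesgue_measure R).-integrable `[0, t + 1] (EFin \o h).
  apply: continuous_compact_integrable; first exact: segment_compact.
  exact: continuous_subspaceT.
have [d e] := continuous_FTC1_closed tu hi t0 (hc t).
by apply: (DeriveDef d); rewrite -derive1E.
Qed.

End Step.

(** * Radial profiles as functions of the inverse distance *)

Section Profiles.
Variables (R : realType) (n : nat).
Hypothesis n0 : (0 < n)%N.
Variable rr : R.
Hypothesis rr0 : 0 < rr.
Implicit Types (t : R).

(** The variable is an inverse distance: [cut] is 1 within distance [rr / 2] and 0 beyond [rr].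
    [cut2] is the same for twice the radius, hence 1 wherever [cut] is nonzero. *)
Definition cut t : R := step (rr * t - 1).
Definition cut2 t : R := step (2 * rr * t - 1).
(** In dimension [n.+1], the field [t^(n+1) (x - y)] is, up to a constant, the gradient of the
    fundamental solution. *)
Definition green_pole t : R := t ^+ n.+1 * cut t.
Definition dgreen_pole t : R :=
  n.+1%:R * t ^+ n * cut t + t ^+ n.+1 * (rr * dstep (rr * t - 1)).
(** The kernel [|x - y|^(1-n)], truncated at the doubled radius. *)
Definition riesz t : R := t ^+ n.-1 * cut2 t.
Definition driesz t : R :=
  n.-1%:R * t ^+ n.-2 * cut2 t + t ^+ n.-1 * (2 * rr * dstep (2 * rr * t - 1)).

Lemma is_derive_step_scale c t : is_derive t 1 (fun s => step (c * s - 1)) (c * dstep (c * t - 1)).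
Proof.
have hc : is_derive t 1 (fun s : R => c * s - 1) c.
  by apply: is_derive_eq; rewrite /GRing.scale/=; ring.
have := @is_derive1_comp _ (@step R) (fun s => c * s - 1) t _ _ (is_derive_step _) hc.
by rewrite mulrC.
Qed.

Lemma is_derive_powerM (m : nat) (f : R -> R) df t : is_derive t 1 f df ->
  is_derive t 1 (fun s => s ^+ m * f s) (m%:R * t ^+ m.-1 * f t + t ^+ m * df).
Proof.
move=> h; have hp : is_derive t 1 (fun s : R => s ^+ m) (m%:R * t ^+ m.-1).
  have := is_derive_poly ('X^m : {poly R}) t; rewrite derivXn hornerMn hornerXn mulr_natl.
  by rewrite (_ : horner 'X^m = (fun s : R => s ^+ m))//; apply/funext => s; rewrite hornerXn.
have := is_deriveM hp h; rewrite /GRing.scale/= => hm.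
by apply: is_derive_eq; rewrite addrC [f t * _]mulrC.
Qed.

Lemma is_derive_green_pole t : is_derive t 1 green_pole (dgreen_pole t).
Proof. exact: is_derive_powerM (is_derive_step_scale _ _). Qed.

Lemma is_derive_riesz t : is_derive t 1 riesz (driesz t).
Proof. exact: is_derive_powerM (is_derive_step_scale _ _). Qed.

Lemma continuous_step_scale c : continuous (fun t : R => step (c * t - 1)).
Proof.
move=> t; apply: differentiable_continuous; apply/derivable1_diffP.
exact: @ex_derive _ _ _ _ _ _ _ (is_derive_step_scale c t).
Qed.

Lemma continuous_dstep_scale c : continuous (fun t : R => dstep (c * t - 1)).
Proof.
move=> t; apply: (@continuous_comp _ _ _ (fun t : R => c * t - 1) (@dstep R)); last exact: continuous_dstep.
by apply: cvgB; [apply: cvgM; [exact: cvg_cst|exact: cvg_id]|exact: cvg_cst].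
Qed.

Lemma continuous_dgreen_pole : continuous dgreen_pole.
Proof.
move=> t; apply: cvgD; apply: cvgM.
- by apply: cvgM; [exact: cvg_cst|exact: exprn_continuous].
- exact: continuous_step_scale.
- exact: exprn_continuous.
- by apply: cvgM; [exact: cvg_cst|exact: continuous_dstep_scale].
Qed.

Lemma continuous_driesz : continuous driesz.
Proof.
move=> t; apply: cvgD; apply: cvgM.
- by apply: cvgM; [exact: cvg_cst|exact: exprn_continuous].
- exact: continuous_step_scale.
- exact: exprn_continuous.
- by apply: cvgM; [exact: cvg_cst|exact: continuous_dstep_scale].
Qed.

Lemma cut_itv t : 0 <= cut t <= 1. Proof. exact: step_itv. Qed.
Lemma cut2_itv t : 0 <= cut2 t <= 1. Proof. exact: step_itv. Qed.

Lemma cut_eq0 t : rr * t <= 1 -> cut t = 0.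
Proof. by move=> h; apply: step_le0; rewrite subr_le0. Qed.

Lemma cut_eq1 t : 2 <= rr * t -> cut t = 1.
Proof. by move=> h; apply: step_ge1; lra. Qed.

Lemma cut2_eq0 t : 2 * rr * t <= 1 -> cut2 t = 0.
Proof. by move=> h; apply: step_le0; rewrite subr_le0. Qed.

Lemma cut_le_cut2 t : cut t <= cut2 t.
Proof.
have /andP[a0 a1] := cut_itv t; have /andP[b0 b1] := cut2_itv t.
have [h|/ltW h] := leP (rr * t) 1; first by rewrite cut_eq0.
by rewrite /cut2 step_ge1//; lra.
Qed.

Lemma sqr_cut_le_cut2 t : cut t != 0 -> cut2 t = 1.
Proof.
have [h|/ltW h] := leP (rr * t) 1; first by rewrite cut_eq0 ?eqxx.
by move=> _; rewrite /cut2 step_ge1//; lra.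
Qed.

(** For [t > 0] this is [t^(n-2) * cut t]. Bounding the denominator below by [1/rr] gives a
    continuous function on the whole line also for [n = 1]; the numerator vanishes where that bound
    is active. *)
Definition dgreen t : R := t ^+ n.-1 * cut t / Num.max t rr^-1.

Lemma dgreenE t : 0 < t -> dgreen t = t ^+ n.-1 * cut t / t.
Proof.
move=> t0; have [h|h] := leP (rr * t) 1.
  by rewrite /dgreen cut_eq0// mulr0 !mul0r.
rewrite /dgreen; have -> // : Num.max t rr^-1 = t.
by apply/max_idPl; rewrite -(ler_pM2l rr0) divff ?gt_eqF// ltW.
Qed.

Lemma dgreen_mul_sqr t : 0 < t -> dgreen t * t ^+ 2 = t ^+ n * cut t.
Proof.
move=> t0; rewrite dgreenE// -[in t ^+ n](prednK n0) [in RHS]exprS; field.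
by rewrite gt_eqF.
Qed.

Lemma continuous_dgreen : continuous dgreen.
Proof.
move=> t; have m0 : 0 < Num.max t rr^-1 by rewrite lt_max invr_gt0 rr0 orbT.
apply: cvgM.
  by apply: cvgM; [exact: exprn_continuous|exact: continuous_step_scale].
apply: cvgV; first by rewrite gt_eqF.
by apply: (@continuous_max R R id (fun=> rr^-1)); [exact: cvg_id|exact: cvg_cst].
Qed.

(** [green] is the primitive of [dgreen] vanishing at [1/rr], a truncated fundamental solution. The
    last clause lets a gradient term weighted by [green] absorb the error of freezing the
    coefficients, in [gradient_absorption]; it holds because the difference of both sides is
    nondecreasing beyond [1/rr]. *)
Lemma green_exists : exists green : R -> R,
  [/\ forall t, 0 < t -> is_derive t 1 green (dgreen t),
      forall t, 0 < t -> rr * t <= 1 -> green t = 0,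
      forall t, 0 < t -> 0 <= green t &
      forall t, 0 < t -> t ^+ n.-1 * cut t ^+ 2 <= (n%:R + 8) * green t].
Proof.
have [F FD] := antiderivative continuous_dgreen.
have b0 : 0 < rr^-1 by rewrite invr_gt0.
have rb : rr * rr^-1 = 1 by rewrite divff ?gt_eqF.
pose f t := F t - F rr^-1.
have fD t : 0 < t -> is_derive t 1 f (dgreen t).
  by move=> /FD h; apply: is_derive_eq; rewrite subr0.
have f0 t : 0 < t -> rr * t <= 1 -> f t = 0.
  move=> t0 rt; have tb : t <= rr^-1 by rewrite -(ler_pM2l rr0) rb.
  have z s : t <= s <= rr^-1 -> dgreen s = 0.
    by move=> /andP[_ sb]; rewrite /dgreen cut_eq0 ?mulr0 ?mul0r// -rb ler_pM2l.
  have pos s : t <= s <= rr^-1 -> 0 < s by move=> /andP[/(lt_le_trans t0)].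
  have h1 : f t <= f rr^-1.
    by apply: (derive_ge0_le tb (fun s sb => fD s (pos s sb))) => s /z ->.
  have h2 : - f t <= - f rr^-1.
    apply: (@derive_ge0_le _ (fun s => - f s) (fun s => - dgreen s) _ _ tb).
      by move=> s /pos /fD h; apply: is_derive_eq.
    by move=> s /z ->; rewrite oppr0.
  by move: h1 h2; rewrite lerN2 {2 3}/f subrr => h1 h2; apply/eqP; rewrite eq_le h1.
exists f; split=> //.
  move=> t t0; have [h|h] := leP (rr * t) 1; first by rewrite f0.
  have bt : rr^-1 <= t by rewrite -(ler_pM2l rr0) rb ltW.
  rewrite -(f0 rr^-1 b0); last by rewrite rb.
  apply: (derive_ge0_le bt (fun s sb => fD s (lt_le_trans b0 (proj1 (andP sb))))) => s /andP[bs _].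
  have s0 := lt_le_trans b0 bs; have /andP[c0 _] := cut_itv s.
  by rewrite dgreenE// divr_ge0 ?(ltW s0)// mulr_ge0// exprn_ge0// ltW.
move=> t t0; have [h|h] := leP (rr * t) 1; first by rewrite f0// cut_eq0// expr0n !mulr0.
have bt : rr^-1 <= t by rewrite -(ler_pM2l rr0) rb ltW.
pose Phi s := (n%:R + 8) * f s - s ^+ n.-1 * cut s ^+ 2.
pose dPhi s := (n%:R + 8) * dgreen s - (n.-1%:R * s ^+ n.-2 * cut s ^+ 2
  + s ^+ n.-1 * (2 * cut s * (rr * dstep (rr * s - 1)))).
rewrite -subr_ge0 -/(Phi t).
have -> : 0 = Phi rr^-1.
  by rewrite /Phi f0 ?cut_eq0 ?rb// expr0n !mulr0 subrr.
apply: (@derive_ge0_le _ Phi dPhi _ _ bt) => s /andP[bs _]; have s0 := lt_le_trans b0 bs.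
  have h1 := fD s s0; have h2 := is_derive_step_scale rr s.
  have h3 : is_derive s 1 (fun s => cut s ^+ 2) (2 * cut s * (rr * dstep (rr * s - 1))).
    have := is_deriveM h2 h2; rewrite /GRing.scale/= => hm.
    have -> : (fun s => cut s ^+ 2) = (fun s => step (rr * s - 1)) * (fun s => step (rr * s - 1)).
      by apply/funext => x; rewrite /cut expr2.
    apply: is_derive_eq; rewrite /cut; ring.
  have h4 := is_derive_powerM n.-1 h3.
  have h5 := is_deriveZ (n%:R + 8) h1.
  exact: is_deriveB h5 h4.
have /andP[c0 c1] := cut_itv s.
have rs1 : 1 <= rr * s by rewrite -rb ler_pM2l.
(* [dstep] is at most 2 and vanishes once [rr * s >= 2]; twice this 4 is the 8 of the constant
   [n + 8]. *)
have dst : rr * s * dstep (rr * s - 1) <= 4.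
  have /andP[d0 d2] := dstep_itv (rr * s - 1).
  have [h2|/ltW h2] := leP (rr * s) 2; last by rewrite dstep_eq0 ?mulr0//; right; lra.
  have -> : (4 : R) = 2 * 2 by ring.
  by apply: ler_pM => //; rewrite mulr_ge0// ltW.
have -> : dPhi s = s ^+ n.-1 * cut s / s *
    (n%:R + 8 - n.-1%:R * cut s - 2 * (rr * s * dstep (rr * s - 1))).
  rewrite /dPhi dgreenE//; have : n.-1%:R * s ^+ n.-2 = n.-1%:R * (s ^+ n.-1 / s) :> R.
    case: n.-1 => [|k]; first by rewrite !mul0r.
    by rewrite /= exprSr mulfK// gt_eqF.
  by move=> ->; field; rewrite gt_eqF.
apply: mulr_ge0; first by rewrite divr_ge0 ?(ltW s0)// mulr_ge0// exprn_ge0// ltW.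
have : n.-1%:R * cut s <= n%:R.
  by rewrite (@le_trans _ _ n.-1%:R)// ?ler_piMr// ler_nat leq_pred.
lra.
Qed.

Variable eta : R.

(** The divergence that the regularisation gives to the otherwise divergence-free field
    [t^(n+1) (x - y)]: a Dirac mass smoothed at width [eta] and cut off. *)
Definition core t : R := n.+1%:R * eta ^+ 2 * t ^+ n.+3 * cut t.

Lemma rr_pow_le (m : nat) t : 0 < t -> rr * t <= 2 -> t ^+ m <= 2 ^+ m * rr ^- m.
Proof.
move=> t0 rt; rewrite ler_pdivlMr ?exprn_gt0// -exprMn mulrC.
by apply: lerXn2r; rewrite ?nnegrE// mulr_ge0 ?ltW.
Qed.

(** The power [n + 1] annihilates the main part of [radial_div]. What is left is the regularisation
    defect [core] and the derivative of the cutoff, supported at distances comparable to [rr]. *)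
Lemma radial_div_green_pole t : 0 < t -> 0 <= eta * t <= 1 ->
  core t - 2 ^+ n.+3 * rr ^- n.+1 * (1 <= rr * t)%R%:R <= radial_div n eta green_pole dgreen_pole t.
Proof.
move=> t0 /andP[e0 e1].
have -> : radial_div n eta green_pole dgreen_pole t = core t
    - rr * t * t ^+ n.+1 * dstep (rr * t - 1) * (1 - (eta * t) ^+ 2).
  by rewrite /radial_div /green_pole /dgreen_pole /core !exprS; ring.
rewrite lerD2l lerN2; have /andP[d0 d2] := dstep_itv (rr * t - 1).
have s0 : 0 <= 1 - (eta * t) ^+ 2 by rewrite subr_ge0 expr_le1.
have s1 : 1 - (eta * t) ^+ 2 <= 1 by rewrite lerBlDr lerDl sqr_ge0.
have t1 : 0 <= rr * t by rewrite mulr_ge0 ?ltW.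
have tn : 0 <= t ^+ n.+1 by rewrite exprn_ge0// ltW.
have [h|h] := ltP (rr * t) 1.
  by rewrite dstep_eq0 ?mulr0 ?mul0r//; left; lra.
have [h2|/ltW h2] := leP (rr * t) 2; last first.
  rewrite dstep_eq0; last by right; lra.
  by rewrite mulr0 mul0r mulr1 divr_ge0 ?exprn_ge0// ltW.
rewrite mulr1; have g0 : 0 <= rr * t * t ^+ n.+1 * dstep (rr * t - 1).
  by apply: mulr_ge0 => //; exact: mulr_ge0.
rewrite (le_trans (ler_piMr g0 s1))//.
have -> : 2 ^+ n.+3 * rr ^- n.+1 = 2 * (2 ^+ n.+1 * rr ^- n.+1) * 2 by rewrite !exprS; ring.
apply: ler_pM => //; first by rewrite mulr_ge0.
by apply: ler_pM => //; exact: rr_pow_le.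
Qed.

(** Turned round, [green] is at most a divergence plus [riesz], which bounds its average without
    integrating a singular function. *)
Lemma radial_div_green green t : 0 < t -> 0 <= eta * t <= 1 -> 0 <= green t ->
  green t - riesz t <= radial_div n eta green dgreen t.
Proof.
move=> t0 /andP[e0 e1] f0; rewrite /radial_div dgreenE// divfK ?gt_eqF//.
have tn : 0 <= t ^+ n.-1 by rewrite exprn_ge0// ltW.
have /andP[c0 c1] := cut_itv t.
have s1 : 1 - (eta * t) ^+ 2 <= 1 by rewrite lerBlDr lerDl sqr_ge0.
apply: lerB; first by rewrite ler_peMl// ler1n.
have h0 : 0 <= t ^+ n.-1 * cut t by rewrite mulr_ge0.
rewrite (le_trans (ler_piMr h0 s1))// ler_wpM2l//; exact: cut_le_cut2.
Qed.

(** Likewise [riesz] is at most half a divergence plus a constant on a ball of radius [2 rr],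
    because [n + 1] exceeds [n - 1] by 2. The constant [rr^2 / rr^(n+1)] times the volume of the
    ball has the size [rr^2] of the integral of the kernel. *)
Lemma radial_div_riesz t : 0 < t -> 0 <= eta * t <= 1 ->
  2 * riesz t - 4 * (rr ^+ 2 * rr ^- n.+1) * (1 <= 2 * rr * t)%R%:R
  <= radial_div n eta riesz driesz t.
Proof.
move=> t0 /andP[e0 e1]; set s := 1 - (eta * t) ^+ 2.
have s0 : 0 <= s by rewrite subr_ge0 expr_le1.
have s1 : s <= 1 by rewrite lerBlDr lerDl sqr_ge0.
have tn : 0 <= t ^+ n.-1 by rewrite exprn_ge0// ltW.
have /andP[c0 c1] := cut2_itv t; have /andP[d0 d2] := dstep_itv (2 * rr * t - 1).
have t1 : 0 <= rr * t by rewrite mulr_ge0 ?ltW.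
have -> : radial_div n eta riesz driesz t =
   (n.+1%:R - n.-1%:R * s) * riesz t - 2 * t ^+ n.-1 * (rr * t) * dstep (2 * rr * t - 1) * s.
  rewrite /radial_div -/s /driesz /riesz.
  have : n.-1%:R * t ^+ n.-2 * t = n.-1%:R * t ^+ n.-1 :> R.
    by case: n.-1 => [|k]; rewrite ?mul0r// -mulrA -exprSr.
  move: (n.-1%:R * t ^+ n.-2) => q qE.
  have -> : (q * cut2 t + t ^+ n.-1 * (2 * rr * dstep (2 * rr * t - 1))) * t =
    (q * t) * cut2 t + t ^+ n.-1 * (2 * rr * dstep (2 * rr * t - 1)) * t by ring.
  by rewrite qE; ring.
apply: lerB.
  rewrite ler_wpM2r ?mulr_ge0//.
  have : n.-1%:R * s <= n.-1%:R by rewrite ler_piMr.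
  have : n.+1%:R = n.-1%:R + 2 :> R by rewrite -{1}(prednK n0) -natrD addn2.
  lra.
have g0 : 0 <= 2 * t ^+ n.-1 * (rr * t) * dstep (2 * rr * t - 1).
  by apply: mulr_ge0 => //; apply: mulr_ge0 => //; exact: mulr_ge0.
rewrite (le_trans (ler_piMr g0 s1))//.
have [h|h] := ltP (2 * rr * t) 1.
  by rewrite dstep_eq0 ?mulr0//; left; lra.
rewrite mulr1; have [h2|/ltW h2] := leP (rr * t) 1; last first.
  rewrite dstep_eq0; last by right; lra.
  by rewrite mulr0 mulr_ge0// divr_ge0 ?exprn_ge0// ltW.
have -> : 4 * (rr ^+ 2 * rr ^- n.+1) = 2 * rr ^- n.-1 * 1 * 2.
  have -> : rr ^+ 2 * rr ^- n.+1 = rr ^- n.-1.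
    rewrite -[in rr ^+ n.+1](prednK n0) !exprS expr0.
    have q0 : rr ^+ n.-1 != 0 by rewrite gt_eqF// exprn_gt0.
    by move: (rr ^+ n.-1) q0 => q q0; field; rewrite q0 gt_eqF.
  ring.
apply: ler_pM => //; first by apply: mulr_ge0 => //; exact: mulr_ge0.
apply: ler_pM => //; first exact: mulr_ge0.
rewrite ler_wpM2l// -[leRHS]mul1r ler_pdivlMr ?exprn_gt0// -exprMn mulrC.
by rewrite exprn_ile1// mulrC.
Qed.

End Profiles.

(** * A mean value inequality at the maximum *)

Section MeanValue.
Variables (R : realType) (n : nat).
Local Notation vec := 'rV[R]_n.+1.
Local Notation H := (@half_space R n).
Implicit Types (k l : 'I_n.+1) (x y z : vec) (t : R).
Variables (V : set vec) (a : vec) (L : R) (G : vec -> 'M[R]_n.+1) (rho : vec -> R) (M : R).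
Hypothesis E : elliptic V a L G rho M.
Variables (lam : R) (v : vec -> R).
Hypothesis S : solution V G rho lam v.
Hypothesis n0 : (0 < n)%N.
Variable x0 : vec.
Hypothesis cx0 : cube a L x0.
Variables (eta rr : R).
Hypotheses (eta0 : 0 < eta) (rr0 : 0 < rr).
Hypothesis outer : forall x, cube a L x -> outer_face a L x -> 2 * rr * near_tau G x0 eta x <= 1.
Hypothesis vmax : forall x, cube a L x -> v x ^+ 2 <= v x0 ^+ 2.

Local Notation p := (conormal G v).
Local Notation xi := (differential v).
Local Notation A := (Amx G x0).
Local Notation x0' := (mirror G x0).
Local Notation t1 := (near_tau G x0 eta).
Local Notation t2 := (far_tau G x0 eta).
Local Notation W := (v x0 ^+ 2).

Let VH : V `<=` H := rel_open_sub (el_open E).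

Lemma far_tau_gt0' x : 0 < t2 x. Proof. exact: (far_tau_gt0 E cx0 eta0). Qed.
Lemma near_tau_gt0' x : 0 < t1 x. Proof. exact: (near_tau_gt0 E cx0 eta0). Qed.
Lemma outer_far x : cube a L x -> outer_face a L x -> 2 * rr * t2 x <= 1.
Proof.
move=> cx ox; rewrite (le_trans _ (outer cx ox))// ler_wpM2l ?mulr_ge0 ?(ltW rr0)//.
exact: (far_tau_le E cx0 eta0 (el_half_space E cx)).
Qed.

Lemma null_div_mirror_field phi dphi :
  (forall t : R, 0 < t -> is_derive t 1 phi (dphi t)) ->
  (forall t : R, 0 < t -> {for t, continuous dphi}) ->
  (forall t : R, 0 < t -> 2 * rr * t <= 1 -> phi t = 0) ->
  null a L (fun x => radial_div n eta phi dphi (t1 x) + radial_div n eta phi dphi (t2 x)).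
Proof.
move=> phiD phiC phi0.
have ZC := Ck1_mirror_field E cx0 eta0 phiD phiC.
have Zo x k : cube a L x -> outer_face a L x -> mirror_field G x0 eta phi k x = 0.
  move=> cx ox; rewrite /mirror_field /radial_field -/(t1 x) -/(t2 x).
  rewrite (phi0 _ (near_tau_gt0' x) (outer cx ox)) (phi0 _ (far_tau_gt0' x) (outer_far cx ox)).
  by rewrite !mul0r addr0.
have Z0 x : V x -> x 0 0 = 0 -> mirror_field G x0 eta phi 0 x = 0.
  by move=> _; exact: (mirror_field_tangent (el_cube E) (el_sym E) (el_M1 E) (el_ell E)).
have N := null_divergence (el_open E) (el_side E) (el_cube E) ZC (Ck1_cst VH 1) Zo Z0.
apply: (eq_null (el_side E) _ N) => x cx; have Hx := el_half_space E cx.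
rewrite mul1r (div_mirror_field E cx0 eta0 phiD Hx) [X in _ + X]big1 ?addr0// => k _.
by rewrite (pderivE Hx (has_pderiv_cst _ _ _)) mulr0.
Qed.

Variable green : R -> R.
Hypothesis greenD : forall t : R, 0 < t -> is_derive t 1 green (dgreen n rr t).
Hypothesis green_cut : forall t : R, 0 < t -> rr * t <= 1 -> green t = 0.
Hypothesis green_ge0 : forall t : R, 0 < t -> 0 <= green t.
Hypothesis green_ge : forall t : R, 0 < t -> t ^+ n.-1 * cut rr t ^+ 2 <= (n%:R + 8) * green t.

Local Notation g := (green_pole n rr).
Local Notation dg := (dgreen_pole n rr).
Local Notation zeta := (riesz n rr).
Local Notation dzeta := (driesz n rr).
Local Notation df := (dgreen n rr).
Local Notation del x := (xi x *m (G x - Bmx G x0)).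

Definition Psi x : R := green (t1 x) + green (t2 x).

(** The divergence of [v^2] times [mirror_field g], which is minus the gradient of [Psi] at frozen
    coefficients, plus the equation tested with [2 Psi v]. The first order terms cancel up to the
    last line, the error of freezing, and [Psi] is differentiated only once. *)
Definition mean_value_integrand x : R :=
  v x ^+ 2 * (radial_div n eta g dg (t1 x) + radial_div n eta g dg (t2 x))
  - 2 * lam ^+ 2 * rho x * v x ^+ 2 * Psi x
  + 2 * Psi x * dot (p x) (xi x)
  - (2 * v x * (g (t1 x) * dot (adist A x0 x) (del x))
     + 2 * v x * (g (t2 x) * dot (adist A x0' x) (del x))).

Lemma half_cut t : 0 < t -> 2 * rr * t <= 1 -> rr * t <= 1.
Proof. by move=> t0; have := mulr_ge0 (ltW rr0) (ltW t0); lra. Qed.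

Lemma null_mean_value : null a L mean_value_integrand.
Proof.
have gD (t : R) : 0 < t -> is_derive t 1 g (dg t) by move=> _; exact: is_derive_green_pole.
have gC (t : R) : 0 < t -> {for t, continuous dg} by move=> _; exact: continuous_dgreen_pole.
have fC (t : R) : 0 < t -> {for t, continuous df} by move=> _; exact: continuous_dgreen.
have g0 (t : R) : 0 < t -> 2 * rr * t <= 1 -> g t = 0.
  by move=> t0 /(half_cut t0) h; rewrite /green_pole cut_eq0 ?mulr0.
have ZC := Ck1_mirror_field E cx0 eta0 gD gC.
have Zo x k : cube a L x -> outer_face a L x -> mirror_field G x0 eta g k x = 0.
  move=> cx ox; rewrite /mirror_field /radial_field -/(t1 x) -/(t2 x).
  rewrite (g0 _ (near_tau_gt0' x) (outer cx ox)) (g0 _ (far_tau_gt0' x) (outer_far cx ox)).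
  by rewrite !mul0r addr0.
have Z0 x : V x -> x 0 0 = 0 -> mirror_field G x0 eta g 0 x = 0.
  by move=> _; exact: (mirror_field_tangent (el_cube E) (el_sym E) (el_M1 E) (el_ell E)).
have vC := Ck1_solution (sol_C S).
have v2C : Ck 1 V (fun x => v x * v x) by exact: Ck1M.
have N1 := null_divergence (el_open E) (el_side E) (el_cube E) ZC v2C Zo Z0.
have PC : Ck 1 V Psi.
  by apply: Ck1D => //; [exact: (Ck1_near_radial E cx0 eta0 greenD fC)
                        |exact: (Ck1_far_radial E cx0 eta0 greenD fC)].
have PvC : Ck 1 V (fun x => 2 * (Psi x * v x)) by apply: Ck1Z => //; exact: Ck1M.
have Po x : cube a L x -> outer_face a L x -> 2 * (Psi x * v x) = 0.
  move=> cx ox; rewrite /Psi.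
  rewrite (green_cut (near_tau_gt0' x) (half_cut (near_tau_gt0' x) (outer cx ox))).
  rewrite (green_cut (far_tau_gt0' x) (half_cut (far_tau_gt0' x) (outer_far cx ox))).
  by rewrite addr0 mul0r mulr0.
have P0 x : V x -> x 0 0 = 0 -> 2 * (Psi x * v x) * p x 0 0 = 0.
  by move=> Vx xb; have [h|h] := sol_bc S; rewrite h// ?mulr0 ?mul0r.
have N2 := null_conormal_flux (el_open E) (el_side E) (el_cube E) (el_GC E) (sol_C S) (sol_eq S)
  PvC Po P0.
apply: (eq_null (el_side E) _ (nullD N1 N2)) => x cx; have Hx := el_half_space E cx.
have Vx := el_cube E cx.
rewrite (div_mirror_field E cx0 eta0 gD Hx).
have hv k := Ck_has_pderiv (k := k) vC Vx.
have dv2 k : pderiv (fun x => v x * v x) k x = 2 * (v x * xi x 0 k).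
  by rewrite (pderivE Hx (has_pderivM (hv k) (hv k))) mxE; ring.
have dPsi k : has_pderiv Psi k x (- (g (t1 x) * adist A x0 x 0 k + g (t2 x) * adist A x0' x 0 k)).
  have h := has_pderivD (@has_pderiv_near_radial _ _ _ _ _ _ _ _ E _ cx0 _ eta0 _ _ greenD k x)
    (@has_pderiv_far_radial _ _ _ _ _ _ _ _ E _ cx0 _ eta0 _ _ greenD k x).
  (* [dgreen] is made so that the differential of [green (t)] is exactly [- g (t)] times [adist]. *)
  have e (t : R) : 0 < t -> df t * t ^+ 3 = g t.
    by move=> t0; rewrite exprSr mulrA (dgreen_mul_sqr n0 rr0 t0) /green_pole exprSr; ring.
  by move: h; rewrite (e _ (near_tau_gt0' x)) (e _ (far_tau_gt0' x)) -opprD.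
have dPv k : pderiv (fun x => 2 * (Psi x * v x)) k x =
    2 * Psi x * xi x 0 k - 2 * v x * (g (t1 x) * adist A x0 x 0 k + g (t2 x) * adist A x0' x 0 k).
  rewrite (pderivE Hx (has_pderivZ (c := 2) (has_pderivM (dPsi k) (hv k)))).
  have -> : pderiv v k x = xi x 0 k by rewrite [RHS]mxE.
  ring.
have -> : \sum_k pderiv (fun x => 2 * (Psi x * v x)) k x * p x 0 k =
    2 * Psi x * dot (p x) (xi x) - 2 * v x * (g (t1 x) * dot (adist A x0 x) (p x)
      + g (t2 x) * dot (adist A x0' x) (p x)).
  rewrite /dot !mulr_sumr -big_split/= mulr_sumr -sumrB; apply: eq_bigr => k _.
  rewrite dPv; ring.
have -> : \sum_k mirror_field G x0 eta g k x * pderiv (fun x => v x * v x) k x =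
    2 * v x * (g (t1 x) * dot (x - x0) (xi x) + g (t2 x) * dot (x - x0') (xi x)).
  rewrite /dot !mulr_sumr -big_split/= mulr_sumr; apply: eq_bigr => k _.
  by rewrite dv2 /mirror_field /radial_field -/(t1 x) -/(t2 x); ring.
have da y : dot (adist A y x) (p x) = dot (x - y) (xi x) + dot (adist A y x) (del x).
  by rewrite (conormal_split G v x0) dotDr (center_adist_conormal E _ cx0).
rewrite !da /mean_value_integrand; ring.
Qed.

(** A weighted arithmetic-geometric inequality. The weight [al] is tuned so that, through
    [green_ge], the gradient part is exactly what [2 * Psi * dot (p x) (xi x)] can pay for by
    ellipticity. *)
Lemma gradient_absorption y x (t := rtau A eta y x) : cube a L x -> t <= t1 x ->
  2 * v x * (g t * dot (adist A y x) (del x)) <=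
  2 * green t * (grad_norm v x ^+ 2 / M) + M ^+ 13 * (n%:R + 8) / 2 * v x ^+ 2 * zeta t.
Proof.
move=> cx tle; have t0 : 0 < t by exact: (rtau_gt0 eta0 (A_ge0' E cx0)).
have M0 := M_gt0 E; set r := grad_norm v x; have r0 : 0 <= r := grad_norm_ge0 v x.
have f0 := green_ge0 t0; have tn : 0 <= t ^+ n.-1 by rewrite exprn_ge0// ltW.
have /andP[z0 z1] := cut2_itv rr t; have /andP[c0 c1] := cut_itv rr t.
have C0 : 0 < n%:R + 8 :> R by rewrite ltr_wpDl.
have rhs0 : 0 <= 2 * green t * (r ^+ 2 / M) + M ^+ 13 * (n%:R + 8) / 2 * v x ^+ 2 * zeta t.
  apply: addr_ge0; first by apply: mulr_ge0; [exact: mulr_ge0|rewrite divr_ge0 ?sqr_ge0// ltW].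
  apply: mulr_ge0; last exact: mulr_ge0.
  apply: mulr_ge0; last exact: sqr_ge0.
  apply: divr_ge0 => //; apply: mulr_ge0; last exact: ltW.
  by rewrite exprn_ge0// ltW.
have [cE|cn] := eqVneq (cut rr t) 0.
  by rewrite /green_pole cE mulr0 mul0r mulr0.
have zE : zeta t = t ^+ n.-1 by rewrite /riesz sqr_cut_le_cut2// mulr1.
have b : `|t ^+ 2 * dot (adist A y x) (del x)| <= M ^+ 6 * r.
  have -> : t ^+ 2 * dot (adist A y x) (del x) = dot (t *: adist A y x) (t *: del x).
    by rewrite dotZl dotZr; ring.
  have -> : M ^+ 6 * r = M * (M * (M ^+ 4 * r)) by ring.
  apply: (norm_dot_le E) => k; rewrite mxE normrM gtr0_norm//.
    exact: (center_adist E cx0 eta0).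
  exact: (center_delta E v cx0 eta0 cx tle).
have -> : 2 * v x * (g t * dot (adist A y x) (del x)) =
    2 * (t ^+ n.-1 * cut rr t) * (v x * (t ^+ 2 * dot (adist A y x) (del x))).
  have -> : g t = t ^+ n.-1 * t ^+ 2 * cut rr t.
    by rewrite /green_pole -exprD addn2 prednK.
  ring.
apply: (@le_trans _ _ (2 * (t ^+ n.-1 * cut rr t) * (`|v x| * (M ^+ 6 * r)))).
  apply: ler_wpM2l; first by apply: mulr_ge0 => //; exact: mulr_ge0.
  by rewrite (le_trans (ler_norm _))// normrM ler_wpM2l.
rewrite zE; pose al := 2 / (M * (n%:R + 8)).
have al0 : 0 < al by rewrite divr_gt0// mulr_gt0.
have -> : 2 * (t ^+ n.-1 * cut rr t) * (`|v x| * (M ^+ 6 * r)) =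
    t ^+ n.-1 * (2 * (cut rr t * r) * (M ^+ 6 * `|v x|)) by ring.
have amgm : 2 * (cut rr t * r) * (M ^+ 6 * `|v x|) <=
    al * (cut rr t ^+ 2 * r ^+ 2) + M ^+ 12 * v x ^+ 2 / al.
  have := sqr_ge0 (al * (cut rr t * r) - M ^+ 6 * `|v x|); rewrite -(pmulr_rge0 _ al0).
  move=> _; have := sqr_ge0 (al * (cut rr t * r) - M ^+ 6 * `|v x|).
  have ial : 0 < al^-1 by rewrite invr_gt0.
  rewrite -(pmulr_rge0 _ ial) -(real_normK (num_real (v x))).
  have -> : al^-1 * (al * (cut rr t * r) - M ^+ 6 * `|v x|) ^+ 2 =
    al * (cut rr t ^+ 2 * r ^+ 2) + M ^+ 12 * `|v x| ^+ 2 / al - 2 * (cut rr t * r) * (M ^+ 6 * `|v x|).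
    by field; rewrite gt_eqF.
  by rewrite subr_ge0.
rewrite (le_trans (ler_wpM2l tn amgm))// mulrDr lerD//.
  have -> : t ^+ n.-1 * (al * (cut rr t ^+ 2 * r ^+ 2)) = al * r ^+ 2 * (t ^+ n.-1 * cut rr t ^+ 2) by ring.
  have h0 : 0 <= al * r ^+ 2 by rewrite mulr_ge0 ?sqr_ge0// ltW.
  rewrite (le_trans (ler_wpM2l h0 (green_ge t0)))// /al le_eqVlt; apply/orP; left; apply/eqP.
  by field; rewrite !gt_eqF.
rewrite /al le_eqVlt; apply/orP; left; apply/eqP.
by field; rewrite !gt_eqF.
Qed.

Local Notation Q := (2 * lam ^+ 2 * M + M ^+ 13 * (n%:R + 8) / 2).

Lemma near_eta x : 0 <= eta * t1 x <= 1.
Proof.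
by rewrite (near_et E cx0 eta0) mulr_ge0// ltW// near_tau_gt0'.
Qed.

Lemma far_eta x : 0 <= eta * t2 x <= 1.
Proof.
by rewrite (far_et E cx0 eta0) mulr_ge0// ltW// far_tau_gt0'.
Qed.

(** The nonnegative [core] of the mirror image is dropped. In front of [Psi] and [zeta], [v^2] is
    replaced by its maximum [W], so that these errors can later be absorbed into the left side. *)
Lemma mean_value_pointwise x : cube a L x ->
  v x ^+ 2 * core n rr eta (t1 x) <= mean_value_integrand x
    + 2 ^+ n.+4 * rr ^- n.+1 * ((1 <= rr * t1 x)%R%:R * v x ^+ 2)
    + 2 * lam ^+ 2 * M * W * Psi x
    + M ^+ 13 * (n%:R + 8) / 2 * W * (zeta (t1 x) + zeta (t2 x)).
Proof.
move=> cx; have Hx := el_half_space E cx; have M0 := M_gt0 E.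
have t10 := near_tau_gt0' x; have t20 := far_tau_gt0' x.
have t21 : t2 x <= t1 x by exact: (far_tau_le E cx0 eta0 Hx).
have g1 := radial_div_green_pole n rr0 t10 (near_eta x).
have g2 := radial_div_green_pole n rr0 t20 (far_eta x).
have a1 := gradient_absorption cx (lexx (t1 x)); have a2 := gradient_absorption cx t21.
have v2 := sqr_ge0 (v x); have vm := vmax cx.
have f1 := green_ge0 t10; have f2 := green_ge0 t20.
have c2 : 0 <= core n rr eta (t2 x).
  have /andP[? _] := cut_itv rr (t2 x).
  by apply: mulr_ge0 => //; apply: mulr_ge0; rewrite ?exprn_ge0 ?(ltW t20)// mulr_ge0 ?sqr_ge0.
have P0 : 0 <= Psi x by exact: addr_ge0.
have cx1 := conormal_xi_ge E v cx.
have C0 : 0 <= M ^+ 13 * (n%:R + 8) / 2 by rewrite divr_ge0// mulr_ge0 ?exprn_ge0 ?(ltW M0)// addr_ge0.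
have z0 t : 0 < t -> 0 <= zeta t.
  move=> t0; have /andP[? _] := cut2_itv rr t; by rewrite mulr_ge0// exprn_ge0// ltW.
have ind : (1 <= rr * t2 x)%R%:R <= (1 <= rr * t1 x)%R%:R :> R.
  have h : rr * t2 x <= rr * t1 x by rewrite ler_wpM2l// ltW.
  by have [/le_trans->//|] := boolP (1 <= rr * t2 x).
have K0 : 0 <= 2 ^+ n.+3 * rr ^- n.+1 by rewrite divr_ge0 ?exprn_ge0// ltW.
have s1 : v x ^+ 2 * (core n rr eta (t1 x) - 2 * (2 ^+ n.+3 * rr ^- n.+1) * (1 <= rr * t1 x)%R%:R) <=
    v x ^+ 2 * (radial_div n eta g dg (t1 x) + radial_div n eta g dg (t2 x)).
  apply: ler_wpM2l => //; have := ler_wpM2l K0 ind.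
  move: g1 g2 c2; move: (core _ _ _ (t1 x)) (core _ _ _ (t2 x)) (radial_div _ _ _ _ (t1 x))
    (radial_div _ _ _ _ (t2 x)) => q1 q2 q3 q4; lra.
have s2 : 2 * lam ^+ 2 * rho x * v x ^+ 2 * Psi x <= 2 * lam ^+ 2 * M * W * Psi x.
  have l2 : 0 <= 2 * lam ^+ 2 by rewrite mulr_ge0 ?sqr_ge0.
  have rh : 0 <= rho x.
    by have := lt_le_trans ltr01 (el_rho_ge E cx); rewrite pmulr_rgt0// => /ltW.
  apply: ler_wpM2r => //; apply: ler_pM => //; first exact: mulr_ge0.
  by apply: ler_wpM2l => //; exact: el_rho_le E _ cx.
have s3 : 2 * green (t1 x) * (grad_norm v x ^+ 2 / M) + 2 * green (t2 x) * (grad_norm v x ^+ 2 / M)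
    <= 2 * Psi x * dot (p x) (xi x).
  rewrite -mulrDl -mulrDr; apply: ler_wpM2l; first exact: mulr_ge0.
  by rewrite ler_pdivrMr// mulrC.
have s4 t : 0 < t -> M ^+ 13 * (n%:R + 8) / 2 * v x ^+ 2 * zeta t <= M ^+ 13 * (n%:R + 8) / 2 * W * zeta t.
  by move=> /z0 zt; apply: ler_wpM2r => //; exact: ler_wpM2l.
have s41 := s4 _ t10; have s42 := s4 _ t20.
rewrite /mean_value_integrand.
have -> : 2 ^+ n.+4 * rr ^- n.+1 * ((1 <= rr * t1 x)%R%:R * v x ^+ 2) =
  v x ^+ 2 * (2 * (2 ^+ n.+3 * rr ^- n.+1) * (1 <= rr * t1 x)%R%:R) by rewrite exprS; ring.
move: s1 s2 s3 s41 s42 a1 a2; rewrite -/(t1 x) -/(t2 x).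
rewrite [v x ^+ 2 * (core _ _ _ _ - _)]mulrBr [_ * W * (_ + _)]mulrDr.
move: (v x ^+ 2 * core _ _ _ _) (v x ^+ 2 * (2 * _ * _)) (v x ^+ 2 * (radial_div _ _ _ _ _ + _))
 (2 * lam ^+ 2 * rho x * _ * _) (2 * lam ^+ 2 * M * _ * _) (2 * Psi x * _) => q1 q2 q3 q4 q5 q6.
move: (2 * v x * (g (t1 x) * _)) (2 * v x * (g (t2 x) * _)) (2 * green (t1 x) * _)
 (2 * green (t2 x) * _) => q7 q8 q9 q10.
lra.
Qed.

(** Null multiples of [radial_div] trade [Psi] for [riesz], then [riesz] for a constant on a ball of
    radius [2 rr]. *)
Lemma mean_value_error : exists2 D, null a L D & forall x, cube a L x ->
  v x ^+ 2 * core n rr eta (t1 x) <= D x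
    + 2 ^+ n.+4 * rr ^- n.+1 * ((1 <= rr * t1 x)%R%:R * v x ^+ 2)
    + 4 * Q * W * (rr ^+ 2 * rr ^- n.+1) * (1 <= 2 * rr * t1 x)%R%:R.
Proof.
have fC (t : R) : 0 < t -> {for t, continuous df} by move=> _; exact: continuous_dgreen.
have zD (t : R) : 0 < t -> is_derive t 1 zeta (dzeta t) by move=> _; exact: is_derive_riesz.
have zC (t : R) : 0 < t -> {for t, continuous dzeta} by move=> _; exact: continuous_driesz.
have f0 (t : R) : 0 < t -> 2 * rr * t <= 1 -> green t = 0.
  by move=> t0 h; apply: green_cut => //; exact: half_cut.
have Nf := null_div_mirror_field greenD fC f0.
have z0 (t : R) : 0 < t -> 2 * rr * t <= 1 -> zeta t = 0.
  by move=> _ h; rewrite /riesz cut2_eq0 ?mulr0.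
have Nz := null_div_mirror_field zD zC z0.
pose K := 2 * lam ^+ 2 * M * W.
exists (fun x => mean_value_integrand x
  + K * (radial_div n eta green df (t1 x) + radial_div n eta green df (t2 x))
  + Q * W / 2 * (radial_div n eta zeta dzeta (t1 x) + radial_div n eta zeta dzeta (t2 x))).
  by apply: nullD; [apply: nullD; [exact: null_mean_value|exact: nullZ]|exact: nullZ].
move=> x cx; have Hx := el_half_space E cx; have M0 := M_gt0 E.
have t10 := near_tau_gt0' x; have t20 := far_tau_gt0' x.
have t21 : t2 x <= t1 x by exact: (far_tau_le E cx0 eta0 Hx).
have h := mean_value_pointwise cx.
have f1 := radial_div_green n rr0 t10 (near_eta x) (green_ge0 t10).
have f2 := radial_div_green n rr0 t20 (far_eta x) (green_ge0 t20).
have z1 := radial_div_riesz n0 rr0 t10 (near_eta x).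
have z2 := radial_div_riesz n0 rr0 t20 (far_eta x).
have W0 : 0 <= W := sqr_ge0 _.
have K0 : 0 <= K.
  apply: mulr_ge0 => //; apply: mulr_ge0; last exact: ltW.
  by rewrite mulr_ge0 ?sqr_ge0.
have C0 : 0 <= M ^+ 13 * (n%:R + 8) / 2 * W.
  by apply: mulr_ge0 => //; rewrite divr_ge0// mulr_ge0 ?exprn_ge0 ?(ltW M0)// addr_ge0.
have QW : Q * W = K + M ^+ 13 * (n%:R + 8) / 2 * W by rewrite /K; ring.
have QW0 : 0 <= Q * W by rewrite QW addr_ge0.
have ind : (1 <= 2 * rr * t2 x)%R%:R <= (1 <= 2 * rr * t1 x)%R%:R :> R.
  have h1 : 2 * rr * t2 x <= 2 * rr * t1 x by rewrite ler_wpM2l// mulr_ge0// ltW.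
  by have [/le_trans->//|] := boolP (1 <= 2 * rr * t2 x).
have J0 : 0 <= rr ^+ 2 * rr ^- n.+1.
  by apply: mulr_ge0; rewrite ?invr_ge0 exprn_ge0// ltW.
have ind' := ler_wpM2l J0 ind.
have zz : zeta (t1 x) + zeta (t2 x) <=
   (radial_div n eta zeta dzeta (t1 x) + radial_div n eta zeta dzeta (t2 x)) / 2
   + 4 * (rr ^+ 2 * rr ^- n.+1 * (1 <= 2 * rr * t1 x)%R%:R).
  move: z1 z2 ind'; rewrite -!mulrA; lra.
have PP : Psi x <= radial_div n eta green df (t1 x) + radial_div n eta green df (t2 x)
    + (zeta (t1 x) + zeta (t2 x)).
  by rewrite /Psi; move: f1 f2; lra.
have PK := ler_wpM2l K0 PP; have zQ := ler_wpM2l QW0 zz.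
move: h PK zQ; rewrite -/K QW.
have -> : 4 * Q * W * (rr ^+ 2 * rr ^- n.+1) * (1 <= 2 * rr * t1 x)%R%:R =
  (K + M ^+ 13 * (n%:R + 8) / 2 * W) * (4 * (rr ^+ 2 * rr ^- n.+1 * (1 <= 2 * rr * t1 x)%R%:R)).
  by rewrite -QW; ring.
rewrite (mulrDr K (_ + _)) [_ * (_ + 4 * _)]mulrDr.
rewrite [(K + _ * W) * (zeta _ + _)]mulrDl.
rewrite [(K + _) / 2 * _](_ : _ = (K + M ^+ 13 * (n%:R + 8) / 2 * W) *
  ((radial_div n eta zeta dzeta (t1 x) + radial_div n eta zeta dzeta (t2 x)) / 2)); last by ring.
move: (v x ^+ 2 * _) (mean_value_integrand x) (2 ^+ n.+4 * _ * _) (K * Psi x)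
 (K * (radial_div _ _ _ _ _ + _)) (K * (zeta _ + _)) (M ^+ 13 * (n%:R + 8) / 2 * W * (zeta _ + _))
 ((K + _) * (_ / 2)) ((K + _) * (4 * _)) => q1 q2 q3 q4 q5 q6 q7 q8 q9.
lra.
Qed.

End MeanValue.

Lemma pos_family (R : realType) (I : finType) (F : I -> R) : (forall i, 0 < F i) ->
  exists2 e : R, 0 < e & forall i, e <= F i.
Proof.
move=> F0; exists (1 + \sum_i (F i)^-1)^-1 => [|i].
  by rewrite invr_gt0 ltr_pwDl// sumr_ge0// => i _; rewrite invr_ge0 ltW.
have s0 : 0 <= \sum_(j | j != i) (F j)^-1 by rewrite sumr_ge0// => j _; rewrite invr_ge0 ltW.
rewrite -[leRHS]invrK lef_pV2 ?posrE ?invr_gt0//; last first.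
  by rewrite ltr_pwDl// sumr_ge0// => j _; rewrite invr_ge0 ltW.
by rewrite (bigD1 i)//= addrCA lerDl addr_ge0.
Qed.

(** * Mean value inequality and Morawetz estimate combined *)

Section LocalEstimate.
Variables (R : realType) (n : nat).
Local Notation vec := 'rV[R]_n.+1.
Local Notation H := (@half_space R n).
Implicit Types (k l : 'I_n.+1) (x y z : vec) (t : R).
Variables (V : set vec) (a : vec) (L : R) (G : vec -> 'M[R]_n.+1) (rho : vec -> R) (M : R).
Hypothesis E : elliptic V a L G rho M.
Variables (lam : R) (v : vec -> R).
Hypothesis S : solution V G rho lam v.
Hypothesis n0 : (0 < n)%N.
Variable x0 : vec.
Hypothesis cx0 : cube a L x0.
Hypothesis vmax : forall x, cube a L x -> v x ^+ 2 <= v x0 ^+ 2.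

Local Notation A := (Amx G x0).
Local Notation W := (v x0 ^+ 2).

Lemma near_tau_ge eta c x : 0 < eta -> 0 < c ->
  (1 <= c * near_tau G x0 eta x) = (sqdist A x0 x + eta ^+ 2 <= c ^+ 2).
Proof.
move=> e0 c0; have t0 := near_tau_gt0 E cx0 e0 x; have := sqr_rtau e0 (A_ge0' E cx0) x0 x.
rewrite -/(near_tau G x0 eta x); set t := near_tau G x0 eta x in t0 *; set s := _ + _ => ts.
rewrite -(@expr_ge1 _ 2)// ?mulr_ge0 ?(ltW c0) ?(ltW t0)// exprMn -ts mulrC.
by rewrite ler_pM2r// exprn_gt0.
Qed.

Lemma sqdist_ge0' x : 0 <= sqdist A x0 x. Proof. exact: (A_ge0' E cx0). Qed.

Lemma sqdist_norm x r : 0 <= r -> sqdist A x0 x <= r ^+ 2 -> `|x - x0| <= M * r.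
Proof.
move=> r0 sr; have M0 := M_gt0 E; apply/coord_normP; first by rewrite mulr_ge0// ltW.
move=> j; rewrite -(@ler_pXn2r _ 2)// ?nnegrE ?mulr_ge0 ?(ltW M0)//.
rewrite real_normK ?num_real// (le_trans (sqr_coord_le_dot _ _))//.
have iM0 : 0 < M^-1 by rewrite invr_gt0.
have := dot_le_inv_form (Bsym (el_cube E) (el_sym E) cx0) iM0 (Bell (el_M1 E) (el_ell E) cx0)
  (Bbd (el_G E) cx0) (x - x0) => h.
rewrite (le_trans h)// exprMn expr2; apply: ler_pM => //.
- by rewrite mulr_ge0// ltW.
- exact: sqdist_ge0'.
- by rewrite ler_wpM2r ?(ltW M0)// (el_dim E).
Qed.

Lemma sqdist_box x r : 0 <= r -> (forall j, `|(x - x0) 0 j| <= r) -> sqdist A x0 x <= (M * r) ^+ 2.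
Proof.
move=> r0 xr; have M0 := M_gt0 E; have iM0 : 0 < M^-1 by rewrite invr_gt0.
have := inv_form_le iM0 (Bell (el_M1 E) (el_ell E) cx0) (x - x0); rewrite invrK => h.
rewrite (le_trans h)// exprMn [in leRHS]expr2 -mulrA ler_wpM2l ?(ltW M0)//.
rewrite (@le_trans _ _ (\sum_(j < n.+1) r ^+ 2))//.
  apply: ler_sum => j _; rewrite -expr2 -real_normK ?num_real//.
  by rewrite ler_pXn2r ?nnegrE.
by rewrite sumr_const card_ord -mulr_natl ler_wpM2r ?sqr_ge0// (el_dim E).
Qed.

Variable rr : R.
Hypothesis rr0 : 0 < rr.
Hypothesis outer : forall x, cube a L x -> outer_face a L x -> 4 * rr ^+ 2 <= sqdist A x0 x.

(** A lower bound for the average of [core], free of [eta]: its height is of order [eta^-(n+1)] on a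
    box of side [eta / M]. *)
Definition mv_const : R := (2 ^+ n.+3 * (2 * M * L) ^+ n.+1)^-1.
Local Notation Q := (2 * lam ^+ 2 * M + M ^+ 13 * (n%:R + 8) / 2).
Hypothesis small : 16 * (8 * M / L) ^+ n.+1 * (Q * rr ^+ 2) <= mv_const.

Lemma mv_const_gt0 : 0 < mv_const.
Proof.
rewrite invr_gt0 mulr_gt0 ?exprn_gt0// mulr_gt0 ?(el_side E)// mulr_gt0//; exact: M_gt0 E.
Qed.

(** Near [x0], [v^2] is at least [W / 2] by continuity, which gives [mv_const / 2 * W]; half of this
    is lost to the error weighted by [Q], as [small] permits. *)
Lemma mean_value : exists2 D, null a L D & exists T0 : nat, forall T, (T0 <= T)%N ->
  mv_const / 4 * W <= avg a L T.+1 (fun x => D x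
    + 2 ^+ n.+4 * rr ^- n.+1 * ((sqdist A x0 x <= rr ^+ 2)%R%:R * v x ^+ 2)).
Proof.
have M0 := M_gt0 E; have L0 := el_side E; have c0 := mv_const_gt0.
have K0 : 0 <= 2 ^+ n.+4 * rr ^- n.+1 by rewrite divr_ge0 ?exprn_ge0// ltW.
have [W0|Wn] := eqVneq W 0.
  exists (fun=> 0); first exact: null0.
  exists 0%N => T _; rewrite W0 mulr0 -[leLHS](mulr0 (T.+1%:R^-1 ^+ n.+1)).
  rewrite /avg ler_wpM2l ?exprn_ge0 ?invr_ge0//; apply: sumr_ge0 => s _.
  by rewrite add0r mulr_ge0// mulr_ge0 ?sqr_ge0.
have Wp : 0 < W by rewrite lt_neqAle eq_sym Wn sqr_ge0.
have VH := rel_open_sub (el_open E).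
have vC := Ck1_solution (sol_C S).
have v2c : {within V, continuous (fun x => v x ^+ 2)} by exact: (Ck_continuous (Ck1_exp VH 2 vC)).
have W2 : 0 < W / 2 by rewrite divr_gt0.
have [d d0 dP] := (within_continuousP _ _).1 v2c x0 (el_cube E cx0) _ W2.
(* By [outer], [x0] lies on no outer face, being at distance 0 from itself; hence there is room for
   a box in the positive directions. *)
have marg j : 0 < a 0 j + L - x0 0 j.
  rewrite subr_gt0 lt_neqAle; have /andP[_ ->] := cx0 j; rewrite andbT.
  apply/eqP => xj; have ox : outer_face a L x0 by exists j; left.
  have := outer cx0 ox; rewrite /sqdist subrr mul0mx /dot big1 => [|k _]; last by rewrite mxE mul0r.
  by rewrite leNgt mulr_gt0// exprn_gt0.
have [mg mg0 mgP] := pos_family marg.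
(* Small against the cutoff radius, the modulus of continuity of [v^2] at [x0] and the room in the
   cube. It has no uniform lower bound, but cancels in [e1]. *)
pose eta := Num.min (Num.min (rr / 4) (d / 2)) mg.
have eta0 : 0 < eta by rewrite !lt_min mg0 !divr_gt0.
have /andP[/andP[eta_rr eta_d] eta_mg] : (eta <= rr / 4) && (eta <= d / 2) && (eta <= mg).
  by rewrite -!le_min.
have out' x : cube a L x -> outer_face a L x -> 2 * rr * near_tau G x0 eta x <= 1.
  move=> cx /(outer cx) h; rewrite leNgt; apply/negP => /ltW.
  rewrite near_tau_ge ?mulr_gt0// exprMn => h2.
  have : 0 < eta ^+ 2 by rewrite exprn_gt0.
  by move: h h2; rewrite -natrX; lra.
have [green [gD g0 gp gge]] := green_exists n rr0.
have [D DN DP] := mean_value_error E S n0 cx0 eta0 rr0 out' vmax gD g0 gp gge.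
exists D => //.
have et0 : 0 < eta / M by rewrite divr_gt0.
have etM : eta / M <= eta by rewrite ler_pdivrMr// ler_peMr ?(ltW eta0)// (el_M1 E).
have inside j : a 0 j <= x0 0 j /\ x0 0 j + eta / M <= a 0 j + L.
  by have /andP[-> _] := cx0 j; have := mgP j; have := le_trans etM eta_mg; lra.
have [T1 T1P] := @avg_box_ge _ _ a L L0 x0 (eta / M) et0 inside.
have r2 : 0 < 2 * M * rr by rewrite !mulr_gt0.
have [T2 T2P] := avg_ball_le a L0 x0 r2.
exists (maxn T1 T2) => T; rewrite geq_max => /andP[/T1P{}T1P /T2P{}T2P].
pose ke := eta ^+ 2 / (2 * eta) ^+ n.+3.
have ke0 : 0 <= ke by rewrite divr_ge0 ?exprn_ge0// ?mulr_ge0// ltW.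
have lower x : cube a L x -> ke * (W / 2) * [forall j, x0 0 j <= x 0 j <= x0 0 j + eta / M]%R%:R
    <= v x ^+ 2 * core n rr eta (near_tau G x0 eta x).
  move=> cx; have t0 := near_tau_gt0 E cx0 eta0 x; set t := near_tau G x0 eta x in t0 *.
  have cr0 : 0 <= core n rr eta t.
    have /andP[? _] := cut_itv rr t.
    by apply: mulr_ge0 => //; apply: mulr_ge0; rewrite ?exprn_ge0 ?(ltW t0)// mulr_ge0 ?sqr_ge0.
  case: forallP => [xb|_]; last by rewrite mulr0 mulr_ge0 ?sqr_ge0.
  have xd j : `|(x - x0) 0 j| <= eta / M.
    have /andP[b1 b2] := xb j; rewrite !mxE ger0_norm ?subr_ge0//; lra.
  have xd' : `|x - x0| < d.
    have h : `|x - x0| <= eta / M by apply/coord_normP => //; exact: ltW.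
    by rewrite (le_lt_trans h)// (le_lt_trans etM)// (le_lt_trans eta_d)// ltr_pdivrMr// ltr_pMr// ltr1n.
  have vW : W / 2 <= v x ^+ 2.
    have := dP x (el_cube E cx) xd'; rewrite ler_norml; lra.
  have s1 := sqdist_box (ltW et0) xd; rewrite mulrC divfK ?gt_eqF// in s1.
  have t2 : 1 <= 2 * eta * t.
    rewrite near_tau_ge ?mulr_gt0// exprMn -natrX; have := sqr_ge0 eta; lra.
  have ct : cut rr t = 1.
    apply: cut_eq1; have : 4 * eta <= rr by move: eta_rr; rewrite ler_pdivlMr// mulrC.
    move=> /(ler_wpM2r (ltW t0)); lra.
  rewrite mulr1 mulrC; apply: ler_pM => //; first by rewrite ltW.
  rewrite /core ct mulr1 /ke ler_pdivrMr ?exprn_gt0 ?mulr_gt0//.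
  have -> : n.+1%:R * eta ^+ 2 * t ^+ n.+3 * (2 * eta) ^+ n.+3 =
    eta ^+ 2 * (n.+1%:R * (2 * eta * t) ^+ n.+3) by rewrite (exprMn n.+3 (2 * eta) t); ring.
  rewrite ler_peMr ?sqr_ge0// -[leLHS]mulr1; apply: ler_pM => //; first by rewrite ler1n.
  exact: exprn_ege1.
have J0 : 0 <= 4 * Q * W * (rr ^+ 2 * rr ^- n.+1).
  apply: mulr_ge0; last by apply: mulr_ge0; rewrite ?invr_ge0 exprn_ge0// ltW.
  apply: mulr_ge0; last exact: ltW.
  apply: mulr_ge0 => //; apply: addr_ge0.
    by apply: mulr_ge0; [rewrite mulr_ge0 ?sqr_ge0|exact: ltW].
  by rewrite divr_ge0// mulr_ge0 ?exprn_ge0 ?(ltW M0)// addr_ge0.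
have upper x : cube a L x -> v x ^+ 2 * core n rr eta (near_tau G x0 eta x) <=
    (D x + 2 ^+ n.+4 * rr ^- n.+1 * ((sqdist A x0 x <= rr ^+ 2)%R%:R * v x ^+ 2))
    + 4 * Q * W * (rr ^+ 2 * rr ^- n.+1) * (`|x - x0| <= 2 * M * rr)%R%:R.
  move=> cx; rewrite (le_trans (DP x cx))// lerD//.
    rewrite lerD2l ler_wpM2l// ler_wpM2r ?sqr_ge0//.
    rewrite near_tau_ge//; have [h|//] := boolP (_ + _ <= _).
    by rewrite (le_trans _ h)// lerDl sqr_ge0.
  rewrite ler_wpM2l//; rewrite near_tau_ge ?mulr_gt0//; have [h|//] := boolP (_ + _ <= _).
  rewrite (_ : (`|_| <= _) = true)//; rewrite -mulrA mulrCA; apply: sqdist_norm.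
    by rewrite mulr_ge0// ltW.
  by rewrite (le_trans _ h)// lerDl sqr_ge0.
have := @avg_le _ _ _ _ L0 T.+1 _ _ (fun x cx => le_trans (lower x cx) (upper x cx)).
rewrite avgD !avgZ => main.
have keW : 0 <= ke * (W / 2) by rewrite mulr_ge0// ltW.
have h1 := ler_wpM2l keW T1P; have h2 := ler_wpM2l J0 T2P.
have e1 : ke * (W / 2) * (eta / M / (2 * L)) ^+ n.+1 = mv_const / 2 * W.
  have e : eta / M / (2 * L) = eta / (2 * M * L) by field; rewrite !gt_eqF.
  rewrite e /ke /mv_const expr_div_n exprMn.
  have q1 : eta ^+ n.+1 != 0 by rewrite gt_eqF ?exprn_gt0.
  have q2 : (2 * M * L) ^+ n.+1 != 0 by rewrite gt_eqF ?exprn_gt0 ?mulr_gt0.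
  have q3 : 2 ^+ n.+3 != 0 :> R by rewrite gt_eqF ?exprn_gt0.
  have -> : eta ^+ n.+3 = eta ^+ n.+1 * eta ^+ 2 by rewrite -exprD addn2.
  move: (eta ^+ n.+1) q1 ((2 * M * L) ^+ n.+1) q2 (2 ^+ n.+3) q3 => q1 n1 q2 n2 q3 n3.
  by field; rewrite n1 n2 n3 gt_eqF.
(* The volume of the ball of radius [2 M rr] compensates [rr^-(n+1)], which leaves [Q rr^2] times
   [W]. *)
have e2 : 4 * Q * W * (rr ^+ 2 * rr ^- n.+1) * (4 * (2 * M * rr) / L) ^+ n.+1 =
    (16 * (8 * M / L) ^+ n.+1 * (Q * rr ^+ 2)) / 4 * W.
  have e : 4 * (2 * M * rr) / L = (8 * M / L) * rr by field; rewrite gt_eqF.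
  rewrite e exprMn; have q1 : rr ^+ n.+1 != 0 by rewrite gt_eqF ?exprn_gt0.
  by field.
have h3 : (16 * (8 * M / L) ^+ n.+1 * (Q * rr ^+ 2)) / 4 * W <= mv_const / 4 * W.
  by rewrite ler_wpM2r ?(ltW Wp)// ler_wpM2r ?invr_ge0.
rewrite e1 in h1; rewrite e2 in h2; move: main h1 h2 h3.
move: (avg _ _ _ _) (_ * avg _ _ _ _) (_ * avg _ _ _ _) => q1 q2 q3.
have -> : mv_const / 2 * W = 2 * (mv_const / 4 * W) by field.
by move: (mv_const / 4 * W) => q4; lra.
Qed.

Hypothesis lam1 : 1 <= lam.
Variables chi chi1 : vec -> R.
Hypothesis chiC : Ck 1 V chi.
Hypothesis chi1C : Ck 1 V chi1.
Hypothesis chi_itv : forall x, cube a L x -> 0 <= chi x <= 1.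
Hypothesis chi1_itv : forall x, cube a L x -> 0 <= chi1 x <= 1.
Hypothesis dchi : forall x k, cube a L x -> `|pderiv chi k x| <= M.
Hypothesis dchi1 : forall x k, cube a L x -> `|pderiv chi1 k x| <= M.
Hypothesis chi1_out : forall x, cube a L x -> outer_face a L x -> chi1 x = 0.
Hypothesis chi_chi1 : forall x, cube a L x ->
  chi1 x = 1 \/ (chi x = 0 /\ forall k, pderiv chi k x = 0).
Hypothesis chi_eq1 : forall x, cube a L x -> sqdist A x0 x <= rr ^+ 2 -> chi x = 1.

(** This is [lam * (2 eps * 600 M^24)] for [eps * lam = 20 M^10]. *)
Definition mor_const : R := 40 * 600 * M ^+ 34.

(** The mass on the ball of radius [rr] left by [mean_value] is bounded through [morawetz] by
    [mor_const / lam] times that on the cube; [e] pays for the null functions at finite [T]. *)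
Lemma local_estimate e : rr * lam <= 20 * M ^+ 10 -> 0 < e -> exists T0 : nat, forall T, (T0 <= T)%N ->
  mv_const / 4 * W <=
    2 ^+ n.+4 * rr ^- n.+1 * (mor_const / lam) * avg a L T.+1 (fun x => v x ^+ 2) + e.
Proof.
move=> rrl e0; have M0 := M_gt0 E; have lam0 : 0 < lam by exact: lt_le_trans lam1.
pose eps := 20 * M ^+ 10 / lam; have eps0 : 0 < eps by rewrite divr_gt0 ?mulr_gt0 ?exprn_gt0.
have epsK : eps * lam = 20 * M ^+ 10 by rewrite /eps divfK ?gt_eqF.
have [D1 N1 [T1 T1P]] := mean_value.
have [D2 N2 D2P] := morawetz E lam1 S cx0 eps0 epsK chiC chi1C chi_itv chi1_itv dchi dchi1
  chi1_out chi_chi1.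
pose K := 2 ^+ n.+4 * rr ^- n.+1.
have K0 : 0 <= K by rewrite divr_ge0 ?exprn_ge0// ltW.
(* Normalises the Morawetz weight: [F * eps * t^2 >= 1] where [sqdist <= rr^2], while [F <= 2 eps]
   because [rr <= eps]. *)
pose F := (rr ^+ 2 + eps ^+ 2) / eps.
have F0 : 0 <= F by rewrite divr_ge0 ?addr_ge0 ?sqr_ge0// ltW.
have FM : F * (600 * M ^+ 24) <= mor_const / lam.
  have rre : rr <= eps by rewrite /eps ler_pdivlMr.
  have h : F <= 2 * eps.
    rewrite /F ler_pdivrMr// -mulrA -expr2.
    have : rr ^+ 2 <= eps ^+ 2 by rewrite ler_pXn2r ?nnegrE ?(ltW rr0) ?(ltW eps0).
    by lra.
  have M24 : 0 <= 600 * M ^+ 24 by apply: mulr_ge0; [exact: ler0n|exact/exprn_ge0/ltW].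
  rewrite (le_trans (ler_wpM2r M24 h))// /eps /mor_const le_eqVlt; apply/orP; left; apply/eqP.
  by field; rewrite gt_eqF.
have N : null a L (fun x => D1 x + K * F * D2 x) by apply: nullD => //; exact: nullZ.
have [T2 T2P] := null_avg_le N e0.
exists (maxn T1 T2) => T; rewrite geq_max => /andP[/T1P{}T1P /T2P{}T2P].
rewrite (le_trans T1P)// [leRHS]addrC.
have v2 x := sqr_ge0 (v x).
have point x : cube a L x ->
    D1 x + 2 ^+ n.+4 * rr ^- n.+1 * ((sqdist A x0 x <= rr ^+ 2)%R%:R * v x ^+ 2) <=
    (D1 x + K * F * D2 x) + K * (mor_const / lam) * v x ^+ 2.
  move=> cx; rewrite -/K -addrA lerD2l -[K * F * _]mulrA -[K * _ * v x ^+ 2]mulrA -mulrDr ler_wpM2l//.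
  have h := D2P x cx; have /andP[c0 c1] := chi_itv cx.
  have z : F * (D2 x + 600 * M ^+ 24 * v x ^+ 2) <= F * D2 x + mor_const / lam * v x ^+ 2.
    by rewrite mulrDr lerD2l mulrA ler_wpM2r.
  rewrite (le_trans _ z)//; apply: le_trans (ler_wpM2l F0 h).
  have t0 := near_tau_gt0 E cx0 eps0 x.
  case: (boolP (sqdist A x0 x <= _)) => [sr|_]; last first.
    rewrite mul0r mulr_ge0// mulr_ge0// mulr_ge0//.
    by rewrite mulr_ge0 ?sqr_ge0// ltW.
  rewrite (chi_eq1 cx sr) !mul1r /F.
  have -> : (rr ^+ 2 + eps ^+ 2) / eps * (eps * near_tau G x0 eps x ^+ 2 * v x ^+ 2) =
    ((rr ^+ 2 + eps ^+ 2) * near_tau G x0 eps x ^+ 2) * v x ^+ 2 by field; rewrite gt_eqF.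
  rewrite ler_peMl//; have := sqr_rtau eps0 (A_ge0' E cx0) x0 x.
  rewrite -/(near_tau G x0 eps x) mulrC => <-.
  by rewrite ler_wpM2r ?sqr_ge0// lerD2r.
rewrite (le_trans (avg_le (el_side E) _ point))// avgD avgZ -/K lerD2r.
by rewrite (le_trans (ler_norm _)).
Qed.

End LocalEstimate.

(** * Comparison with the Riemannian volume *)

Section IntegralLowerBounds.
Local Open Scope ereal_scope.
Import HBNNSimple.

(* No measurability is needed: the integral of a nonnegative function is a
   supremum over the simple functions below it. *)
Lemma ge0_integral_le d (T : measurableType d) (R : realType) (mu : {measure set T -> \bar R})
    (f g : T -> \bar R) : (forall x, 0 <= f x) -> (forall x, f x <= g x) ->
  \int[mu]_x f x <= \int[mu]_x g x.
Proof.
move=> f0 fg; rewrite !ge0_integralTE//; last by move=> x; exact: le_trans (fg x).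
apply: ereal_sup_le => _ [h /= hf <-]; exists h => //= x.
exact: le_trans (fg x).
Qed.

Lemma lebesgue_integral_rV_ge0 (R : realType) n (F : 'rV[R]_n -> \bar R) :
  (forall x : 'rV[R]_n, 0 <= F x) -> 0 <= lebesgue_integral_rV F.
Proof.
elim: n F => [|n IHn] F F0 /=; first exact: F0.
by apply: integral_ge0 => t _; apply: IHn => x; exact: F0.
Qed.

Lemma lebesgue_integral_rV_ge (R : realType) n (F : 'rV[R]_n -> \bar R) (al : 'rV[R]_n) (h c : R) :
  (0 <= h)%R -> (0 <= c)%R -> (forall x : 'rV[R]_n, 0 <= F x) ->
  (forall x : 'rV[R]_n, (forall j, (al 0 j <= x 0 j < al 0 j + h)%R) -> c%:E <= F x) ->
  (c * h ^+ n)%:E <= lebesgue_integral_rV F.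
Proof.
move=> h0 c0; elim: n F al => [|n IHn] F al F0 FB /=.
  by rewrite mulr1; apply: FB => -[].
pose al0 : R := al 0%R ord0; pose al1 : 'rV[R]_n := rsubmx (al : 'rV_(1 + n)).
pose I := [set` `[al0, (al0 + h)%R[%R].
have mI : measurable I by exact: measurable_itv.
apply: (@le_trans _ _ (\int[@lebesgue_measure R]_t ((c * h ^+ n)%:E * (\1_I t)%:E))).
  rewrite ge0_integralZl_EFin//; last 2 first.
  - by apply/measurable_EFinP; apply: measurable_indic; exact: measurable_itv.
  - by rewrite mulr_ge0// exprn_ge0.
  - rewrite (_ : (\int[_]_x _ = h%:E)%E) -?EFinM ?exprSr ?mulrA//.
    transitivity (@lebesgue_measure R I).
      by rewrite integral_indic//; congr (lebesgue_measure _); exact: setIT.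
    rewrite lebesgue_measure_itv/= lte_fin.
    case: ifPn => [_|]; first by rewrite -EFinD addrAC subrr add0r.
    by rewrite ltrDl -leNgt => h1; congr EFin; apply/eqP; rewrite eq_le h1 h0.
apply: ge0_integral_le => t.
  by rewrite mule_ge0// lee_fin// mulr_ge0// exprn_ge0.
rewrite indicE; case: (boolP (t \in I)) => [|_]; last first.
  by rewrite mule0; apply: lebesgue_integral_rV_ge0 => x; exact: F0.
rewrite inE /I/= in_itv/= mule1 => tI; apply: (IHn _ al1) => [x|x xB]; first exact: F0.
apply: FB => j; rewrite mxE; case: (@splitP 1 n j) => k jk.
  by rewrite (_ : j = ord0) ?mxE ?ord1//; apply/val_inj; rewrite /= jk ord1.
have := xB k; rewrite mxE; rewrite (_ : rshift 1 k = j)//.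
by apply/val_inj; rewrite /= jk.
Qed.

End IntegralLowerBounds.

(** * Cells of the grid and their volume *)

Section Volume.
Variables (R : realType) (n : nat) (M : ptopologicalType) (S : smooth_manifold R n M).
Local Notation vec := 'rV[R]_n.+1.
Variables (g : riemannian_metric S) (vol : {measure set (borel M) -> \bar R}).
Hypothesis hvol : is_riemannian_volume g vol.
Variables (i : Defs.index S) (a : vec) (L : R).
Hypotheses (L0 : 0 < L) (cV : cube a L `<=` codom i).

Lemma open_chart (U : set vec) : open U -> open [set p | dom i p /\ U (chart i p)].
Proof.
move=> Uo; rewrite openE => p [ip Up].
have /subspace_continuousP/(_ p ip) := @chart_continuous _ _ _ S i.
have Un : nbhs (chart i p) U by apply: open_nbhs_nbhs; split.
move=> /(_ _ Un); rewrite /= /within/= => h.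
have ipn : nbhs p (dom i) by apply: open_nbhs_nbhs; split=> //; exact: dom_open.
by rewrite /interior; apply: filterS2 ipn h => q iq /(_ iq).
Qed.

(** Half-open, so that the cells of one grid are disjoint; Borel as an intersection of differences
    of open sets. *)
Definition cell T (s : {ffun 'I_n.+1 -> 'I_T}) : set M :=
  [set p | dom i p /\ forall j,
     grid a L s 0 j <= chart i p 0 j < grid a L s 0 j + L / T%:R].

Lemma measurable_cell T (s : {ffun 'I_n.+1 -> 'I_T}) :
  measurable (cell s : set (borel M)).
Proof.
pose lt_set j (b : R) : set (borel M) := [set p | dom i p /\ chart i p 0 j < b].
have mlt j b : measurable (lt_set j b).
  apply: sub_sigma_algebra; apply: (@open_chart [set x : vec | x 0 j < b]).
  rewrite openE => x /= xb; apply/nbhs_ballP; exists (b - x 0 j); first by rewrite /= subr_gt0.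
  move=> y; rewrite -ball_normE/= => xy.
  have := coord_norm_le (x - y) j; rewrite !mxE => h.
  have := le_lt_trans h xy; rewrite ltr_norml => /andP[]; lra.
have mdom : measurable (dom i : set (borel M)) by apply: sub_sigma_algebra; exact: dom_open.
rewrite (_ : cell s = dom i `&` \bigcap_(j in [set: 'I_n.+1])
  (lt_set j (grid a L s 0 j + L / T%:R) `\` lt_set j (grid a L s 0 j))).
  apply: measurableI => //; apply: fin_bigcap_measurable => // j _.
  exact: measurableD.
apply/seteqP; split => [p [ip pc]|p [ip pc]]; split=> // j.
  move=> _; have /andP[h1 h2] := pc j; split=> // -[_].
  by rewrite ltNge h1.
have [[_ h2] h1] := pc j I; rewrite h2 andbT leNgt; apply/negP => h.
exact: h1.
Qed.

Lemma cell_cube T (s : {ffun 'I_n.+1 -> 'I_T}) (x : vec) :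
  (forall j, grid a L s 0 j <= x 0 j < grid a L s 0 j + L / T%:R) -> cube a L x.
Proof.
move=> xs j; have /andP[h1 h2] := xs j.
have T0 : (0 < T)%N by exact: leq_ltn_trans (ltn_ord (s j)).
have T0' : 0 < T%:R :> R by rewrite ltr0n.
have /andP[g1 _] := grid_cube a L0 s j; rewrite (le_trans g1)//=.
rewrite (le_trans (ltW h2))// mxE -addrA lerD2l -mulrDl ler_pdivrMr//.
by rewrite -{2}[L]mulr1 -mulrDr ler_pM2l// natr1 ler_nat.
Qed.

Lemma trivIset_cell T (s s' : {ffun 'I_n.+1 -> 'I_T}) p : cell s p -> cell s' p -> s = s'.
Proof.
move=> [_ h] [_ h']; apply/ffunP => j; apply/val_inj => /=.
have T0 : (0 < T)%N by exact: leq_ltn_trans (ltn_ord (s j)).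
have T0' : 0 < T%:R :> R by rewrite ltr0n.
have q r r' : a 0 j + L * r%:R / T%:R < a 0 j + L * r'%:R / T%:R + L / T%:R -> (r <= r')%N.
  rewrite -addrA ltrD2l -mulrDl ltr_pM2r ?invr_gt0// -{3}[L]mulr1 -mulrDr ltr_pM2l//.
  by rewrite natr1 ltr_nat ltnS.
have /andP[h1 h2] := h j; have /andP[h3 h4] := h' j; rewrite !mxE in h1 h2 h3 h4.
apply/eqP; rewrite eqn_leq; apply/andP; split; apply: q.
  exact: le_lt_trans h1 h4.
exact: le_lt_trans h3 h2.
Qed.

Variable mc : R.
Hypothesis mc0 : 0 <= mc.
Hypothesis mcP : forall x, cube a L x -> mc <= density g i x.

Lemma vol_cell_ge T (s : {ffun 'I_n.+1 -> 'I_T}) :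
  ((mc * (L / T%:R) ^+ n.+1)%:E <= vol (cell s : set (borel M)))%E.
Proof.
rewrite (@hvol i _ (measurable_cell s)); last by move=> p [].
apply: (@lebesgue_integral_rV_ge _ _ _ (grid a L s)) => //.
- by rewrite divr_ge0// ltW.
- by move=> x; rewrite lee_fin mulr_ge0// sqrtr_ge0.
move=> x xs; rewrite lee_fin; have cx := cell_cube xs.
have [ix xE] := param_dom (cV cx).
rewrite indicE mem_set ?mul1r; first exact: mcP.
by exists (param i x) => //; split=> //; rewrite xE.
Qed.

(** The step function with value [om s] on the cell of [s] lies below [u], and each cell has at
    least the volume used on the left. *)
Lemma sum_cell_le (u : M -> R) T (om : {ffun 'I_n.+1 -> 'I_T} -> R) :
  (forall s, 0 <= om s) -> (forall s p, cell s p -> om s <= u p) -> (forall p, 0 <= u p) ->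
  ((\sum_s om s * (mc * (L / T%:R) ^+ n.+1))%:E <= \int[vol]_p (u p)%:E)%E.
Proof.
move=> om0 omu u0.
apply: (@le_trans _ _ (\int[vol]_p (\sum_s ((om s)%:E * (\1_(cell s : set (borel M)) p)%:E)))%E).
  rewrite ge0_integral_sum//.
  - rewrite -sumEFin; apply: lee_sum => s _.
    rewrite ge0_integralZl_EFin//; last first.
      by apply/measurable_EFinP; apply: measurable_indic; exact: measurable_cell.
    rewrite integral_indic// ?setIT; last exact: measurable_cell.
    by rewrite EFinM lee_wpmul2l ?lee_fin// vol_cell_ge.
  - move=> s; apply: measurable_funeM; apply/measurable_EFinP; apply: measurable_indic.
    exact: measurable_cell.
  - by move=> s p _; rewrite mule_ge0// lee_fin.
apply: ge0_integral_le => p.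
  by apply: sume_ge0 => s _; rewrite mule_ge0// lee_fin.
have [[s sp]|np] := pselect (exists s : {ffun 'I_n.+1 -> 'I_T}, cell s p).
  rewrite (bigD1 s)//= big1 ?adde0; last first.
    move=> s' ss'; rewrite indicE memNset ?mule0// => sp'.
    by move: ss'; rewrite (trivIset_cell sp sp') eqxx.
  by rewrite indicE mem_set// mule1 lee_fin; exact: omu.
rewrite big1 ?lee_fin// => s _; rewrite indicE memNset ?mule0// => sp.
by apply: np; exists s.
Qed.

(** Riemann sums are compared with the integral in one direction only: by uniform continuity, the
    value of [v^2] at the corner of a cell, less [e], is a lower bound of [u^2] on the cell. *)
Lemma avg_sqr_le (u : M -> R) : {within cube a L, continuous (u \o param i)} ->
  (\int[vol]_p (u p ^+ 2)%:E = 1)%E ->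
  forall e, 0 < e -> exists T0 : nat, forall T, (T0 <= T)%N ->
  mc * L ^+ n.+1 * (avg a L T.+1 (fun x => (u \o param i) x ^+ 2) - e) <= 1.
Proof.
move=> uc u1 e e0; set v := u \o param i in uc *.
have v2c : {within cube a L, continuous (fun x => v x ^+ 2)}.
  by under eq_fun do rewrite expr2; exact: within_continuousM.
have [d d0 dP] := uniform_cube v2c e0.
exists (Num.truncn (L / d)) => T TT.
have TL : L / T.+1%:R < d.
  rewrite ltr_pdivrMr// mulrC -ltr_pdivrMr// (lt_le_trans (truncnS_gt _))// ler_nat ltnS//.
pose om (s : {ffun 'I_n.+1 -> 'I_T.+1}) := Num.max (v (grid a L s) ^+ 2 - e) 0.
have om0 s : 0 <= om s by rewrite le_max lexx orbT.
have omu s p : cell s p -> om s <= u p ^+ 2.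
  move=> [ip ps]; rewrite ge_max sqr_ge0 andbT.
  have cx := cell_cube ps; have vp : v (chart i p) = u p by rewrite /v /= chartK.
  have gd : `|chart i p - grid a L s| < d.
    have LT0 : 0 <= L / T.+1%:R by rewrite divr_ge0// ltW.
    apply: le_lt_trans TL; apply/coord_normP => // j.
    have /andP[h1 h2] := ps j; 
    have -> : (chart i p - grid a L s) 0 j = chart i p 0 j - grid a L s 0 j by rewrite !mxE.
    by rewrite ger0_norm ?subr_ge0// lerBlDr addrC ltW.
  have := dP _ _ (grid_cube a L0 s) cx gd; rewrite vp ler_norml; lra.
have := sum_cell_le om0 omu (fun p => sqr_ge0 (u p)); rewrite u1 lee_fin.
apply: le_trans; rewrite -mulr_suml expr_div_n.
rewrite [leRHS](_ : _ = mc * L ^+ n.+1 * (T.+1%:R^-1 ^+ n.+1 * \sum_s om s)); last first.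
  by rewrite exprVn; ring.
apply: ler_wpM2l; first by rewrite mulr_ge0// exprn_ge0// ltW.
have -> : avg a L T.+1 (fun x => v x ^+ 2) - e = avg a L T.+1 (fun x => v x ^+ 2 - e).
  rewrite avgD; congr (_ + _); rewrite /avg sumr_const card_ffun !card_ord.
  by rewrite -[_ *+ (_ ^ _)]mulr_natl natrX mulrA -exprMn mulVf ?expr1n ?mul1r// pnatr_eq0.
rewrite /avg ler_wpM2l ?exprn_ge0 ?invr_ge0//; apply: ler_sum => s _.
by rewrite le_max lexx.
Qed.

End Volume.

(** * Uniform constants in a chart *)

Section CubeBounds.
Variables (R : realType) (n : nat).
Local Notation vec := 'rV[R]_n.+1.
Local Notation H := (@half_space R n).
Variables (a : vec) (L : R).
Hypothesis L0 : 0 < L.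

Lemma cube_bounded (f : vec -> R) : {within cube a L, continuous f} ->
  exists B : R, forall x, cube a L x -> `|f x| <= B.
Proof.
move=> fc; have [c _ cP] : exists2 c, c \in cube a L & forall t, t \in cube a L -> `|f t| <= `|f c|.
  apply: (@compact_EVT_max _ R (fun x => `|f x|) (cube a L)).
- by exists a => j; rewrite lexx lerDl ltW.
- exact: compact_cube.
- apply/within_continuousP => x cx e e0.
  have [d d0 dP] := (within_continuousP _ _).1 fc x cx e e0.
  exists d => // y cy yx; rewrite (le_trans (ler_dist_dist _ _))//; exact: dP.
by exists `|f c| => x cx; apply: cP; rewrite inE.
Qed.

Lemma cube_bounded_fam (I : finType) (F : I -> vec -> R) :
  (forall i, {within cube a L, continuous (F i)}) ->
  exists B : R, forall i x, cube a L x -> `|F i x| <= B.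
Proof.
move=> FC; have /choice[b bP] : forall i, exists B : R, forall x, cube a L x -> `|F i x| <= B.
  by move=> i; exact: cube_bounded.
exists (\sum_i `|b i|) => i x cx; rewrite (bigD1 i)//= (le_trans (bP i x cx))//.
by rewrite (le_trans (ler_norm _))// lerDl sumr_ge0.
Qed.

(** At a boundary point the cube rests on the boundary and is centred in the tangential directions
    only; at an interior point it is centred, and small enough to stay off the boundary. *)
Lemma cube_around (V : set vec) c : rel_open V -> V c ->
  exists (a : vec) (L : R), [/\ 0 < L, cube a L `<=` V,
    forall x, H x -> `|x - c| <= L / 2 -> cube a L x &
    forall x, outer_face a L x -> exists k, L / 2 <= `|x 0 k - c 0 k|].
Proof.
move=> Vo Vc; have [d d0 dP] := rel_openP Vo Vc; have Hc := rel_open_sub Vo Vc.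
have nearV (a' : vec) (L' : R) : 0 < L' -> L' < d -> 0 <= a' 0 0 ->
    (forall j, a' 0 j <= c 0 j <= a' 0 j + L') -> cube a' L' `<=` V.
  move=> L'0 L'd a'0 ac x cx; apply: dP.
    by have /andP[h _] := cx 0; exact: le_trans h.
  apply: le_lt_trans L'd; apply/coord_normP; first exact: ltW.
  move=> j; have /andP[h1 h2] := cx j; have /andP[h3 h4] := ac j; rewrite !mxE ler_norml; lra.
have [c0|c0] := eqVneq (c 0 0) 0.
  have L'0 : 0 < d / 2 by rewrite divr_gt0.
  pose a' : vec := \row_j (c 0 j - (j != 0)%:R * (d / 2 / 2)).
  have aE j : a' 0 j = c 0 j - (j != 0)%:R * (d / 2 / 2) by rewrite mxE.
  have a00 : a' 0 0 = 0 by rewrite aE c0 eqxx mul0r subr0.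
  have aj j : j != 0 -> a' 0 j = c 0 j - d / 2 / 2 by move=> j0; rewrite aE j0 mul1r.
  exists a', (d / 2); split=> //.
  - apply: nearV => //; first by lra.
      by rewrite a00.
    by move=> j; have [->|j0] := eqVneq j 0; rewrite ?a00 ?c0 ?aj//; lra.
  - move=> x Hx /coord_normP xc j; have := xc (ltac:(lra)) j; rewrite [(x - c) 0 j]mxE [(- c) 0 j]mxE ler_norml => /andP[h1 h2].
    have [j0|j0] := eqVneq j 0; last by rewrite aj//; lra.
    by move: h1 h2; rewrite j0 a00 c0 => h1 h2; have : 0 <= x 0 0 := Hx; lra.
  - move=> x [k [xk|[xk nk]]]; exists k; rewrite xk.
      have [k0|k0] := eqVneq k 0; first by rewrite k0 a00 c0 ger0_norm; lra.
      by rewrite aj// ger0_norm; lra.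
    have k0 : k != 0 by apply/eqP => k0; apply: nk; split=> //; rewrite a00.
    by rewrite aj// ler0_norm; lra.
have c0' : 0 < c 0 0 by rewrite lt_neqAle eq_sym c0 Hc.
pose L' := Num.min (d / 2) (c 0 0); have L'0 : 0 < L' by rewrite lt_min c0' divr_gt0.
have L'd : L' <= d / 2 by rewrite ge_min lexx.
have L'c : L' <= c 0 0 by rewrite ge_min lexx orbT.
pose a' : vec := \row_j (c 0 j - L' / 2).
have aE j : a' 0 j = c 0 j - L' / 2 by rewrite mxE.
exists a', L'; split=> //.
- by apply: nearV => // [||j]; rewrite ?aE; lra.
- move=> x Hx /coord_normP xc j; have := xc (ltac:(lra)) j; rewrite [(x - c) 0 j]mxE [(- c) 0 j]mxE ler_norml aE => /andP[h1 h2]; lra.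
- move=> x [k [xk|[xk nk]]]; exists k; rewrite xk aE.
    by rewrite ger0_norm; lra.
  by rewrite ler0_norm; lra.
Qed.

End CubeBounds.

(** Nonnegativity of the inverse form at [z - z m / K], where [K] bounds the form of [m]:
    ellipticity of the inverse follows from positivity and a bound on the entries. *)
Lemma posdef_inverse_ge (R : realType) n (m : 'M[R]_n.+1) (La : R) : m^T = m ->
  (forall v : 'rV[R]_n.+1, v != 0 -> 0 < (v *m m *m v^T) 0 0) -> 0 < La ->
  (forall k l, `|m k l| <= La) ->
  forall w, dot w w <= n.+1%:R * La * dot (w *m invmx m) w.
Proof.
move=> ms mp La0 mb z; have mu := posdef_unitmx mp.
have F0 w : 0 <= dot (w *m invmx m) w.
  pose y := w *m invmx m; have -> : w = y *m m by rewrite mulmxKV.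
  rewrite mulmxK// dotC dotE; have [->|y0] := eqVneq y 0; first by rewrite !mul0mx mxE.
  by rewrite ltW// mp.
pose K := n.+1%:R * La; have K0 : 0 < K by rewrite mulr_gt0.
have := F0 (z - K^-1 *: (z *m m)).
rewrite mulmxBl -scalemxAl mulmxK// -!scaleNr dotDl !dotDr !dotZl !dotZr.
have -> : dot (z *m invmx m) (z *m m) = dot z z.
  by rewrite -[X in dot _ (z *m X)]ms -dot_mulmx mulmxKV.
have := form_le mb z; rewrite -/K (dotC (z *m m) z) => fl.
have Kn : K != 0 by rewrite gt_eqF.
move: (dot z (z *m m)) (dot z z) (dot (z *m invmx m) z) fl => f s q fl h.
have : 0 <= q - 2 * s / K + f / K ^+ 2.
  by apply: le_trans h _; rewrite le_eqVlt; apply/orP; left; apply/eqP; field.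
have : f / K ^+ 2 <= s / K.
  by rewrite ler_pdivrMr ?exprn_gt0// (_ : s / K * K ^+ 2 = K * s)//; field.
have e2 : 2 * s / K = s / K + s / K by field.
move=> h1 h2; have : s / K <= q by lra.
by rewrite ler_pdivrMr// mulrC.
Qed.

(** * Cutoffs in a cube *)

Section Cutoff.
Variables (R : realType) (n : nat).
Local Notation vec := 'rV[R]_n.+1.
Local Notation H := (@half_space R n).
Variables (c : vec) (s : R).
Hypothesis s0 : 0 < s.
Implicit Types x : vec.

Definition sqnorm x : R := dot (x - c) (x - c).
(** Equal to 1 for [sqnorm <= s] and to 0 for [sqnorm >= 2 s]. It is built on the Euclidean square,
    as the maximum norm is not differentiable. *)
Definition cutoff x : R := step (2 - sqnorm x / s).

Lemma sqnormE x : sqnorm x = sqdist 1%:M c x.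
Proof. by rewrite /sqdist mulmx1. Qed.

Lemma has_pderiv_sqnorm k x : has_pderiv sqnorm k x (2 * (x 0 k - c 0 k)).
Proof.
have h := @has_pderiv_sqdist R n 1%:M (trmx1 R n.+1) c k x.
rewrite (_ : sqnorm = sqdist 1%:M c); last by apply/funext => y; exact: sqnormE.
by move: h; rewrite /adist mulmx1 !mxE.
Qed.

Lemma sqnorm_le x (r : R) : `|x - c| <= r -> sqnorm x <= n.+1%:R * r ^+ 2.
Proof.
move=> xr; apply: le_trans (dot_le_norm _) _; apply: ler_wpM2l => //.
by rewrite ler_sqr ?nnegrE// (le_trans _ xr).
Qed.

Lemma sqnorm_ge x k (r : R) : 0 <= r -> r <= `|x 0 k - c 0 k| -> r ^+ 2 <= sqnorm x.
Proof.
move=> r0 xr; apply: le_trans (sqr_coord_le_dot (x - c) k).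
by rewrite -(real_normK (num_real ((x - c) 0 k))) ler_sqr ?nnegrE// !mxE.
Qed.

Lemma is_derive_cutoff (t : R) : is_derive t 1 (fun t : R => step (2 - t / s)) (- s^-1 * dstep (2 - t / s)).
Proof.
have hc : is_derive t 1 (fun t : R => 2 - t / s) (- s^-1).
  have -> : (fun t : R => 2 - t / s) = (fun t : R => 2 - s^-1 * t).
    by apply/funext => y; rewrite mulrC.
  by apply: is_derive_eq; rewrite /GRing.scale/=; ring.
have := @is_derive1_comp _ (@step R) _ t _ _ (is_derive_step _) hc.
by rewrite mulrC.
Qed.

Lemma Ck1_cutoff V : V `<=` H -> Ck 1 V cutoff.
Proof.
move=> VH; apply: (@Ck1_comp _ _ _ VH (fun t : R => step (2 - t / s)) (fun t => - s^-1 * dstep (2 - t / s))).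
- rewrite (_ : sqnorm = sqdist 1%:M c); last by apply/funext => y; exact: sqnormE.
  exact: Ck1_sqdist.
- by move=> x _; exact: is_derive_cutoff.
- move=> x _; apply: cvgM; first exact: cvg_cst.
  apply: (@continuous_comp _ _ _ (fun t : R => 2 - t / s) (@dstep R)); last exact: continuous_dstep.
  by apply: cvgB; [exact: cvg_cst|apply: cvgM; [exact: cvg_id|exact: cvg_cst]].
Qed.

Lemma pderiv_cutoff k x : H x -> pderiv cutoff k x =
  - s^-1 * dstep (2 - sqnorm x / s) * (2 * (x 0 k - c 0 k)).
Proof.
move=> Hx; apply: pderivE => //.
have h := has_pderiv_comp (@has_pderiv_sqnorm k x) (is_derive_cutoff (sqnorm x)).
exact: h.
Qed.

Lemma cutoff_itv x : 0 <= cutoff x <= 1. Proof. exact: step_itv. Qed.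

Lemma cutoff_eq1 x : sqnorm x <= s -> cutoff x = 1.
Proof.
by move=> h; apply: step_ge1; have h1 : sqnorm x / s <= 1; [rewrite ler_pdivrMr// mul1r|lra].
Qed.

Lemma cutoff_eq0 x : 2 * s <= sqnorm x -> cutoff x = 0.
Proof.
by move=> h; apply: step_le0; have h1 : 2 <= sqnorm x / s; [rewrite ler_pdivlMr|lra].
Qed.

Lemma pderiv_cutoff_eq0 k x : H x -> 2 * s <= sqnorm x -> pderiv cutoff k x = 0.
Proof.
move=> Hx h; rewrite pderiv_cutoff// dstep_eq0 ?mulr0 ?mul0r//; left.
by have h1 : 2 <= sqnorm x / s; [rewrite ler_pdivlMr|lra].
Qed.

Lemma pderiv_cutoff_le k x (l : R) : H x -> `|x 0 k - c 0 k| <= l ->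
  `|pderiv cutoff k x| <= 4 * l / s.
Proof.
move=> Hx xl; rewrite pderiv_cutoff//; have /andP[d0 d2] := dstep_itv (2 - sqnorm x / s).
have -> : 4 * l / s = s^-1 * 2 * (2 * l) by field; rewrite gt_eqF.
have is0 : 0 < s^-1 by rewrite invr_gt0.
rewrite normrM normrM normrN (gtr0_norm is0) (ger0_norm d0).
apply: ler_pM => //; [by rewrite mulr_ge0// ltW|by rewrite ler_wpM2l// ltW|].
by rewrite normrM ger0_norm// ler_wpM2l.
Qed.

End Cutoff.

(** * The equation in a chart as an elliptic problem *)

Section ChartElliptic.
Variables (R : realType) (n : nat) (M : ptopologicalType) (S : smooth_manifold R n M).
Local Notation vec := 'rV[R]_n.+1.
Variables (g : riemannian_metric S) (i : Defs.index S).

Definition weighted_inverse (x : vec) : 'M[R]_n.+1 := density g i x *: invmx (metric g i x).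

Lemma conormal_weighted_inverse u : conormal weighted_inverse (u \o param i) = flux g i u.
Proof. by apply/funext => x; rewrite /conormal /weighted_inverse -scalemxAr. Qed.

Lemma Ck1_weighted_inverse k l : Ck 1 (codom i) (fun x => weighted_inverse x k l).
Proof.
have VH := rel_open_sub (rel_open_codom i).
under eq_fun do rewrite mxE.
by apply: Ck1M => //; [exact: Ck1_density|exact: Ck1_inverse_metric].
Qed.

Lemma Ck1_density_inverse : Ck 1 (codom i) (fun x => (density g i x)^-1).
Proof.
have VH := rel_open_sub (rel_open_codom i).
apply: (@Ck1_comp _ _ _ VH (fun t => t^-1) (fun t => - t ^- 2)).
- exact: Ck1_density.
- by move=> x Vx; apply: is_derive_inv; rewrite gt_eqF// density_gt0.
- move=> x Vx; apply: cvgN; apply: cvgV; first by rewrite expf_neq0// gt_eqF// density_gt0.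
  exact: exprn_continuous.
Qed.

(** Continuity on a compact cube bounds all the data. Every [K] above [B] is admissible, so that one
    constant can also bound the gradients of the cutoffs. *)
Lemma chart_elliptic (a : vec) (L : R) : 0 < L -> cube a L `<=` codom i ->
  exists B : R, forall K, B <= K ->
    elliptic (codom i) a L weighted_inverse (density g i) K.
Proof.
move=> L0 cV; have Vo := rel_open_codom i.
have cC f : Ck 0 (codom i) f -> {within cube a L, continuous f} by exact: continuous_subspaceW cV.
have C1 f : Ck 1 (codom i) f -> {within cube a L, continuous f}.
  by move=> /(@Ck_le _ _ 0 1 _ _ isT)/cC.
have [b1 B1] := cube_bounded_fam L0 (fun kl : 'I_n.+1 * 'I_n.+1 => C1 _ (Ck1_weighted_inverse kl.1 kl.2)).
have [b2 B2] := cube_bounded_fam L0 (fun klm : 'I_n.+1 * 'I_n.+1 * 'I_n.+1 =>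
  cC _ (Ck_pderiv klm.2 (Ck1_weighted_inverse klm.1.1 klm.1.2))).
have [b3 B3] := cube_bounded L0 (C1 _ (@Ck1_density _ _ _ _ g i)).
have [b4 B4] := cube_bounded L0 (C1 _ Ck1_density_inverse).
have [b5 B5] := cube_bounded_fam L0 (fun k => cC _ (Ck_pderiv k (@Ck1_density _ _ _ _ g i))).
have [b6 B6] := cube_bounded_fam L0 (fun kl : 'I_n.+1 * 'I_n.+1 =>
  C1 _ (@Ck1_metric _ _ _ _ g i kl.1 kl.2)).
pose La : R := `|b6| + 1; have La0 : 0 < La by rewrite ltr_wpDl.
have nLa : 0 <= n.+1%:R * La * `|b4| by rewrite mulr_ge0// mulr_ge0// ltW.
have n1 : 1 <= n.+1%:R :> R by rewrite ler1n.
exists (n.+1%:R + n.+1%:R * La * `|b4| + `|b1| + `|b2| + `|b3| + `|b4| + `|b5|) => K BK.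
have [p1 p2 p3 p4 p5] : [/\ 0 <= `|b1|, 0 <= `|b2|, 0 <= `|b3|, 0 <= `|b4| & 0 <= `|b5|] by [].
have := (ler_norm b1, ler_norm b2, ler_norm b3, ler_norm b4, ler_norm b5).
move=> [[[[q1 q2] q3] q4] q5].
have dP x : cube a L x -> 0 < density g i x by move=> /cV; exact: density_gt0.
have d4 x : cube a L x -> (density g i x)^-1 <= `|b4|.
  by move=> cx; rewrite (le_trans (ler_norm _))// (le_trans (B4 x cx)).
split=> //.
- exact: Ck1_weighted_inverse.
- by move=> x Vx; rewrite /weighted_inverse linearZ/= trmx_inv (Defs.metric_sym g Vx).
- exact: Ck1_density.
- lra.
- lra.
- by move=> x k l cx; have := B1 (k, l) x cx => /=; lra.
- by move=> x m k l cx; have := B2 (k, l, m) x cx => /=; lra.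
- move=> x w cx; rewrite /weighted_inverse -scalemxAr dotZl mulrA.
  have Vx := cV x cx; have bLa k l : `|metric g i x k l| <= La.
    by rewrite /La; have := B6 (k, l) x cx => /=; have := ler_norm b6; lra.
  have h := posdef_inverse_ge (Defs.metric_sym g Vx) (metric_pos g Vx) La0 bLa w.
  have q0 : 0 <= dot (w *m invmx (metric g i x)) w.
    have : 0 <= n.+1%:R * La * dot (w *m invmx (metric g i x)) w by apply: le_trans h; exact: dot_ge0.
    by rewrite pmulr_rge0// mulr_gt0.
  apply: le_trans h _; apply: ler_wpM2r => //.
  rewrite -ler_pdivrMr ?dP//; have nLa' : 0 <= n.+1%:R * La by rewrite mulr_ge0// ltW.
  by have := ler_wpM2l nLa' (d4 x cx); lra.
- move=> x cx; rewrite -ler_pdivrMr ?dP// mul1r; have := d4 x cx; lra.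
- by move=> x cx; have := B3 x cx; have := ler_norm (density g i x); lra.
- by move=> x k cx; have := B5 k x cx; lra.
Qed.

Lemma chart_solution u lam : Ck_on S 2 u -> (forall p, laplacian g u p + lam ^+ 2 * u p = 0) ->
  dirichlet S u \/ neumann g u ->
  solution (codom i) weighted_inverse (density g i) lam (u \o param i).
Proof.
move=> Cu eqn bc; split; first exact: Cu.
- move=> x Vx; rewrite conormal_weighted_inverse.
  have := eqn (param i x); rewrite laplacian_chart// => e.
  have d0 : density g i x != 0 by rewrite gt_eqF// density_gt0.
  set s := \sum_k _ in e *; have -> : s = density g i x * ((density g i x)^-1 * s) by rewrite mulVKf.
  rewrite (_ : _^-1 * s = - (lam ^+ 2 * u (param i x))); first by rewrite /=; ring.
  by apply/eqP; rewrite -addr_eq0 e.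
- have Cu1 : Ck_on S 1 u by move=> j; exact: Ck_le (Cu j).
  case: bc => bc; [left|right] => x Vx x0; first exact: dirichlet_chart bc Vx x0.
  by rewrite conormal_weighted_inverse; exact: neumann_chart.
Qed.

End ChartElliptic.

(** * Uniform estimate near a point of a chart *)

Section ChartEstimate.
Variables (R : realType) (n : nat) (M : ptopologicalType) (S : smooth_manifold R n M).
Local Notation vec := 'rV[R]_n.+1.
Local Notation H := (@half_space R n).
Variables (g : riemannian_metric S) (vol : {measure set (borel M) -> \bar R}).
Hypotheses (n0 : (0 < n)%N) (hvol : is_riemannian_volume g vol).

Lemma mor_const_ge0 (K : R) : 0 <= K -> 0 <= mor_const K.
Proof. by move=> /(exprn_ge0 34); rewrite /mor_const; move: (K ^+ 34) => m m0; lra. Qed.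

Lemma scaled_radius (kap lam : R) : 0 < kap -> 1 <= lam ->
  [/\ 0 < kap / lam, kap / lam <= kap & kap / lam * lam = kap].
Proof.
move=> k0 l1; have l0 : 0 < lam by lra.
split; first by rewrite divr_gt0.
  by rewrite ler_pdivrMr// ler_peMr// ltW.
by rewrite divfK// gt_eqF.
Qed.

(** The constants depend on the chart and on [c] only. With [rr = kap / lam], the factor
    [rr^-(n+1) / lam] of [local_estimate] becomes a multiple of [lam^n]. *)
Lemma chart_estimate (i : Defs.index S) c : codom i c ->
  exists r0 C : R, 0 < r0 /\ forall (lam : R) (u : M -> R) (x0 : vec),
    1 <= lam -> Ck_on S 2 u -> (forall p, laplacian g u p + lam ^+ 2 * u p = 0) ->
    dirichlet S u \/ neumann g u -> (\int[vol]_p (u p ^+ 2)%:E = 1)%E ->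
    codom i x0 -> `|x0 - c| <= r0 -> (forall p, `|u p| <= `|u (param i x0)|) ->
    u (param i x0) ^+ 2 <= C * lam ^+ n.
Proof.
move=> Vc; have Vo := rel_open_codom i; have VH := rel_open_sub Vo.
have [a [L [L0 cV near outer]]] := cube_around Vo Vc.
have [B EB] := chart_elliptic g L0 cV.
have Hc := VH _ Vc.
have cc : cube a L c by apply: near => //; rewrite subrr normr0 divr_ge0// ltW.
(* [64 / L] is [4 L / s] for the [s] below, a bound for the gradients of the cutoffs. *)
have L64 : 0 < 64 / L by rewrite divr_gt0.
have [K [E K1 Kn K64]] : exists K : R,
    [/\ elliptic (codom i) a L (weighted_inverse g i) (density g i) K, 1 <= K, n.+1%:R <= K & 64 / L <= K].
  have n1 : 1 <= n.+1%:R :> R by rewrite ler1n.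
  have BB := ler_norm B; have B0 := normr_ge0 B; exists (`|B| + 64 / L + n.+1%:R).
  by split; [apply: EB|..]; lra.
have K0 : 0 < K by lra.
have Km0 : 0 < K^-1 by rewrite invr_gt0.
(* [chi] and [chi1] will be the cutoffs at [s] and [2 s]: [chi1] is 1 on the support of [chi], and 0
   once [sqnorm >= 4 s = (L / 2)^2], hence on the outer faces. *)
pose s := L ^+ 2 / 16; have s0 : 0 < s by rewrite divr_gt0// exprn_gt0.
have s20 : 0 < 2 * s by rewrite mulr_gt0.
(* The ball [sqdist <= rr^2] around [x0] will lie in [|x - c| <= 2 r0], where
   [sqnorm <= 4 n.+1 r0^2 <= 4 (K r0)^2 = s], hence [chi = 1]. *)
pose r0 := L / (8 * K); have r00 : 0 < r0 by rewrite divr_gt0// mulr_gt0.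
have r0K : K * r0 = L / 8 by rewrite /r0; field; rewrite gt_eqF.
have r0L : r0 <= L / 8 by rewrite -r0K ler_peMl// ltW.
clearbody r0; have mv0 : 0 < mv_const n L K by exact: mv_const_gt0 E.
pose Q := 16 * (8 * K / L) ^+ n.+1.
pose P := 2 * K + K ^+ 13 * (n%:R + 8) / 2.
have Q0 : 0 < Q by rewrite mulr_gt0// exprn_gt0// divr_gt0// mulr_gt0.
have P0 : 0 < P.
  have : 0 <= K ^+ 13 * (n%:R + 8) / 2 by apply: divr_ge0 => //; apply: mulr_ge0; [rewrite exprn_ge0// ltW|rewrite addr_ge0].
  by rewrite /P; lra.
(* [kap <= r0 / K] keeps the balls of radius [rr] near [c]; the last bound yields [small], where
   [kap <= 1] lets [kap] stand for [kap^2]. *)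
have [kap [kap0 kapr kap1 kapm]] : exists kap : R,
    [/\ 0 < kap, kap <= r0 / K, kap <= 1 & kap * (Q * P) <= mv_const n L K].
  have QP0 : 0 < Q * P by exact: mulr_gt0.
  exists (Num.min (Num.min (r0 / K) 1) (mv_const n L K / (Q * P))); split.
  - by rewrite !lt_min ltr01 andbT (divr_gt0 r00 K0) (divr_gt0 mv0 QP0).
  - by rewrite !ge_min lexx.
  - by rewrite !ge_min lexx orbT.
  - by rewrite -ler_pdivlMr// !ge_min lexx !orbT.
pose C1 : R := 2 ^+ n.+4 / kap ^+ n.+1 * mor_const K.
have C10 : 0 <= C1.
  have h1 : 0 <= 2 ^+ n.+4 / kap ^+ n.+1 :> R by rewrite divr_ge0// exprn_ge0// ltW.
  exact: mulr_ge0 h1 (mor_const_ge0 (ltW K0)).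
have Ln0 : 0 < L ^+ n.+1 by rewrite exprn_gt0.
exists r0, (4 / mv_const n L K * (C1 * (K / L ^+ n.+1 + 1) + 1)); split=> // lam u x0 lam1 Cu eqn bc u1 Vx0 x0c umax.
have lam0 : 0 < lam by lra.
have Hx0 := VH _ Vx0.
have cx0 : cube a L x0 by apply: near => //; lra.
have [rr0 rrk rrl] := scaled_radius kap0 lam1; move: (kap / lam) rr0 rrk rrl => rr rr0 rrk rrl.
have rrr : K * rr <= r0 by rewrite mulrC -ler_pdivlMr//; lra.
have far x (r : R) : 0 <= r -> sqdist (Amx (weighted_inverse g i) x0) x0 x <= r ^+ 2 -> `|x - c| <= K * r + r0.
  move=> r_ge0 h; rewrite -[x - c](subrKA x0) (le_trans (ler_normD _ _))// lerD//.
  have := sqdist_norm E cx0 r_ge0 h; exact.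
have Sol := chart_solution i Cu eqn bc.
have vmax x : cube a L x -> (u \o param i) x ^+ 2 <= (u \o param i) x0 ^+ 2.
  move=> _; rewrite /= -(real_normK (num_real (u _))) -(real_normK (num_real (u (param i x0)))).
  by rewrite ler_sqr ?nnegrE.
have outer' x : cube a L x -> outer_face a L x ->
    4 * rr ^+ 2 <= sqdist (Amx (weighted_inverse g i) x0) x0 x.
  move=> cx /outer[k xk]; rewrite leNgt; apply/negP => h.
  have rr2 : 0 <= 2 * rr by lra.
  have := far x (2 * rr) rr2; rewrite exprMn -natrX => /(_ (ltW h)) h1.
  have := coord_norm_le (x - c) k; rewrite [(x - c) 0 k]mxE [(- c) 0 k]mxE; lra.
have small : 16 * (8 * K / L) ^+ n.+1 * ((2 * lam ^+ 2 * K + K ^+ 13 * (n%:R + 8) / 2) * rr ^+ 2)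
    <= mv_const n L K.
  suff /(ler_wpM2l (ltW Q0)) h : (2 * lam ^+ 2 * K + K ^+ 13 * (n%:R + 8) / 2) * rr ^+ 2 <= P * kap.
    by apply: le_trans h _; rewrite mulrA mulrC.
  have e1 : rr ^+ 2 * lam ^+ 2 = kap ^+ 2 by rewrite -exprMn rrl.
  have rr2 : rr ^+ 2 <= kap ^+ 2 by rewrite ler_sqr ?nnegrE// ltW.
  have k2 : kap ^+ 2 <= kap by rewrite expr2 ger_pMr.
  have : 0 <= K ^+ 13 * (n%:R + 8) / 2 by apply: divr_ge0 => //; apply: mulr_ge0; [rewrite exprn_ge0// ltW|rewrite addr_ge0].
  rewrite /P; move: (K ^+ 13 * (n%:R + 8) / 2) => q q0.
  have h1 := ler_wpM2l q0 rr2; have h2 := ler_wpM2l q0 k2.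
  have h3 := ler_wpM2l (ltW K0) k2.
  have -> : (2 * lam ^+ 2 * K + q) * rr ^+ 2 = 2 * (K * (rr ^+ 2 * lam ^+ 2)) + q * rr ^+ 2 by ring.
  by rewrite e1; lra.
have cube_coord x k : cube a L x -> `|x 0 k - c 0 k| <= L.
  move=> cx; have /andP[h1 h2] := cx k; have /andP[h3 h4] := cc k.
  by rewrite ler_norml; lra.
have Hcube x : cube a L x -> H x by move=> cx; apply: VH; exact: cV.
have rlam : rr * lam <= 20 * K ^+ 10.
  rewrite rrl (le_trans kap1)//; have : 1 <= K ^+ 10 by rewrite exprn_ege1.
  lra.
have [T1 T1P] : exists T0 : nat, forall T, (T0 <= T)%N ->
    mv_const n L K / 4 * (u \o param i) x0 ^+ 2 <= 2 ^+ n.+4 / rr ^+ n.+1 * (mor_const K / lam) *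
      avg a L T.+1 (fun x => (u \o param i) x ^+ 2) + 1.
  apply: (local_estimate E Sol n0 cx0 vmax rr0 outer' small lam1
    (chi := cutoff c s) (chi1 := cutoff c (2 * s)) _ _ _ _ _ _ _ _ _ rlam ltr01).
  - exact: Ck1_cutoff.
  - exact: Ck1_cutoff.
  - by move=> x _; exact: cutoff_itv.
  - by move=> x _; exact: cutoff_itv.
  - move=> x k cx; rewrite (le_trans (pderiv_cutoff_le s0 (Hcube _ cx) (cube_coord x k cx)))//.
    by rewrite (_ : 4 * L / s = 64 / L)// /s; field; rewrite gt_eqF.
  - move=> x k cx; rewrite (le_trans (pderiv_cutoff_le s20 (Hcube _ cx) (cube_coord x k cx)))//.
    rewrite (_ : 4 * L / (2 * s) = (64 / L) / 2); last by rewrite /s; field; rewrite gt_eqF.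
    by lra.
  - move=> x cx /outer[k xk]; apply: cutoff_eq0 => //.
    rewrite (_ : 2 * (2 * s) = (L / 2) ^+ 2); last by rewrite /s; field.
    by apply: sqnorm_ge xk; rewrite divr_ge0// ltW.
  - move=> x cx; have [h|h] := leP (sqnorm c x) (2 * s); first by left; exact: cutoff_eq1.
    right; split=> [|k]; first by apply: cutoff_eq0 => //; exact: ltW.
    by apply: pderiv_cutoff_eq0 => //; [exact: Hcube|exact: ltW].
  - move=> x cx h; apply: cutoff_eq1 => //.
    have h1 := far x rr (ltW rr0) h.
    have h2 : `|x - c| <= 2 * r0 by lra.
    apply: le_trans (sqnorm_le h2) _.
    have -> : s = K * r0 * (K * r0) * 4 by rewrite r0K /s; field.
    have : n.+1%:R <= K * K by rewrite (le_trans Kn)// ler_peMr// ltW.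
    move=> /(ler_wpM2r (exprn_ge0 2 (ltW r00))).
    by rewrite exprMn; move: (n.+1%:R : R) => d; nra.
have mcP x : cube a L x -> K^-1 <= density g i x.
  by move=> cx; rewrite -div1r ler_pdivrMr// mulrC; exact: el_rho_ge E _ cx.
have uc : {within cube a L, continuous (u \o param i)}.
  exact: continuous_subspaceW cV (Ck_continuous (Cu i)).
have [T2 T2P] := avg_sqr_le hvol L0 cV (ltW Km0) mcP uc u1 ltr01.
have := T1P _ (leq_maxl T1 T2); have := T2P _ (leq_maxr T1 T2).
move: (avg _ _ _ _) => A hA.
have {}hA : A <= K / L ^+ n.+1 + 1.
  rewrite -lerBlDr ler_pdivlMr//; move: hA; rewrite -mulrA mulrC ler_pdivrMr// mul1r.
  by rewrite mulrC.
have e1 : 2 ^+ n.+4 / rr ^+ n.+1 * (mor_const K / lam) = C1 * lam ^+ n.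
  have -> : rr = kap / lam by rewrite -rrl mulfK// gt_eqF.
  rewrite /C1 expr_div_n [lam ^+ n.+1]exprS; field.
  by rewrite !gt_eqF ?exprn_gt0.
rewrite e1 /=; set W := u _ ^+ 2; move=> hW.
have ln1 : 1 <= lam ^+ n by rewrite exprn_ege1.
have m40 : 0 <= 4 / mv_const n L K by rewrite divr_ge0// ltW.
have -> : W = 4 / mv_const n L K * (mv_const n L K / 4 * W) by field; rewrite gt_eqF.
rewrite -[leRHS]mulrA; apply: ler_wpM2l => //; apply: le_trans hW _.
have := ler_wpM2l C10 hA; move=> /(ler_wpM2l (le_trans ler01 ln1)).
move: (K / L ^+ n.+1) (lam ^+ n) ln1 => X l l1; lra.
Qed.

End ChartEstimate.

(** * From charts to the compact manifold *)

Section SupNorm.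
Variables (R : realType) (n : nat) (M : ptopologicalType) (S : smooth_manifold R n M).
Local Notation vec := 'rV[R]_n.+1.
Variables (g : riemannian_metric S) (vol : {measure set (borel M) -> \bar R}).

Lemma Ck_on_continuous m (u : M -> R) : Ck_on S m u -> continuous u.
Proof.
move=> Cu p; pose i := chart_at S p; have ip : dom i p by exact: dom_chart_at.
have ipn : nbhs p (dom i) by apply: open_nbhs_nbhs; split=> //; exact: dom_open.
have Vc : codom i (chart i p) by exists p.
apply/cvgrPdist_le => e e0.
have [d d0 dP] := (within_continuousP _ _).1 (Ck_continuous (Cu i)) _ Vc e e0.
have /open_nbhs_nbhs/filterS : open_nbhs p [set q | dom i q /\ `|chart i q - chart i p| < d].
  split; last by split=> //; rewrite subrr normr0.
  apply: (@open_chart _ _ _ _ _ [set y | `|y - chart i p| < d]).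
  rewrite (_ : [set y | _] = ball (chart i p) d); first exact: ball_open.
  by apply/seteqP; split => y; rewrite -ball_normE/= distrC.
apply=> q [iq qd]; have := dP (chart i q) (ex_intro2 _ _ q iq erefl) qd.
by rewrite /= !chartK// distrC.
Qed.

Lemma Lnorm2_eq1 (u : M -> R) : ('N[vol]_2%:E [EFin \o (u : borel M -> R)] = 1)%E ->
  (\int[vol]_p (u p ^+ 2)%:E = 1)%E.
Proof.
move=> u1; have := @powR_Lnorm _ (borel M) R vol (EFin \o u) 2 (lt0r_neq0 (ltr0Sn _ _)).
rewrite u1 (poweR_EFin 1 2) powR1 => ->; apply: eq_integral => p _ /=.
by rewrite powR_mulrn// real_normK ?num_real.
Qed.

Hypotheses (n0 : (0 < n)%N) (hvol : is_riemannian_volume g vol).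

(** Only solutions whose maximum sits at [q] are concerned. This makes the estimate a local property
    of [q], to which compactness applies although the maximum point varies with [u]. *)
Definition sup_bound (C : R) (q : M) := forall (lam : R) (u : M -> R), 1 <= lam -> Ck_on S 2 u ->
  (forall p, laplacian g u p + lam ^+ 2 * u p = 0) -> dirichlet S u \/ neumann g u ->
  (\int[vol]_p (u p ^+ 2)%:E = 1)%E -> (forall p, `|u p| <= `|u q|) -> u q ^+ 2 <= C * lam ^+ n.

(** The constant runs along the filter at infinity, so that the covering form of compactness returns
    one [C] valid at every point. *)
Lemma sup_bound_near (p : M) : \forall q \near p & C \near +oo%R, sup_bound C q.
Proof.
pose i := chart_at S p; have ip : dom i p by exact: dom_chart_at.
have Vc : codom i (chart i p) by exists p.
have [r [C0 [r0 est]]] := chart_estimate n0 hvol Vc.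
exists ([set q | dom i q /\ `|chart i q - chart i p| < r], [set C | C0 <= C]).
  split; last by apply: nbhs_pinfty_ge; exact: num_real.
  apply: open_nbhs_nbhs; split; last by split=> //; rewrite subrr normr0.
  apply: (@open_chart _ _ _ _ _ [set y | `|y - chart i p| < r]).
  rewrite (_ : [set y | _] = ball (chart i p) r); first exact: ball_open.
  by apply/seteqP; split => y; rewrite -ball_normE/= distrC.
move=> [q C]/= [[iq qr] C0C] lam u l1 Cu eqn bc u1 umax.
have := est lam u (chart i q) l1 Cu eqn bc u1 (ex_intro2 _ _ q iq erefl) (ltW qr).
rewrite chartK// => /(_ umax) h; apply: le_trans h _.
by apply: ler_wpM2r => //; rewrite exprn_ge0// (le_trans _ l1).
Qed.

End SupNorm.

Theorem theorem1 (R : realType) (n : nat) (hn : (2 <= n.+1)%N)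
    (M : ptopologicalType) (S : smooth_manifold R n M)
    (Mcompact : compact [set: M]) (g : riemannian_metric S)
    (vol : {measure set (borel M) -> \bar R})
    (hvol : is_riemannian_volume g vol) :
  exists C lambda0 : R, 0 < lambda0 /\
    forall (lambda : R) (u : M -> R),
      lambda0 <= lambda ->
      Ck_on S 2 u ->
      (forall p, laplacian g u p + lambda ^+ 2 * u p = 0) ->
      dirichlet S u \/ neumann g u ->
      ('N[vol]_2%:E [EFin \o (u : borel M -> R)] = 1)%E ->
      exists x0 : M, (forall x, `|u x| <= `|u x0|) /\
        `|u x0| <= C * lambda `^ ((n.+1%:R - 1) / 2).
Proof.
have h := (compact_near_coveringP _).1 Mcompact R +oo%R (fun C q => sup_bound g vol C q) _
  (fun p _ => sup_bound_near hn hvol p).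
have [C [C0 CP]] : exists C : R, 0 <= C /\ forall q, sup_bound g vol C q.
  (* Intersected with [C >= 0], which splits the square root of the product at the end. *)
  have := filter_ex (filterI (nbhs_pinfty_ge (@real0 R)) (h _)).
  by move=> [C [C0 CP]]; exists C; split=> // q; exact: CP.
exists (Num.sqrt C), 1; split=> // lam u l1 Cu eqn bc /Lnorm2_eq1 u1.
have [x0 _ x0P] : exists2 x0, x0 \in [set: M] & forall t, t \in [set: M] -> `|u t| <= `|u x0|.
  apply: (@compact_EVT_max _ R (fun x => `|u x|) [set: M]) => //; first by exists point.
  apply: continuous_subspaceT => x; apply: continuous_comp (@norm_continuous _ _ _).
  exact: Ck_on_continuous Cu x.
have umax x : `|u x| <= `|u x0| by apply: x0P; rewrite inE.
exists x0; split=> //; have l0 : 0 <= lam by rewrite (le_trans _ l1).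
(* The dimension is [n.+1], so the exponent is [n / 2]. *)
have -> : lam `^ ((n.+1%:R - 1) / 2) = Num.sqrt (lam ^+ n).
  by rewrite powRrM -natr1 addrK powR_mulrn// powR12_sqrt// exprn_ge0.
rewrite -sqrtrM// -sqrtr_sqr ler_wsqrtr//; exact: CP.
Qed.
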